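(* Let $m\ge3$. For $r,p\in(0,1)$ let $X$ be a tree-indexed Markov chain on the octopus tree $T_m$ with parameters $(r,p)$. Then there exists a constant $r_2(m)\in(0,1)$, not depending on $p$, such that for all $r,p\in(0,1)$: (a) $X\notin\mathcal{R}$ if $r<r_1(m)$, and (b) $X\in\mathcal{R}$ if $r\ge r_2(m)$. Moreover, (c) $r_2(3)=r_1(3)=1/2$ (that is, for $m=3$ statement (b) holds with $r_2(3)=r_1(3)=1/2$).
   Context: Octopus tree. For $m\ge3$, $T_m$ is the infinite tree consisting of $m$ disjoint semi-infinite paths whose endpoints are joined at one vertex, i.e. the tree with one vertex $o$ of degree $m$ and all other vertices of degree two. Poisson representable processes. Let $S$ be a finite or countably infinite set and $\nu$ a $\sigma$-finite (nonnegative) measure on $\mathcal{P}(S)\setminus\{\emptyset\}$. Let $Z$ be a Poisson process on $\mathcal{P}(S)\setminus\{\emptyset\}$ with intensity measure $\nu$ (a random collection of nonempty subsets of $S$), and set $X^\nu_i=1$ if $i\in\bigcup_{B\in Z}B$ and $X^\nu_i=0$ otherwise, $i\in S$. $\mathcal{R}$ is the set of all $\{0,1\}$-valued processes $(X_i)_{i\in S}$ that are equal in distribution to $X^\nu$ for some such measure $\nu$. Tree-indexed Markov chain. Let $T$ be a tree with vertex set $V(T)$ and finite vertex degrees, and $r,p\in[0,1]$. Fix a root $o\in V(T)$. Let $(R_v)_{v\in V(T)}$ be independent with $P(R_v=0)=r$, $P(R_v=1)=1-r$. The tree-indexed Markov chain $X=(X(v))_{v\in V(T)}$ with parameters $(r,p)$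 is defined by $X(o)=R_o$ and, moving outwards from $o$, for each $v\neq o$ with parent $v^-$ (the neighbor of $v$ closest to $o$), independently, $X(v)=X(v^-)$ with probability $1-p$ and $X(v)=R_v$ with probability $p$. Its law does not depend on the choice of $o$. Threshold. For $n\ge3$, $r^{(n)}$ is the largest strictly negative root of the polylogarithm $\mathrm{Li}_{1-n}(z)=\sum_{k\ge1}k^{n-1}z^k$ (extended by analytic continuation; it is a rational function), and $r_1(n)=1/(1-r^{(n)})$. *)

(* Defs.v *)
From HB Require Import structures.
From mathcomp Require Import all_boot all_order all_algebra.
From mathcomp Require Import all_classical all_reals all_analysis.
From mathcomp Require Import measurable_realfun.
Set Implicit Arguments.
Unset Strict Implicit.
Unset Printing Implicit Defensive.
Import Order.TTheory GRing.Theory Num.Theory.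
Import numFieldNormedType.Exports.
Local Open Scope classical_set_scope.
Local Open Scope ring_scope.

Definition mutually_independent d (T : measurableType d) (R : realType)
    (P : probability T R) (I : eqType) d' (U : measurableType d')
    (X : I -> T -> U) : Prop :=
  forall (s : seq I) (A : I -> set U),
    uniq s -> (forall i, measurable (A i)) ->
    P (\bigcap_(i in [set` s]) (X i @^-1` A i)) =
    (\prod_(i <- s) P (X i @^-1` A i))%E.

Definition cylinders (S : Type) : set (set (S -> bool)) :=
  [set A | exists i b, A = [set x : S -> bool | x i = b]].

(* Equality of the laws on {0,1}^S with its product sigma-algebra; the two
   processes may live on different probability spaces. *)
Definition eq_in_distribution (R : realType) (S : Type)
    d1 (T1 : measurableType d1) (P1 : probability T1 R) (X1 : S -> T1 -> bool)
    d2 (T2 : measurableType d2) (P2 : probability T2 R) (X2 : S -> T2 -> bool)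
    : Prop :=
  forall A : set (S -> bool), <<s @cylinders S >> A ->
    P1 [set w | A (X1^~ w)] = P2 [set w | A (X2^~ w)].

Definition membership_events (S : Type) : set (set (set S)) :=
  [set A | exists i, A = [set B : set S | B i]].

(* P(S) with the sigma-algebra generated by the events {B | i \in B}. *)
Definition subsets (S : countType) :=
  g_sigma_algebraType (@membership_events S).

(* A measure on P(S) \ {set0} is encoded as a measure on P(S) that gives no
   mass to set0; {set0} is measurable because S is countable. *)
Definition sigma_finite_on_nonempty (R : realType) (S : countType)
    (nu : {measure set (subsets S) -> \bar R}) : Prop :=
  nu [set (set0 : set S)] = 0%E /\ sigma_finite setT nu.

(* A random countable collection of nonempty subsets of S, repetitions allowed,
   is given by an enumeration Z of its members; Z k w = set0 means that there
   is no k-th member. *)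
Definition point_count (R : realType) (S : countType) (T : Type)
    (Z : nat -> T -> subsets S) (A : set (subsets S)) (w : T) : \bar R :=
  counting [set k | A (Z k w)].
Arguments point_count R {S T} Z A w.

Definition poisson_distributed d (T : measurableType d) (R : realType)
    (P : probability T R) (l : \bar R) (N : T -> \bar R) : Prop :=
  match l with
  | l%:E => forall k : nat,
      P (N @^-1` [set k%:R%:E]) = (expR (- l) * l ^+ k / k`!%:R)%:E
  | _ => P (N @^-1` [set +oo%E]) = 1%E
  end.

Definition poisson_process d (T : measurableType d) (R : realType)
    (P : probability T R) (S : countType)
    (nu : {measure set (subsets S) -> \bar R})
    (Z : nat -> {RV P >-> subsets S}) : Prop :=
  (forall A : set (subsets S), measurable A -> ~ A set0 ->
     poisson_distributed P (nu A) (point_count R Z A)) /\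
  (forall (n : nat) (A : 'I_n -> set (subsets S)),
     (forall i, measurable (A i)) -> (forall i, ~ A i set0) ->
     trivIset setT A ->
     mutually_independent P (fun i => point_count R Z (A i))).

Definition covered (S : countType) (T : Type) (Z : nat -> T -> subsets S)
    (i : S) (w : T) : bool :=
  `[< exists k, (Z k w : set S) i >].

Definition poisson_representable d (T : measurableType d) (R : realType)
    (P : probability T R) (S : countType) (X : S -> {RV P >-> bool}) : Prop :=
  exists nu : {measure set (subsets S) -> \bar R},
    sigma_finite_on_nonempty nu /\
    exists (d' : measure_display) (T' : measurableType d')
           (P' : probability T' R) (Z : nat -> {RV P' >-> subsets S}),
      poisson_process nu Z /\ eq_in_distribution P X P' (covered Z).

Definition walk_length (V : eqType) (e : rel V) (x y : V) : set nat :=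
  [set n | exists s : seq V, [/\ path e x s, last x s = y & size s = n]].

(* Meaningful when x and y are connected. *)
Definition graph_dist (V : eqType) (e : rel V) (x y : V) : nat :=
  xget 0%N [set n | walk_length e x y n /\
                    forall k, walk_length e x y k -> (n <= k)%N].

(* w is the parent of v in the tree with edge relation e and root o. *)
Definition is_parent (V : eqType) (e : rel V) (o v w : V) : Prop :=
  e v w /\ forall u, e v u -> (graph_dist e o w <= graph_dist e o u)%N.

(* In a bool-valued process, true is the state 1 and false the state 0. The coin
   C v is true when v takes the fresh value Rv v instead of its parent's. *)
Definition tree_markov_chain d (T : measurableType d) (R : realType)
    (P : probability T R) (V : countType) (e : rel V) (o : V) (r p : R)
    (X : V -> {RV P >-> bool}) : Prop :=
  exists Rv C : V -> {RV P >-> bool},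
    [/\ mutually_independent P
          (fun i : V + V => match i with inl v => Rv v | inr v => C v end),
        forall v, P (Rv v @^-1` [set false]) = r%:E,
        forall v, P (C v @^-1` [set true]) = p%:E,
        forall w, X o w = Rv o w
      & forall v u w, v != o -> is_parent e o v u ->
          X v w = if C v w then Rv v w else X u w].

(* None is the center; Some (i, k) is the vertex of the i-th leg at distance
   k + 1 from the center. *)
Definition octopus_vertex (m : nat) : countType := option ('I_m * nat)%type.

Definition octopus_edge (m : nat) : rel (octopus_vertex m) := fun x y =>
  match x, y with
  | None, Some (_, k) | Some (_, k), None => k == 0%N
  | Some (i, k), Some (j, l) => (i == j) && ((k == l.+1) || (l == k.+1))
  | None, None => false
  end.

(* The fraction pq.1 / pq.2, in lowest terms, is the rational function that
   continues the series of Li_{-s}. *)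
Definition polylog_fraction (R : realType) (s : nat)
    (pq : {poly R} * {poly R}) : Prop :=
  coprimep pq.1 pq.2 /\
  forall z : R, `|z| < 1 ->
    pq.2.[z] != 0 /\
    series (fun k : nat => k.+1%:R ^+ s * z ^+ k.+1) @ \oo
      --> pq.1.[z] / pq.2.[z].

(* Li_{-s}. Its only pole is 1, where the value below is junk. *)
Definition polylog_neg (R : realType) (s : nat) (z : R) : R :=
  let pq := xget (0, 1) [set pq | polylog_fraction s pq] in
  pq.1.[z] / pq.2.[z].

Definition largest_negative_root (R : realType) (f : R -> R) : R :=
  xget 0 [set z | [/\ z < 0, f z = 0 & forall y, y < 0 -> f y = 0 -> y <= z]].

Definition r1 (R : realType) (n : nat) : R :=
  1 / (1 - largest_negative_root (@polylog_neg R n.-1)).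

(* Main.v *)
(* With a Poisson process of intensity nu, a finite set F of vertices is entirely in
   state 0 with probability exp(- nu {B meets F}), and these void probabilities
   determine the law.  Let q = 1 - p and s = (1 - r) / r.  For the chain and F not
   containing the center, conditioning on the center gives the void probability
   r (prod_i A_i) (1 + s prod_i Z_i), where i ranges over the legs, A_i depends
   only on the vertices of F on leg i, and Z_i = z_k := (1 - q^k) / (1 + s q^k)
   if the first of them has distance k to the center (Z_i = 1 if there is none).

   Necessity.  By inclusion-exclusion, the mass of the sets containing given
   vertices at distance k on j legs is the mixed difference over [z_k, 1]^j of
   t |-> L_0(prod_i t_i), where L_0(z) = ln (1 + s z); letting k grow gives
   (z d/dz)^j L_0 (1) >= 0 for 2 <= j <= m.  These values are P_{j-1}(1 - r), where
   P_n = (x (1 - x) d/dx)^n x satisfies Li_{-n}(z) = - P_n(z / (z - 1)), and the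
   first positive roots of the P_n decrease with n, so that 1 - r is at most the
   first positive root of P_{m-1}, which is 1 - r_1(m).

   Sufficiency, with r_2 = r_1.  Let nu charge each connected set containing the
   center and exactly b_i vertices of leg i with the mixed difference of L_0 over
   prod_i [z_{b_i}, z_{b_i + 1}], which is nonnegative when 1 - r is at most that
   root, and each finite interval of a leg with a second difference of
   ln (r + (1 - r) q^k).  Its void probabilities telescope to those of X. *)
Require Import Defs.
From HB Require Import structures.
From mathcomp Require Import all_boot all_order all_algebra.
From mathcomp Require Import ring lra zify.
From mathcomp Require Import all_classical all_reals all_analysis.
From mathcomp Require Import measurable_realfun.
Set Implicit Arguments.
Unset Strict Implicit.
Unset Printing Implicit Defensive.
Import Order.TTheory GRing.Theory Num.Theory.
Import numFieldNormedType.Exports.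
Local Open Scope classical_set_scope.
Local Open Scope ring_scope.

(** * Logistic polynomials and polylogarithms *)

(** Necessity uses every order j from 2 to m. The sign of P_{m-1} (1 - r) alone would not place 1 -
    r before the first root, because P_{m-1} may become positive again further right; the lower
    orders keep 1 - r inside the stretch beyond that root on which P_{m-2} still decreases. Order 1
    stays out because the factors A_i add to the logarithm a term affine in the number of vertices,
    which only differences of order at least 2 remove.

    Sufficiency meets order m only. Since z_0 = 0, a leg on which the central set has no vertex
    still contributes the side [z_0, z_1], so every weight is an m-fold difference. By the mean
    value theorem it has the sign of (z d/dz)^m L_0 at a point z of (0, 1], where s z / (1 + s z) <=
    1 - r; positivity of P_{m-1} up to its first root is what this asks for, so both directions meet
    at the same threshold.

    Two matters shape the rest. The chain may be rooted anywhere, while the formulas start from the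
    center, so the path between the two has to be reversed. And the Poisson process has to be built:
    the intensity is purely atomic, so independent Poisson multiplicities of countably many sets
    suffice. *)

Fixpoint logistic_poly (R : nzRingType) (n : nat) : {poly R} :=
  if n is n'.+1 then 'X * (1 - 'X) * (logistic_poly R n')^`() else 'X.

Section LogisticPoly.
Variable R : realType.
Implicit Types (x : R) (n : nat).
Local Notation P := (logistic_poly R).

Lemma logistic_polyS_horner n x : (P n.+1).[x] = x * (1 - x) * (P n)^`().[x].
Proof. by rewrite /= !hornerE. Qed.

Lemma logistic_poly1_horner x : (P 1).[x] = x * (1 - x).
Proof. by rewrite logistic_polyS_horner /= derivX !hornerE. Qed.

Lemma logistic_poly2_horner x : (P 2).[x] = x * (1 - x) * (1 - 2 * x).
Proof. by rewrite logistic_polyS_horner /= derivX mulr1 !poly.derivE !hornerE /=; ring. Qed.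

Lemma logistic_poly_at0 n : (P n).[0] = 0.
Proof. by case: n => [|n]; rewrite ?hornerE // logistic_polyS_horner !mul0r. Qed.

Lemma size_logistic_poly n : (size (P n) <= n.+2)%N.
Proof.
elim: n => [|n IH]; first by rewrite size_polyX.
rewrite /= (leq_trans (size_polyMleq _ _)) //.
have h1 : (size ('X * (1 - 'X) : {poly R})%R <= 3)%N.
  rewrite (leq_trans (size_polyMleq _ _)) // size_polyX addSn /= add1n ltnS.
  by rewrite (leq_trans (size_polyD _ _)) // geq_max size_polyN size_polyX size_poly1.
have h2 : (size (P n)^`()%R <= n.+1)%N.
  have [->|/lt_size_deriv h] := eqVneq (P n) 0; first by rewrite deriv0 size_poly0.
  by rewrite -ltnS (leq_trans h).
by rewrite -subn1 leq_subLR (leq_trans (leq_add h1 h2)).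
Qed.

(** That this is nonzero gives [logistic_poly_neq0], and later that the numerator of the rational
    function for Li_{-n} does not vanish at the pole 1. *)
Lemma lead_coef_logistic_poly n : (P n)`_n.+1 = (-1) ^+ n * n`!%:R.
Proof.
elim: n => [|n IH]; first by rewrite coefX fact0 expr0 mulr1.
rewrite /= -mulrA coefXM /= mulrBl mul1r coefB coefXM /= !coef_deriv IH.
rewrite nth_default ?size_logistic_poly // mul0rn sub0r.
by rewrite exprS factS natrM -mulr_natr; ring.
Qed.

Lemma logistic_poly_neq0 n : P n != 0.
Proof.
apply/eqP => h; have := lead_coef_logistic_poly n; rewrite h coef0 => /esym/eqP.
by rewrite mulf_eq0 signr_eq0 pnatr_eq0 -leqn0 leqNgt fact_gt0.
Qed.

Lemma poly_MVT (p : {poly R}) (a b : R) : a < b ->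
  exists2 c, a < c < b & p.[b] - p.[a] = p^`().[c] * (b - a).
Proof.
move=> ab; have [] := @MVT _ (horner p) (horner p^`()) a b ab.
  exact/continuous_subspaceT/continuous_horner.
by move=> c; rewrite in_itv /= => cab h; exists c.
Qed.

Lemma poly_ivt_strict (p : {poly R}) (a b : R) : a < b -> p.[a] * p.[b] < 0 ->
  exists2 x, a < x < b & root p x.
Proof.
have main (q : {poly R}) : a < b -> q.[a] < 0 -> 0 < q.[b] ->
    exists2 x, a < x < b & root q x.
  move=> ab qa qb; have [|x /andP[ax xb] qx] := @poly_ivt R q a b (ltW ab).
    by rewrite !ltW.
  exists x => //; rewrite !lt_neqAle ax xb !andbT; apply/andP; split.
    by apply: contraTneq qa => ->; rewrite (eqP qx) ltxx.
  by apply: contraTneq qb => <-; rewrite (eqP qx) ltxx.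
move=> ab; have [pa|pa|->] := ltgtP p.[a] 0; last by rewrite mul0r ltxx.
  by rewrite nmulr_rlt0 //; exact: main.
rewrite pmulr_rlt0 // => pb; have [//|||x xab] := main (- p).
- by rewrite hornerN oppr_lt0.
- by rewrite hornerN oppr_gt0.
by rewrite rootN; exists x.
Qed.

(** By Rolle the derivative vanishes strictly between consecutive zeros, and the factor x (1 - x)
    restores the end points 0 and 1. As many zeros are found as the degree allows. *)
Lemma logistic_poly_roots n : exists z : nat -> R,
  [/\ z 0%N = 0, z n.+1 = 1, forall i, (i <= n)%N -> z i < z i.+1
    & forall i, (i <= n.+1)%N -> root (P n.+1) (z i)].
Proof.
elim: n => [|n [z [z0 zn zlt zr]]].
  exists (fun i => i%:R); split=> // [i|[|[|]]] // *; first by rewrite ltr_nat.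
    by rewrite /root logistic_poly1_horner mul0r.
  by rewrite /root logistic_poly1_horner subrr mulr0.
have ex i : exists y, (i <= n)%N -> z i < y < z i.+1 /\ root (P n.+1)^`() y.
  have [le|_] := leqP i n; last by exists 0.
  have [c hc] := poly_MVT (P n.+1) (zlt i le).
  have /eqP -> : root (P n.+1) (z i.+1) by apply: zr.
  have /eqP -> : root (P n.+1) (z i) by apply: zr; exact: leqW.
  move=> /eqP; rewrite subrr eq_sym mulf_eq0 subr_eq0 (gt_eqF (zlt i le)) orbF.
  by exists c => _.
have [y hy] := choice ex.
exists (fun i => if i is i'.+1 then if (i' <= n)%N then y i' else 1 else 0).
split => //.
- by rewrite ltnn.
- move=> [|i] hi /=.
    by have [] := hy 0%N isT; rewrite z0 => /andP[].
  rewrite -ltnS hi; have [/andP[_ h1] _] := hy i hi.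
  have [lt|ge] := leqP i.+1 n.
    have [/andP[h2 _] _] := hy i.+1 lt.
    exact: lt_trans h1 h2.
  have -> : i = n by apply/eqP; rewrite eqn_leq -ltnS hi -ltnS ge.
  rewrite -zn; have [/andP[_]] := hy n (leqnn n).
  by [].
- move=> [|i] hi; rewrite /root logistic_polyS_horner; first by rewrite !mul0r.
  have [le|_] := leqP i n; last by rewrite subrr mulr0 mul0r.
  by have [_ /eqP ->] := hy i le; rewrite mulr0.
Qed.

Definition first_pos_root (p : {poly R}) (x : R) :=
  [/\ 0 < x, root p x & forall y, 0 < y < x -> 0 < p.[y]].

Lemma first_pos_root_uniq p x y :
  first_pos_root p x -> first_pos_root p y -> x = y.
Proof.
move=> [x0 rx hx] [y0 ry hy]; have [xy|yx|//] := ltgtP x y.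
  by have := hy x; rewrite x0 xy (eqP rx) ltxx => /(_ isT).
by have := hx y; rewrite y0 yx (eqP ry) ltxx => /(_ isT).
Qed.

(* The derivative has degree n+1 and vanishes between consecutive roots, so it
   has exactly one zero before the first positive root. *)
Lemma first_pos_root_step n x : first_pos_root (P n.+1) x -> x <= 1 ->
  exists y, [/\ first_pos_root (P n.+2) y, y < x &
    forall t, y < t <= x -> (P n.+1)^`().[t] < 0].
Proof.
move=> [x0 rx hx] x1; set Q := (P n.+1)^`().
have [z [z0 zn zlt zr]] := logistic_poly_roots n.
have zmono i j : (i < j)%N -> (j <= n.+1)%N -> z i < z j.
  elim: j => // j IH; rewrite ltnS leq_eqVlt => /predU1P[->|ij] jn; first exact: zlt.
  exact: lt_trans (IH ij (ltnW jn)) (zlt _ _).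
have P0 := logistic_poly_at0 n.+1.
have ex i : exists y, (i <= n)%N -> z i < y < z i.+1 /\ root Q y.
  have [le|_] := leqP i n; last by exists 0.
  have [c hc] := poly_MVT (P n.+1) (zlt i le).
  have /eqP -> : root (P n.+1) (z i.+1) by apply: zr.
  have /eqP -> : root (P n.+1) (z i) by apply: zr; exact: leqW.
  move=> /eqP; rewrite subrr eq_sym mulf_eq0 subr_eq0 (gt_eqF (zlt i le)) orbF.
  by exists c => _.
have [y hy] := choice ex.
have yS i : (i < n)%N -> y i < y i.+1.
  move=> lt; have [/andP[_ h1] _] := hy i (ltnW lt).
  by have [/andP[h2 _] _] := hy i.+1 lt; exact: lt_trans h1 h2.
have ymono i j : (i < j)%N -> (j <= n)%N -> y i < y j.
  elim: j => // j IH; rewrite ltnS leq_eqVlt => /predU1P[->|ij] jn; first exact: yS.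
  exact: lt_trans (IH ij (ltnW jn)) (yS _ _).
have Q0 : Q != 0.
  apply/eqP => Q0; have := logistic_poly_neq0 n.+2.
  by rewrite /= -/(P n.+1) -/Q Q0 mulr0 eqxx.
have xz1 : x <= z 1%N.
  rewrite leNgt; apply/negP => lt; have := hx (z 1%N).
  have /eqP -> := zr 1%N isT.
  by rewrite lt -[X in X < z 1%N]z0 zlt // ltxx => /(_ isT).
(* Otherwise t, y 0, ..., y n would be n + 2 different zeros of Q, whose degree is at most n + 1; t
   <= z 1 keeps t apart from the later y i. *)
have only t : t <= z 1%N -> root Q t -> t = y 0%N.
  move=> tz rt; apply/eqP/negPn/negP => ne.
  have sQ : (size Q <= n.+2)%N.
    by rewrite -ltnS (leq_trans (lt_size_deriv (logistic_poly_neq0 n.+1))) ?size_logistic_poly.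
  move: sQ; rewrite leqNgt => /negP; apply.
  have := @max_poly_roots _ Q (t :: [seq y i | i <- iota 0 n.+1]) Q0.
  rewrite [size (_ :: _)]/= size_map size_iota; apply.
    apply/allP => u; rewrite inE => /predU1P[->//|/mapP[i ii ->]].
    by move: ii; rewrite mem_iota add0n /= => /hy [].
  rewrite cons_uniq map_inj_in_uniq ?iota_uniq ?andbT.
    apply/mapP => -[i]; rewrite mem_iota add0n /= ltnS.
    case: i => [_|i ilt] h; first by rewrite h eqxx in ne.
    have [/andP[h1 _] _] := hy i.+1 ilt.
    move: tz; rewrite h leNgt => /negP; apply.
    case: i h ilt h1 => [//|i] h ilt h1; apply: lt_trans h1.
    by apply: zmono => //; apply: leqW.
  move=> i j; rewrite !mem_iota !add0n /= !ltnS => hi hj yij.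
  have [lt|lt|//] := ltngtP i j; first by have := ymono _ _ lt hj; rewrite yij ltxx.
  by have := ymono _ _ lt hi; rewrite yij ltxx.
have [/andP[y0_gt y0_lt] ry0] := hy 0%N isT; rewrite z0 in y0_gt.
(* On each side of y 0 inside (0, z 1] the sign of Q is constant, since a sign change would produce
   a second zero; [pos] and [neg] carry a sign from c to t. *)
have pos c t : 0 < c -> c <= z 1%N -> 0 < t -> t <= z 1%N -> 0 < Q.[c] ->
    (c < y 0%N) = (t < y 0%N) -> t != y 0%N -> 0 < Q.[t].
  move=> c0 cz t0 tz Qc ct ne; rewrite ltNge; apply/negP => Qt.
  have Qt' : Q.[t] < 0.
    rewrite lt_neqAle Qt andbT; apply: contra ne => rt.
    exact/eqP/only.
  have bad a b : 0 < a -> a < b -> b <= z 1%N -> Q.[a] * Q.[b] < 0 ->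
      (a < y 0%N) = (b < y 0%N) -> False.
    move=> a0 ab bz neg; have [u /andP[au ub] ru] := poly_ivt_strict ab neg.
    have uE := only _ (le_trans (ltW ub) bz) ru.
    by rewrite -uE au ltNge (ltW ub).
  have [lt|lt|e] := ltgtP c t; last by move: Qc; rewrite e ltNge Qt.
    by apply: (bad c t) => //; rewrite pmulr_rlt0.
  by apply: (bad t c) => //; rewrite pmulr_llt0.
have neg c t : 0 < c -> c <= z 1%N -> 0 < t -> t <= z 1%N -> Q.[c] < 0 ->
    (c < y 0%N) = (t < y 0%N) -> t != y 0%N -> Q.[t] < 0.
  move=> c0 cz t0 tz Qc ct ne; rewrite ltNge; apply/negP => Qt.
  have Qt' : 0 < Q.[t].
    rewrite lt_neqAle Qt andbT eq_sym; apply: contra ne => rt.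
    exact/eqP/only.
  have := pos t c t0 tz c0 cz Qt' (esym ct); rewrite ltNge (ltW Qc).
  move=> /(_ _)/notF; apply; apply: contraTneq Qc => ->.
  by rewrite (eqP ry0) ltxx.
(* Rolle on [0, x] gives a zero of Q, which can only be y 0. *)
have y0x : y 0%N < x.
  rewrite ltNge; apply/negP => xy.
  have [c /andP[c0 cx]] := poly_MVT (P n.+1) x0.
  rewrite (eqP rx) P0 subrr => /esym/eqP; rewrite mulf_eq0 subr0 (gt_eqF x0) orbF.
  move=> /only -/(_ (ltW (lt_le_trans cx xz1))) e.
  by move: cx; rewrite e ltNge xy.
have pos0 t : 0 < t < y 0%N -> 0 < Q.[t].
  move=> /andP[t0 ty].
  have [c /andP[c0 cx] hc] := poly_MVT (P n.+1) y0_gt.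
  have Qc : 0 < Q.[c].
    have : 0 < Q.[c] * (y 0%N - 0) by rewrite -hc P0 subr0 hx // y0_gt.
    by rewrite pmulr_lgt0 // subr0.
  have yz : y 0%N <= z 1%N := ltW y0_lt.
  apply: (pos c t) => //; rewrite ?(le_trans (ltW ty)) ?(le_trans (ltW cx)) //.
    by rewrite cx ty.
  by rewrite lt_eqF.
have neg0 t : y 0%N < t <= x -> Q.[t] < 0.
  move=> /andP[yt tx].
  (* [P n.+1] falls from a positive value at the midpoint of y 0 and x to 0 at x, so Q is negative
     somewhere in between; [neg] spreads this sign over (y 0, x]. *)
  have [c /andP[c0 cx] hc] := poly_MVT (P n.+1) (midf_lt y0x).2.
  have yc := lt_trans (midf_lt y0x).1 c0.
  have Qc : Q.[c] < 0.
    have : Q.[c] * (x - (y 0%N + x) / 2) < 0.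
      rewrite -hc (eqP rx) sub0r oppr_lt0 hx // (midf_lt y0x).2.
      by rewrite (lt_trans y0_gt) // (midf_lt y0x).1.
    by rewrite pmulr_llt0 // subr_gt0 (midf_lt y0x).2.
  apply: (neg c t) => //.
  - exact: lt_trans yc.
  - exact: le_trans (ltW cx) xz1.
  - exact: lt_trans yt.
  - exact: le_trans tx xz1.
  - by rewrite !ltNge (ltW yc) (ltW yt).
  - by rewrite gt_eqF.
exists (y 0%N); split => //; split => //.
  by rewrite /root logistic_polyS_horner (eqP ry0) mulr0.
move=> t /andP[t0 ty]; rewrite logistic_polyS_horner pmulr_rgt0 ?pos0 ?t0 //.
by rewrite mulr_gt0 // subr_gt0 (lt_le_trans (lt_trans ty y0x)).
Qed.

Lemma logistic_poly_first_root n :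
  exists2 x, first_pos_root (P n.+1) x & x <= 1.
Proof.
elim: n => [|n [x hx x1]]; last first.
  by have [y [hy yx _]] := first_pos_root_step hx x1; exists y => //; rewrite (le_trans (ltW yx)).
exists 1 => //; split => //; first by rewrite /root logistic_poly1_horner subrr mulr0.
by move=> y /andP[y0 y1]; rewrite logistic_poly1_horner mulr_gt0 // subr_gt0.
Qed.

Lemma logistic_poly2_first_root : first_pos_root (P 2) (1 / 2).
Proof.
split; first by lra.
  by rewrite /root logistic_poly2_horner; apply/eqP; field.
by move=> y y01; rewrite logistic_poly2_horner !mulr_gt0 //; lra.
Qed.

(** The induction hypothesis puts x before the first root z of the preceding polynomial. Were x
    beyond y, it would lie in (y, z], where that polynomial has negative derivative, so the next one
    would be negative at x. *)
Lemma le_first_pos_root n (x y : R) : first_pos_root (P n.+1) y -> 0 < x < 1 ->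
  (forall j, (2 <= j <= n.+1)%N -> 0 <= (P j).[x]) -> x <= y.
Proof.
elim: n y => [|n IH] y hy /[dup] x01 /andP[x0 x1] hP.
  have [z hz z1] := logistic_poly_first_root 0.
  rewrite leNgt; apply/negP => yx; case: hy => y0 + _.
  rewrite /root logistic_poly1_horner mulf_eq0 (gt_eqF y0) /= subr_eq0 => /eqP e.
  by move: yx; rewrite -e ltNge (ltW x1).
have [z hz z1] := logistic_poly_first_root n.
have [y' [hy' y'z neg]] := first_pos_root_step hz z1.
have <- := first_pos_root_uniq hy' hy.
have xz : x <= z by apply: IH => // j /andP[j2 jn]; rewrite hP // j2 ltnW.
rewrite leNgt; apply/negP => yx; have := hP n.+2; rewrite /= ltnSn => /(_ isT).
rewrite leNgt -/(P n.+2) logistic_polyS_horner => /negP; apply.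
by rewrite pmulr_rlt0 ?neg ?yx ?mulr_gt0 ?subr_gt0.
Qed.

Lemma first_pos_root_lt1 n y : first_pos_root (P n.+2) y -> y < 1.
Proof.
have [z hz z1] := logistic_poly_first_root n.
have [y' [hy' y'z _]] := first_pos_root_step hz z1.
by move=> /(first_pos_root_uniq hy') <-; apply: lt_le_trans y'z z1.
Qed.
End LogisticPoly.

(** * Analytic continuation of Li_{-n} and the threshold *)

Section Polylog.
Variable R : realType.
Implicit Types (z x : R) (n : nat).
Local Notation P := (logistic_poly R).

(** Absorbs the factor k + 1 created by termwise differentiation. *)
Lemma natrM_expr_le (t : R) k : 0 <= t <= 1 -> k.+1%:R * t ^+ k * (1 - t) <= 1.
Proof.
move=> /andP[t0 t1]; elim: k => [|k IH].
  by rewrite expr0 !mul1r lerBlDr lerDl.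
have -> : k.+2%:R * t ^+ k.+1 * (1 - t) =
    t * (k.+1%:R * t ^+ k * (1 - t)) + t ^+ k.+1 * (1 - t) :> R.
  by rewrite -[k.+2]addn1 natrD exprS; ring.
rewrite -[leRHS](subrKC t) lerD // -[leRHS]mulr1 ?ler_wpM2l //.
by rewrite [leRHS]mulr1 ler_piMl ?subr_ge0 // exprn_ile1.
Qed.

(** The differentiated series at z is dominated by a multiple of the series of |f k| K^k for a
    radius K between |z| and 1, the factor k + 1 being absorbed by (|z| / K)^k. *)
Lemma is_cvg_pseries_diffs (f : R^nat) :
  (forall z, `|z| < 1 -> cvgn (pseries f z)) ->
  forall z, `|z| < 1 -> cvgn (pseries (pseries_diffs f) z).
Proof.
move=> cf z z1.
have [K zK K1] : exists2 K : R, `|z| < K & K < 1 by exists ((`|z| + 1) / 2); rewrite (midf_lt z1).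
have K0 : 0 < K := le_lt_trans (normr_ge0 _) zK.
pose t := `|z| / K.
have t0 : 0 <= t by rewrite divr_ge0 // ltW.
have t1 : t < 1 by rewrite ltr_pdivrMr // mul1r.
have ck : cvgn (series (fun i => `|f i| * K ^+ i)).
  apply: (@is_cvg_pseries_inside_norm _ _ ((K + 1) / 2)).
    by apply: cf; rewrite ger0_norm ?(midf_lt K1) // divr_ge0 // addr_ge0 // ltW.
  rewrite !ger0_norm ?(midf_lt K1) // ?divr_ge0 ?addr_ge0 // ltW //.
apply: normed_cvg.
have ck1 : cvgn (series (fun i => ((1 - t) * K)^-1 * (`|f i.+1| * K ^+ i.+1))).
  apply: is_cvg_seriesZ.
  rewrite [X in cvgn X](_ : _ =
      (fun n => series (fun i => `|f i| * K ^+ i) n.+1 - `|f 0%N| * K ^+ 0)).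
    apply: is_cvgB; last exact: is_cvg_cst.
    by move: ck => /cvg_ex[l]; rewrite -cvg_shiftS => hl; apply/cvg_ex; exists l.
  by apply/funext => n; rewrite /series /= big_nat_recl //= addrC addrA addNr add0r.
apply: (series_le_cvg _ _ _ ck1) => k //=.
  by rewrite mulr_ge0 // ?invr_ge0 ?mulr_ge0 ?subr_ge0 // ?exprn_ge0 // ltW.
rewrite /pseries_diffs !normrM normr_nat normrX.
have -> : `|z| = t * K by rewrite divfK ?gt_eqF.
rewrite exprMn exprS invfM !mulrA.
have -> : (1 - t)^-1 / K * `|f k.+1| * K * K ^+ k = (1 - t)^-1 * (`|f k.+1| * K ^+ k).
  by field; rewrite !gt_eqF ?subr_gt0.
have -> : k.+1%:R * `|f k.+1| * t ^+ k * K ^+ k = (k.+1%:R * t ^+ k) * (`|f k.+1| * K ^+ k) by ring.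
rewrite ler_wpM2r ?mulr_ge0 // ?exprn_ge0 ?(ltW K0) //.
rewrite -[leRHS]mul1r ler_pdivlMr ?subr_gt0 //.
by rewrite natrM_expr_le // t0 ltW.
Qed.

(** The coefficient at 0 is set apart because [0 ^+ 0 = 1] would add a constant term when n = 0. *)
Let cpow n (k : nat) : R := if k is k'.+1 then k'.+1%:R ^+ n else 0.

Lemma is_derive_logistic_polylog n z : z < 1 ->
  is_derive z 1 (fun x => - (P n).[x / (x - 1)])
    ((P n)^`().[z / (z - 1)] / (z - 1) ^+ 2).
Proof.
move=> z1; have z1' : z - 1 != 0 by rewrite subr_eq0 lt_eqF.
have dg : is_derive z 1 (fun x => x / (x - 1)) (- (z - 1) ^- 2).
  have dV : is_derive z 1 (fun x => (x - 1)^-1) (- (z - 1) ^- 2 *: 1).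
    apply: is_deriveV => //.
    by rewrite -[X in is_derive _ _ _ X]subr0; exact: is_deriveB.
  have := @is_deriveM _ _ id (fun x => (x - 1)^-1) z 1 _ _ (is_derive_id _ _) dV.
  move=> /is_derive_eq; apply; rewrite /GRing.scale /=; field => //.
have := @is_deriveN _ _ _ _ _ _ _ (@is_derive1_comp _ (horner (P n)) (fun x => x / (x - 1))
  z _ _ (is_derive_poly (P n) (z / (z - 1))) dg).
by move=> /is_derive_eq; apply; rewrite mulrN opprK.
Qed.

(** Both sides pass from n to n + 1 by z d/dz: the series by termwise differentiation inside the
    disc, the right side because x = z / (z - 1) satisfies z dx/dz = x (1 - x). The base case is the
    geometric series. *)
Lemma pseries_pow_cvg n z : `|z| < 1 ->
  pseries (cpow n) z @ \oo --> - (P n).[z / (z - 1)].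
Proof.
elim: n z => [|n IH] z z1.
  have z1' : 1 - z != 0 by rewrite subr_eq0 gt_eqF // (le_lt_trans (ler_norm _)).
  rewrite /= hornerX -cvg_shiftS.
  rewrite [X in X @ _ --> _](_ : _ = series (geometric z z)); last first.
    apply/funext => N; rewrite /pseries /series /= big_nat_recl //= mul0r add0r.
    by apply: eq_bigr => i _; rewrite expr0 mul1r exprS.
  have -> : - (z / (z - 1)) = z / (1 - z) by rewrite -[z - 1]opprB invrN mulrN opprK.
  exact: cvg_geometric_series.
have c0 x : `|x| < 1 -> cvgn (pseries (cpow n) x) by move=> /IH /cvgP.
have c1 := is_cvg_pseries_diffs c0.
have c2 := is_cvg_pseries_diffs c1.
have [K zK K1] : exists2 K : R, `|z| < K & K < 1 by exists ((`|z| + 1) / 2); rewrite (midf_lt z1).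
have nK : `|K| = K by rewrite ger0_norm // (le_trans (normr_ge0 z)) // ltW.
have zlt : z < 1 := le_lt_trans (ler_norm _) z1.
have dS : is_derive z (1 : R) (fun x => - (P n).[x / (x - 1)])
    (limn (pseries (pseries_diffs (cpow n)) z)).
  have := @pseries_snd_diffs _ (cpow n) K z.
  rewrite nK => /(_ _ _ _ zK) h; apply: near_eq_is_derive; last first.
    by apply: h; [apply: c0|apply: c1|apply: c2]; rewrite nK.
  near=> x; apply/cvg_lim => //; apply: IH; near: x.
  exact: (@cvgr_norm_lt _ _ _ (nbhs z) _ id z _ _ z1).
have lE : limn (pseries (pseries_diffs (cpow n)) z) =
    (P n)^`().[z / (z - 1)] / (z - 1) ^+ 2.
  by rewrite -(@derive_val _ _ _ _ _ _ _ dS) (@derive_val _ _ _ _ _ _ _ (is_derive_logistic_polylog n zlt)).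
rewrite -cvg_shiftS.
rewrite [X in X @ _ --> _](_ : _ = (fun N => z * pseries (pseries_diffs (cpow n)) z N)); last first.
  apply/funext => N; rewrite /pseries /series /= big_nat_recl //= mul0r add0r.
  rewrite mulr_sumr; apply: eq_bigr => i _; rewrite /pseries_diffs /= !exprS; ring.
have -> : - (P n.+1).[z / (z - 1)] = z * ((P n)^`().[z / (z - 1)] / (z - 1) ^+ 2).
  rewrite logistic_polyS_horner; field.
  by rewrite subr_eq0 lt_eqF.
by apply: cvgM; [exact: cvg_cst|rewrite -lE; exact: c1].
Unshelve. all: by end_near. Qed.

Lemma series_polylog_cvg n z : `|z| < 1 ->
  series (fun k : nat => k.+1%:R ^+ n * z ^+ k.+1) @ \oo --> - (P n).[z / (z - 1)].
Proof.
move=> /(@pseries_pow_cvg n); rewrite -cvg_shiftS.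
rewrite [X in X @ _ --> _ -> _](_ : _ = series (fun k : nat => k.+1%:R ^+ n * z ^+ k.+1)) //.
by apply/funext => N; rewrite /pseries /series /= big_nat_recl //= mul0r add0r.
Qed.

Let polylog_num n : {poly R} :=
  - \sum_(i < n.+2) (P n)`_i *: ('X^i * ('X - 1%:P) ^+ (n.+1 - i)).

Let polylog_den n : {poly R} := ('X - 1%:P) ^+ n.+1.

Lemma polylog_num_den n z : z != 1 ->
  (polylog_num n).[z] / (polylog_den n).[z] = - (P n).[z / (z - 1)].
Proof.
rewrite -subr_eq0 => z1.
rewrite hornerN horner_sum (horner_coef_wide _ (size_logistic_poly R n)) mulNr.
rewrite mulr_suml; congr (- _); apply: eq_bigr => i _.
rewrite /polylog_den !(hornerE, horner_exp) expr_div_n /=.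
have -> : (z - 1) ^+ n.+1 = (z - 1) ^+ (n.+1 - i) * (z - 1) ^+ i.
  by rewrite -exprD subnK // -ltnS.
by field; rewrite !expf_neq0.
Qed.

(** The denominator vanishes only at 1, where all terms of the numerator disappear except the one
    with the leading coefficient of [P n]; hence the two are coprime. *)
Lemma polylog_fraction_num_den n : polylog_fraction n (polylog_num n, polylog_den n).
Proof.
split => [|z z1] /=.
  rewrite coprimep_pexpr // coprimep_XsubC /root hornerN horner_sum oppr_eq0.
  rewrite big_ord_recr big1 /=.
    rewrite subnn expr0 mulr1 add0r hornerZ hornerXn expr1n mulr1 lead_coef_logistic_poly.
    by rewrite mulf_neq0 ?signr_eq0 // pnatr_eq0 -lt0n fact_gt0.
  move=> i _; rewrite hornerZ hornerM hornerXn horner_exp hornerXsubC subrr expr0n.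
  by rewrite subn_eq0 leqNgt ltnS /= leq_ord !mulr0.
have z1' : z != 1 by apply: contraTneq z1 => ->; rewrite normr1 ltxx.
rewrite polylog_num_den //; split; last exact: series_polylog_cvg.
by rewrite horner_exp !hornerE expf_neq0 // subr_eq0.
Qed.

(** Uniqueness of the continuation. The cross difference D vanishes at the points 1 / (k + 2) of the
    disc, more of them than its degree allows, so D = 0. Coprimality then excludes a zero of [pq.2]
    at z, which would be one of [pq.1] as well. The identity thus reaches beyond the disc, to every
    z < 1. *)
Lemma polylog_fractionE n pq z : polylog_fraction n pq -> z < 1 ->
  pq.1.[z] / pq.2.[z] = - (P n).[z / (z - 1)].
Proof.
move=> [cop h] z1; have z1' : z != 1 by rewrite lt_eqF.
rewrite -polylog_num_den //.
have den0 x : x != 1 -> (polylog_den n).[x] != 0.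
  by move=> x1; rewrite horner_exp !hornerE expf_neq0 // subr_eq0.
pose D := pq.1 * polylog_den n - polylog_num n * pq.2.
have D0 : D = 0.
  apply/eqP/negPn/negP => D0.
  pose s := [seq k.+2%:R^-1 : R | k <- iota 0 (size D)].
  have := @max_poly_roots _ D s D0; rewrite /s size_map size_iota ltnn => h'.
  suff : false by []. apply: h'.
    apply/allP => _ /mapP[k _ ->]; set x : R := _^-1.
    have x1 : `|x| < 1.
      by rewrite ger0_norm ?invr_ge0 // invf_lt1 ?ltr1n.
    have x1' : x != 1 by apply: contraTneq x1 => ->; rewrite normr1 ltxx.
    have [q0 hc] := h x x1.
    have e := cvg_unique (@norm_hausdorff _ _) hc (series_polylog_cvg (n := n) x1).
    rewrite /root /D hornerD hornerN !hornerM subr_eq0 -eqr_div ?den0 //.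
    by rewrite polylog_num_den // e.
  rewrite map_inj_uniq ?iota_uniq // => i j /invr_inj /eqP.
  by rewrite eqr_nat => /eqP [].
have := congr1 (fun p => p.[z]) D0; rewrite /D hornerD hornerN !hornerM horner0 => /subr0_eq e.
have q0 : pq.2.[z] != 0.
  apply/negP => q0; have : pq.1.[z] == 0.
    by move: e; rewrite (eqP q0) mulr0 => /eqP; rewrite mulf_eq0 (negPf (den0 _ z1')) orbF.
  move=> p0; have := coprimep_root cop p0.
  by rewrite q0.
by apply/eqP; rewrite eqr_div ?den0 // e.
Qed.

Lemma polylog_negE n z : z < 1 -> polylog_neg n z = - (P n).[z / (z - 1)].
Proof.
move=> z1; rewrite /polylog_neg; apply: polylog_fractionE => //.
by apply: (xgetPex (0, 1)); exists (polylog_num n, polylog_den n); exact: polylog_fraction_num_den.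
Qed.

(** The involution z -> z / (z - 1) maps the negative half-line onto (0, 1) and reverses the order,
    so the largest negative root of Li corresponds to the first positive root x; and 1 / (1 - x / (x
    - 1)) = 1 - x. *)
Lemma r1E n x : first_pos_root (P n.+2) x -> r1 R n.+3 = 1 - x.
Proof.
move=> hx; have x1 := first_pos_root_lt1 hx; have [x0 rx px] := hx.
have x10 : x - 1 < 0 by rewrite subr_lt0.
have y0 : x / (x - 1) < 0 by rewrite pmulr_rlt0 // invr_lt0.
have root_le z : z < 0 -> polylog_neg n.+2 z = 0 -> z <= x / (x - 1).
  move=> z0; rewrite polylog_negE ?(lt_trans z0) // => /eqP; rewrite oppr_eq0 => rz.
  have z10 : z - 1 < 0 by rewrite subr_lt0 (lt_trans z0).
  rewrite leNgt; apply/negP => lt.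
  have := px (z / (z - 1)); rewrite (eqP rz) ltxx => /(_ _)/notF; apply.
  rewrite nmulr_rgt0 ?invr_lt0 // z10 /= ltr_ndivrMr //.
  move: lt; rewrite ltr_ndivrMr // => lt.
  by rewrite -subr_gt0; rewrite -subr_gt0 in lt; move: lt; congr (0 < _); ring.
have isr : polylog_neg n.+2 (x / (x - 1)) = 0.
  rewrite polylog_negE ?(lt_trans y0) //.
  have -> : x / (x - 1) / (x / (x - 1) - 1) = x.
    by field; repeat (apply/andP; split); apply/eqP; lra.
  by rewrite (eqP rx) oppr0.
have -> : r1 R n.+3 = 1 / (1 - x / (x - 1)).
  rewrite /r1 /largest_negative_root /=; congr (1 / (1 - _)).
  set S := [set _ | _].
  have [z0 pz hz] : S (xget 0 S) by apply: (xgetPex 0); exists (x / (x - 1)); split.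
  apply/eqP; rewrite eq_le root_le //=; exact: hz.
by field; repeat (apply/andP; split); apply/eqP; lra.
Qed.

Lemma r1_3 : r1 R 3 = 1 / 2.
Proof. by rewrite (r1E (@logistic_poly2_first_root R)); field. Qed.
End Polylog.

(** * Mixed differences of z |-> ln (1 + s z) *)

Section MixedDifferences.
Variable R : realType.
Implicit Types (z c : R) (g : R -> R) (l : seq (R * R)).

(** The mixed difference of t -> g (z t_1 ... t_k) over the box with sides l. The dilation z stays a
    free argument so that one side can be split off at a time. *)
Fixpoint mixed_diff g l : R -> R :=
  if l is (a, b) :: l' then mixed_diff (fun z => g (b * z) - g (a * z)) l' else g.

Lemma mixed_diffB g h l z :
  mixed_diff (fun z => g z - h z) l z = mixed_diff g l z - mixed_diff h l z.
Proof.
elim: l g h z => [//|[a b] l IH] g h z /=; rewrite -IH; congr (mixed_diff _ l z).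
by apply/funext => y; ring.
Qed.

Lemma mixed_diffM g c l z :
  mixed_diff (fun z => g (c * z)) l z = mixed_diff g l (c * z).
Proof.
elim: l g z => [//|[a b] l IH] g z /=; rewrite -IH; congr (mixed_diff _ l z).
by apply/funext => y; rewrite !(mulrCA c).
Qed.

Lemma mixed_diff_cons g a b l z :
  mixed_diff g ((a, b) :: l) z = mixed_diff g l (b * z) - mixed_diff g l (a * z).
Proof. by rewrite /= mixed_diffB !mixed_diffM. Qed.

Lemma mixed_diff_at0 g l : g 0 = 0 -> mixed_diff g l 0 = 0.
Proof. by move=> g0; case: l => [//|[a b] l]; rewrite mixed_diff_cons !mulr0 subrr. Qed.

(* [log_weight s k] is (z d/dz)^k ln (1 + s z). *)
Definition log_weight (s : R) (k : nat) (z : R) : R :=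
  if k is k'.+1 then (logistic_poly R k').[s * z / (1 + s * z)]
  else ln (1 + s * z).

Variable s : R.
Hypothesis s0 : 0 < s.
Local Notation L := (log_weight s).

Let den z : 0 <= z -> 0 < 1 + s * z.
Proof. by move=> z0; rewrite ltr_pwDl // mulr_ge0 // ltW. Qed.

Lemma log_weight_at0 k : L k 0 = 0.
Proof. by case: k => [|k]; rewrite /= mulr0 ?addr0 ?ln1 // mul0r logistic_poly_at0. Qed.

(** Written without the division by z of [is_derive_log_weight], so that it covers z = 0 and yields
    continuity there. *)
Lemma is_derive_log_weight0 k z : 0 <= z ->
  is_derive z 1 (L k)
   (if k is k'.+1 then (logistic_poly R k')^`().[s * z / (1 + s * z)] * (s / (1 + s * z) ^+ 2)
    else s / (1 + s * z)).
Proof.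
move=> z0; have d0 := den z0.
have dd : is_derive z 1 (fun z => 1 + s * z) s.
  have := is_deriveD (is_derive_cst (1 : R) z 1) (is_deriveZ s (is_derive_id z 1)).
  by move=> /is_derive_eq; apply; rewrite add0r /GRing.scale /= mulr1.
case: k => [|k].
  have := @is_derive1_comp _ (@ln R) (fun z => 1 + s * z) z _ _ (is_derive1_ln d0) dd.
  by move=> /is_derive_eq; apply; rewrite mulrC.
have dV : is_derive z 1 (fun x => (1 + s * x)^-1) (- (1 + s * z) ^- 2 *: s).
  by apply: is_deriveV => //; rewrite gt_eqF.
have dg : is_derive z 1 (fun x => s * x / (1 + s * x)) (s / (1 + s * z) ^+ 2).
  have := @is_deriveM _ _ (fun x => s * x) (fun x => (1 + s * x)^-1) z 1 _ _
    (is_deriveZ s (is_derive_id z 1)) dV.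
  move=> /is_derive_eq; apply; rewrite /GRing.scale /=; field.
  by rewrite gt_eqF.
exact: (@is_derive1_comp _ (horner (logistic_poly R k)) (fun x => s * x / (1 + s * x))
  z _ _ (is_derive_poly _ _) dg).
Qed.

(** With x = s z / (1 + s z) one has z dx/dz = x (1 - x), so z d/dz acts as the operator that
    generates [logistic_poly]. *)
Lemma is_derive_log_weight k z : 0 < z -> is_derive z 1 (L k) (L k.+1 z / z).
Proof.
move=> z0; have d0 := den (ltW z0).
have := is_derive_log_weight0 k (ltW z0) => /is_derive_eq; apply.
case: k => [|k]; first by rewrite /= hornerX; field; rewrite !gt_eqF.
by rewrite [L _]/(log_weight s k.+2) /log_weight logistic_polyS_horner; field; rewrite !gt_eqF.
Qed.

Lemma continuous_log_weight k z : 0 <= z -> {for z, continuous (L k)}.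
Proof.
move=> z0; apply/differentiable_continuous/derivable1_diffP.
by apply: ex_derive; exact: is_derive_log_weight0.
Qed.

Let box_ok l := all (fun ab => 0 <= ab.1 < ab.2) l.

Lemma continuous_mixed_diff k l z : box_ok l -> 0 <= z ->
  {for z, continuous (mixed_diff (L k) l)}.
Proof.
elim: l z => [|[a b] l IH] z; first by move=> _; exact: continuous_log_weight.
move=> ok z0; have [/andP[a0 ab] ol] := andP ok; rewrite /= -/(box_ok l) in a0 ab ol.
rewrite [X in {for _, continuous X}](_ : _ =
   (mixed_diff (L k) l \o *%R b) - (mixed_diff (L k) l \o *%R a)); last first.
  by apply/funext => y; rewrite mixed_diff_cons.
apply: continuousB; apply: continuous_comp.
- exact: mulrl_continuous.
- by apply: IH => //; rewrite mulr_ge0 // (le_trans a0) ?ltW.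
- exact: mulrl_continuous.
- by apply: IH => //; rewrite mulr_ge0.
Qed.

Lemma is_derive_mixed_diff k l z : box_ok l -> 0 < z ->
  is_derive z 1 (mixed_diff (L k) l) (mixed_diff (L k.+1) l z / z).
Proof.
elim: l z => [|[a b] l IH] z; first by move=> _; exact: is_derive_log_weight.
move=> ok z0; have [/andP[a0 ab] ol] := andP ok; rewrite /= -/(box_ok l) in a0 ab ol.
have part c : 0 <= c ->
    is_derive z 1 (fun z => mixed_diff (L k) l (c * z)) (mixed_diff (L k.+1) l (c * z) / z).
  (* A side may start at 0, as the first boxes of the representing measure do; the corresponding
     term is then constant in z. *)
  rewrite le_eqVlt => /predU1P[<-|c0].
    rewrite [X in is_derive _ _ X _](_ : _ = cst (mixed_diff (L k) l 0)); last first.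
      by apply/funext => y; rewrite mul0r.
    apply: is_derive_eq; rewrite mul0r mixed_diff_at0 ?mul0r //.
    exact: log_weight_at0.
  have := @is_derive1_comp _ (mixed_diff (L k) l) (fun z => c * z) z _ _
    (IH _ ol (mulr_gt0 c0 z0)) (is_deriveZ c (is_derive_id z 1)).
  move=> /is_derive_eq; apply; rewrite /GRing.scale /=; field.
  by rewrite !gt_eqF.
have := is_deriveB (part b (ltW (le_lt_trans a0 ab))) (part a a0).
rewrite [X in is_derive _ _ X _ -> _](_ : _ = mixed_diff (L k) ((a, b) :: l)).
  move=> /is_derive_eq; apply.
  by rewrite mixed_diff_cons mulrBl.
by apply/funext => y; rewrite mixed_diff_cons.
Qed.

(** Each side (a, b) is traded for one more z d/dz by the mean value theorem on [a z, b z]. The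
    result has the sign of a single value of [log_weight]. The lower bound on x serves necessity,
    where the box shrinks to the corner 1; the upper bound serves sufficiency, where the boxes lie
    in the unit cube. *)
Lemma mixed_diff_MVT k l z : box_ok l -> 0 < z -> exists c x,
  [/\ 0 < c, 0 < x, z * \prod_(ab <- l) ab.1 <= x <= z * \prod_(ab <- l) ab.2
    & mixed_diff (L k) l z = c * L (k + size l)%N x].
Proof.
elim: l k z => [|[a b] l IH] k z.
  by move=> _ z0; exists 1, z; rewrite !big_nil !mulr1 lexx addn0 mul1r.
move=> ok z0; have [/andP[a0 ab] ol] := andP ok; rewrite /= -/(box_ok l) in a0 ab ol.
have b0 := le_lt_trans a0 ab.
have azbz : a * z < b * z by rewrite ltr_pM2r.
have [||y yab hy] := @MVT _ (mixed_diff (L k) l) (fun z => mixed_diff (L k.+1) l z / z) _ _ azbz.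
  move=> y; rewrite in_itv /= => /andP[ay _].
  by apply: is_derive_mixed_diff => //; rewrite (le_lt_trans _ ay) ?mulr_ge0 // ltW.
  apply: continuous_in_subspaceT => y; rewrite inE /= in_itv /= => /andP[ay _].
  by apply: continuous_mixed_diff => //; rewrite (le_trans _ ay) ?mulr_ge0 // ltW.
move: yab; rewrite in_itv /= => /andP[ay yb].
have y0 : 0 < y by rewrite (le_lt_trans _ ay) ?mulr_ge0 // ltW.
have [c [x [c0 x0 /andP[xa xb] e]]] := IH k.+1 y ol y0.
exists (c * ((b * z - a * z) / y)), x; split=> //.
- by rewrite mulr_gt0 // divr_gt0 // subr_gt0.
- have pa0 : 0 <= \prod_(ab <- l) ab.1.
    by rewrite big_seq prodr_ge0 // => ab' /(allP ol) /andP[].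
  have pb0 : 0 <= \prod_(ab <- l) ab.2.
    by rewrite big_seq prodr_ge0 // => ab' /(allP ol) /andP[/le_trans h /ltW]; exact: h.
  rewrite !big_cons /= !mulrA !(mulrC z).
  by rewrite (le_trans _ xa) ?(le_trans xb) // ler_wpM2r // ltW.
- transitivity (mixed_diff (L k) l (b * z) - mixed_diff (L k) l (a * z)).
    exact: mixed_diff_cons.
  by rewrite hy e addSnnS; ring.
Qed.

Lemma mixed_diff_log_weight_ge0 l :
  all (fun ab => [&& 0 <= ab.1, ab.1 < ab.2 & ab.2 <= 1]) l ->
  (forall z, 0 < z <= 1 -> 0 <= L (size l) z) -> 0 <= mixed_diff (L 0) l 1.
Proof.
move=> ol h.
have [||c [x [c0 x0 /andP[_ xb] ->]]] := @mixed_diff_MVT 0 l 1 => //.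
  by apply: sub_all ol => ab /and3P[-> ->].
rewrite mulr_ge0 ?(ltW c0) // h // x0 (le_trans xb) // mul1r big_seq prodr_ile1 //.
by move=> ab /(allP ol) /and3P[h0 h1 ->]; rewrite (le_trans h0) // ltW.
Qed.

End MixedDifferences.

(** * Void probabilities of the chain *)

Section BooleanEvents.
Context d (T : measurableType d) (R : realType) (P : probability T R).
Implicit Types b c : T -> bool.

Definition prb b : R := fine (P [set w | b w]).

Lemma measurable_boolP b : measurable_fun setT b -> measurable [set w | b w].
Proof.
move=> mb; rewrite (_ : [set w | b w] = setT `&` b @^-1` [set true]) ?setTI //.
by rewrite -[X in measurable X]setTI; exact: mb.
Qed.

Lemma measurable_bool_comp (f : bool -> bool) b :
  measurable_fun setT b -> measurable_fun setT (fun w => f (b w)).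
Proof. by move=> mb; apply: (@measurableT_comp _ _ _ _ _ _ f). Qed.

Lemma measurable_all_seq (I : Type) (f : I -> T -> bool) (s : seq I) :
  (forall i, measurable_fun setT (f i)) ->
  measurable_fun setT (fun w => all (fun i => f i w) s).
Proof.
move=> mf; elim: s => [|i s IH] /=; first exact: measurable_cst.
exact: measurable_and.
Qed.

Lemma prbE b : measurable_fun setT b -> P [set w | b w] = (prb b)%:E.
Proof. by move=> /measurable_boolP mb; rewrite fineK // fin_num_measure. Qed.

Lemma eq_prb b c : b =1 c -> prb b = prb c.
Proof. by move=> /funext ->. Qed.

Lemma prbID b c : measurable_fun setT b -> measurable_fun setT c ->
  prb b = prb (fun w => b w && c w) + prb (fun w => b w && ~~ c w).
Proof.
move=> mb mc; have m1 : measurable_fun setT (fun w => b w && c w) by exact: measurable_and.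
have m2 : measurable_fun setT (fun w => b w && ~~ c w).
  by apply: measurable_and => //; exact: (measurable_bool_comp negb).
apply: EFin_inj; rewrite EFinD -!prbE // -measureU //.
- congr (P _); apply/seteqP; split => w /=; first by move=> ->; case: (c w); [left|right].
  by move=> [] /andP[].
- exact: measurable_boolP.
- exact: measurable_boolP.
- by apply/seteqP; split => w //= [] /andP[_ ->] /andP[].
Qed.

Lemma prbT : prb (fun=> true) = 1.
Proof.
rewrite /prb (_ : [set _ | _] = setT) ?probability_setT //.
by apply/seteqP; split.
Qed.

Lemma prb0 : prb (fun=> false) = 0.
Proof. by rewrite /prb (_ : [set _ | _] = set0) ?measure0 //; apply/seteqP; split. Qed.

End BooleanEvents.

(** * Finite-dimensional laws of a tree-indexed chain *)

Section TreeChain.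
Context d (T : measurableType d) (R : realType) (P : probability T R).
Variables (V : countType) (o : V) (par : V -> V) (r p : R).
Variables (Rv C : V -> {RV P >-> bool}) (X : V -> {RV P >-> bool}).
Let Y (i : V + V) : T -> bool := match i with inl v => Rv v | inr v => C v end.
Hypothesis indepY : mutually_independent P Y.
Hypothesis PR : forall v, P (Rv v @^-1` [set false]) = r%:E.
Hypothesis PC : forall v, P (C v @^-1` [set true]) = p%:E.
Hypothesis Xo : forall w, X o w = Rv o w.
Hypothesis XS : forall v w, v != o -> X v w = if C v w then Rv v w else X (par v) w.

Definition state_prob (b : bool) : R := if b then 1 - r else r.

Definition transition (a b : bool) : R :=
  p * state_prob b + (1 - p) * (a == b)%:R.

(** Detailed balance, by which the path between the root and the center of the octopus can be read
    from the center. *)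
Lemma transition_reversible a b :
  state_prob a * transition a b = state_prob b * transition b a.
Proof. by rewrite /transition /state_prob; case: a b => [] [] /=; ring. Qed.

(* W ends with the root and lists the parent of each of its other vertices
   after that vertex. *)
Fixpoint root_last (W : seq V) : bool :=
  if W is v :: W' then
    if W' is _ :: _ then [&& v \notin W', v != o, par v \in W' & root_last W']
    else v == o
  else false.

Fixpoint chain_weight (W : seq V) (x : V -> bool) : R :=
  if W is v :: W' then
    (if W' is _ :: _ then transition (x (par v)) (x v) else state_prob (x v)) *
      chain_weight W' x
  else 1.

Definition cylinder (W : seq V) (x : V -> bool) : T -> bool :=
  fun w => all (fun v => X v w == x v) W.

Lemma measurable_cylinder W x : measurable_fun setT (cylinder W x).
Proof. by apply: measurable_all_seq => v; exact: (measurable_bool_comp (eq_op^~ (x v))). Qed.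

Let coins (D : seq (V + V)) (y : V + V -> bool) : T -> bool :=
  fun w => all (fun i => Y i w == y i) D.

Let mY i : measurable_fun setT (Y i).
Proof. by case: i => v; exact: measurable_funP. Qed.

Let mcoins D y : measurable_fun setT (coins D y).
Proof. by apply: measurable_all_seq => i; exact: (measurable_bool_comp (eq_op^~ (y i))). Qed.

Let PY i b : prb P (fun w => Y i w == b) =
  match i with inl _ => state_prob b | inr _ => if b then p else 1 - p end.
Proof.
have meq (f : T -> bool) c : measurable_fun setT f ->
    measurable_fun setT (fun w => f w == c).
  by move=> mf; exact: (measurable_bool_comp (eq_op^~ c)).
have neg (f : T -> bool) c : measurable_fun setT f ->
    prb P (fun w => f w == ~~ c) = 1 - prb P (fun w => f w == c).
  move=> mf; rewrite -(prbT P).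
  rewrite (@prbID _ _ _ P (fun=> true) (fun w => f w == c)) //; last first.
    exact: meq.
  rewrite [X in _ = X + _ - _](@eq_prb _ _ _ P _ (fun w => f w == c)) //.
  rewrite addrAC subrr add0r; apply: eq_prb => w /=.
  by case: (f w) c => [] [].
have key (f : T -> bool) c : prb P (fun w => f w == c) = fine (P (f @^-1` [set c])).
  by congr (fine (P _)); apply/seteqP; split => w /= /eqP.
case: i => v; case: b => /=.
- by rewrite (neg _ false) ?key ?PR.
- by rewrite key PR.
- by rewrite key PC.
- by rewrite (neg _ true) ?key ?PC.
Qed.

Let pcoin y i : R := prb P (fun w => Y i w == y i).

Lemma root_last_mem W : root_last W -> o \in W.
Proof.
elim: W => [//|v [_ /eqP ->|u W IH]] /=; first by rewrite inE eqxx.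
by move=> /and4P[_ _ _ /IH h]; rewrite in_cons h orbT.
Qed.

Let coins_prod D y : uniq D -> prb P (coins D y) = \prod_(i <- D) pcoin y i.
Proof.
move=> uD; apply: EFin_inj; rewrite -prbE // -prodEFin.
have := @indepY D (fun i => [set y i]) uD (fun=> I).
have pre i : Y i @^-1` [set y i] = [set w | Y i w == y i].
  by apply/seteqP; split => w /= /eqP.
rewrite (_ : \bigcap_(i in [set` D]) _ = [set w | coins D y w]) => [->|].
  apply: eq_bigr => i _; rewrite pre prbE //.
  exact: (measurable_bool_comp (eq_op^~ (y i))).
apply/seteqP; split => w /=.
  by move=> h; apply/allP => i iD; apply/eqP; exact: h.
by move=> /allP h i iD; apply/eqP; exact: h.
Qed.

(** The induction on W needs the list D of coins that W does not use. Removing the first vertex v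
    hands its coins over to D: both [Rv v] and [C v] when v is refreshed, only [C v] when it copies
    its parent. *)
Let joint_law W x D y : root_last W -> uniq D ->
  (forall v, v \in W -> (inl v \notin D) && (inr v \notin D)) ->
  prb P (fun w => cylinder W x w && coins D y w) =
  chain_weight W x * \prod_(i <- D) pcoin y i.
Proof.
elim: W D y => [//|v W IH] D y rl uD WD.
have up D' (z : V + V -> bool) : {in D', z =1 y} ->
    \prod_(i <- D') pcoin z i = \prod_(i <- D') pcoin y i.
  by move=> e; rewrite !big_seq; apply: eq_bigr => i iD; rewrite /pcoin e.
have upc D' (z : V + V -> bool) w : {in D', z =1 y} -> coins D' z w = coins D' y w.
  by move=> e; apply: eq_in_all => i iD; rewrite e.
have /andP[lv rv] := WD v (mem_head _ _).
pose z b1 b2 i := if i == inl v then b1 else if i == inr v then b2 else y i.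
have zD b1 b2 : {in D, z b1 b2 =1 y}.
  move=> i iD; rewrite /z; case: eqP => [e|_]; first by rewrite -e iD in lv.
  by case: eqP => [e|//]; rewrite -e iD in rv.
have zl b1 b2 : z b1 b2 (inl v) = b1 by rewrite /z eqxx.
have zr b1 b2 : z b1 b2 (inr v) = b2 by rewrite /z eqxx.
have mC W' D' y' : measurable_fun setT (fun w => cylinder W' x w && coins D' y' w).
  by apply: measurable_and; [exact: measurable_cylinder|exact: mcoins].
case: W => [|u W] in IH rl WD *.
  have vo : v = o by apply/eqP.
  subst v; rewrite (@eq_prb _ _ _ P _ (coins (inl o :: D) (z (x o) true))); last first.
    by move=> w; rewrite /= zl upc // /cylinder /= Xo andbT.
  rewrite coins_prod ?cons_uniq ?lv // big_cons (up D) //.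
  by rewrite /pcoin PY zl /= mulr1.
have /and4P[vW vo pvW rl'] := rl.
rewrite (@prbID _ _ _ P _ (C v)) //.
have WD' D' : {subset D' <= inl v :: inr v :: D} ->
    forall v', v' \in u :: W -> (inl v' \notin D') && (inr v' \notin D').
  move=> sub v' v'W; have /andP[l' r'] := WD v' (@mem_behead _ [:: v, u & W] v' v'W).
  have vv : v' != v by apply: contraNneq vW => <-.
  apply/andP; split; apply/negP => /sub; rewrite !in_cons.
    case/or3P => [/eqP[e]|//|h]; first by rewrite e eqxx in vv.
    by rewrite h in l'.
  case/or3P => [//|/eqP[e]|h]; first by rewrite e eqxx in vv.
  by rewrite h in r'.
rewrite (@eq_prb _ _ _ P _ (fun w => cylinder (u :: W) x w &&
    coins (inl v :: inr v :: D) (z (x v) true) w)); last first.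
  move=> w; rewrite [cylinder _ _ _]/= -/(cylinder (u :: W) x w) XS //.
  rewrite [coins (_ :: _) _ _]/= zl zr -/(coins D _ w) upc //=.
  by case: (C v w) => /=; case: (Rv v w == x v); case: (X u w == x u);
    case: (cylinder W x w); case: (coins D y w); rewrite /= ?andbF.
rewrite IH //; last 2 first.
- by rewrite !cons_uniq in_cons negb_or lv rv uD.
- exact: WD'.
(* Without a refresh v copies its parent, whose state is prescribed by the rest of W, so the
   condition on v is no longer random. *)
rewrite (@eq_prb _ _ _ P _ (fun w => (x (par v) == x v) && (cylinder (u :: W) x w &&
    coins (inr v :: D) (z (x v) false) w))); last first.
  move=> w; have -> : cylinder [:: v, u & W] x w = (X v w == x v) && cylinder (u :: W) x w by [].
  rewrite XS // [coins (_ :: _) _ _]/= zr -/(coins D _ w) upc //.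
  case: (boolP (cylinder (u :: W) x w)) => [/allP h|_]; last by rewrite !andbF.
  rewrite -(eqP (h _ pvW)).
  by case: (C v w); rewrite /= ?andbF ?andbT.
have e2 : prb P (fun w => (x (par v) == x v) && (cylinder (u :: W) x w &&
    coins (inr v :: D) (z (x v) false) w)) =
    (x (par v) == x v)%:R * (chain_weight (u :: W) x * ((1 - p) * \prod_(i <- D) pcoin y i)).
  case: (x (par v) == x v); last by rewrite mul0r; exact: prb0.
  rewrite mul1r.
  transitivity (prb P (fun w => cylinder (u :: W) x w &&
    coins (inr v :: D) (z (x v) false) w)); first by [].
  rewrite IH //; last 2 first.
  - by rewrite cons_uniq rv.
  - by apply: WD' => i; rewrite !in_cons => /orP[->|->]; rewrite ?orbT.
  by rewrite big_cons up // /pcoin PY zr.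
rewrite e2 !big_cons up // /pcoin !PY zl zr.
rewrite [chain_weight (v :: _) x]/= -/(chain_weight (u :: W) x) /transition.
by rewrite [LHS]/= -/(chain_weight (u :: W) x); ring.
Qed.

Lemma cylinder_law W x : root_last W -> prb P (cylinder W x) = chain_weight W x.
Proof.
move=> rl; have := @joint_law W x [::] (fun=> true) rl isT (fun _ _ => isT).
by rewrite big_nil mulr1 => <-; apply: eq_prb => w; rewrite andbT.
Qed.

End TreeChain.

(** * Distances and parents from a height function *)

Section GraphDistance.
Variables (V : eqType) (e : rel V) (o : V) (h : V -> nat) (par : V -> V).
Hypothesis ho : h o = 0%N.
Hypothesis hle : forall x y, e x y -> (h y <= (h x).+1)%N.
Hypothesis sym_e : symmetric e.
Hypothesis par_edge : forall x, x != o -> e x (par x).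
Hypothesis par_h : forall x, x != o -> h x = (h (par x)).+1.

Lemma height_walk n x : walk_length e o x n -> (h x <= n)%N.
Proof.
move=> [s [ps <- <-]]; suff H y : path e y s -> (h (last y s) <= h y + size s)%N.
  by have := H o ps; rewrite ho.
elim: s y {ps} => [|z s IH] y /=; first by rewrite addn0.
move=> /andP[/hle h1 /IH h2]; rewrite (leq_trans h2) // -addSnnS leq_add2r.
exact: h1.
Qed.

Lemma walk_height x : walk_length e o x (h x).
Proof.
move: {2}(h x) (leqnn (h x)) => n; elim: n x => [|n IH] x hx.
  have [->|xo] := eqVneq x o; first by rewrite ho; exists [::].
  by move: hx; rewrite (par_h xo).
have [->|xo] := eqVneq x o; first by rewrite ho; exists [::].
have [|s [ps ls ss]] := IH (par x); first by rewrite -ltnS -par_h.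
exists (rcons s x); split; last by rewrite size_rcons ss -par_h.
  by rewrite rcons_path ps ls sym_e par_edge.
by rewrite last_rcons.
Qed.

(** The height rises by at most 1 along an edge, so no walk is shorter, and following the parents
    attains it. *)
Lemma graph_distE x : graph_dist e o x = h x.
Proof.
apply: xget_unique => [|y [wy hy]].
  by split; [exact: walk_height|move=> k; exact: height_walk].
by apply/eqP; rewrite eqn_leq hy ?height_walk //; exact: walk_height.
Qed.

Lemma is_parent_par x : x != o -> is_parent e o x (par x).
Proof.
move=> xo; split=> [|u xu]; first exact: par_edge.
by rewrite !graph_distE -ltnS -par_h // hle // sym_e.
Qed.

End GraphDistance.

(** * The octopus tree rooted at an arbitrary vertex *)

Section Octopus.
Variables (m : nat) (i0 : 'I_m) (K : nat).
Local Notation V := (octopus_vertex m).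
Local Notation e := (@octopus_edge m).

(* The vertex of leg i at distance k from the center. *)
Definition leg_vertex (i : 'I_m) (k : nat) : V :=
  if k is k'.+1 then Some (i, k') else None.

Let o := leg_vertex i0 K.

(** The root is the vertex of leg [i0] at distance K. Strictly between it and the center the parent
    lies one step further out, which is distance [k.+2] because [Some (i, k)] has distance [k.+1];
    on all other leg vertices the parent lies one step inwards. *)
Definition octopus_parent (v : V) : V :=
  if v is Some (i, k) then
    leg_vertex i (if (i == i0) && (k.+1 < K)%N then k.+2 else k)
  else leg_vertex i0 1.

(** The distance to the root; the sum of two truncated subtractions is an absolute difference. *)
Let height (v : V) : nat :=
  if v is Some (i, k) then
    if i == i0 then ((K - k.+1) + (k.+1 - K))%N else (K + k.+1)%N
  else K.

Lemma octopus_edge_sym : symmetric e.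
Proof.
move=> [[i k]|] [[j l]|] //=; rewrite eq_sym; congr (_ && _).
by rewrite orbC.
Qed.

Lemma octopus_is_parent v : v != o -> is_parent e o v (octopus_parent v).
Proof.
apply: (is_parent_par (h := height)).
- rewrite /o /height; case: K => [//|k] /=; rewrite eqxx; lia.
- move=> [[i k]|] [[j l]|] //=.
  + case/andP => /eqP -> /orP[] /eqP ->; case: (_ == _); lia.
  + move=> /eqP ->; case: (_ == _); lia.
  + move=> /eqP ->; case: (_ == _); lia.
- exact: octopus_edge_sym.
- rewrite /o => -[[i k]|] //=.
  case: (altP (i =P i0)) => [->|ne] /=; last by case: k => [|k] //= _; rewrite eqxx /= eqxx ?orbT.
  case: (ltngtP k.+1 K) => [lt|gt|<-] /=; rewrite ?eqxx ?orbT //.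
  case: k gt => [|k] //= _; rewrite ?eqxx ?orbT //.
- rewrite /o => -[[i k]|] /=; last by rewrite /height; case: K => [//|k _] /=; rewrite eqxx; lia.
  case: (altP (i =P i0)) => [->|ne] /=.
    case: (ltngtP k.+1 K) => [lt|gt|<-] /=; rewrite ?eqxx //; first by lia.
    by case: k gt => [|k] gt /=; rewrite ?eqxx; lia.
  by case: k => [|k] /= _; rewrite ?(negPf ne); lia.
Qed.

End Octopus.

(** * Void probabilities on the octopus, read from the center *)

Section OctopusLaw.
Context d (T : measurableType d) (R : realType) (P : probability T R).
Variables (m : nat) (i0 : 'I_m) (K : nat) (r p : R).
Local Notation V := (octopus_vertex m).
Let o : V := leg_vertex i0 K.
Let par := octopus_parent i0 K.
Variables (X : V -> {RV P >-> bool}).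
Hypothesis r01 : 0 < r < 1.
Hypothesis path_law : forall W x, root_last o par W ->
  prb P (cylinder X W x) = chain_weight par r p W x.
Local Notation lv := (@leg_vertex m).
Local Notation q := (1 - p).

Let r1_neq0 : 1 - r != 0.
Proof. by case/andP: r01 => _ r1; rewrite subr_eq0 gt_eqF. Qed.

(* [leg_void a y] is the probability that the chain started at a vertex of
   state 0 with probability r + (1 - r) * y avoids state 1 at the positions
   marked by a. *)
Fixpoint leg_void (a : seq bool) (y : R) : R :=
  match a with
  | [::] => 1
  | false :: a' => leg_void a' (q * y)
  | true :: a' => (r + (1 - r) * (q * y)) * leg_void a' 1
  end.

(** The solution y of r + (1 - r) y = 1 for state 0 and of r + (1 - r) y = 0 for state 1. In this
    coordinate a step of the chain multiplies the mean by q. *)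
Definition state_coord (b : bool) : R := if b then - r / (1 - r) else 1.

Lemma leg_void_affine a t x y :
  t * leg_void a x + (1 - t) * leg_void a y = leg_void a (t * x + (1 - t) * y).
Proof.
elim: a x y => [|[] a IH] x y /=; first by ring.
  by ring.
by rewrite IH; congr leg_void; ring.
Qed.

(** [leg_void] is affine in its coordinate, so averaging over the next state only averages the
    coordinate, from [state_coord b] to q times it. A mark c removes the term of state 1. *)
Lemma leg_void_transition c a b :
  (c ==> ~~ true)%:R * transition r p b true * leg_void a (state_coord true) +
  transition r p b false * leg_void a (state_coord false) =
  leg_void (c :: a) (state_coord b).
Proof.
have e1 : transition r p b true = 1 - transition r p b false.
  by rewrite /transition /state_prob; case: b => /=; ring.
have e2 : transition r p b false = r + (1 - r) * (q * state_coord b).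
  by rewrite /transition /state_prob /state_coord; case: (b) => /=; field.
case: c => /=; first by rewrite !mul0r add0r e2.
rewrite mul1r e1 addrC leg_void_affine e2; congr leg_void.
by field.
Qed.

Fixpoint leg_clear (i : 'I_m) (k : nat) (a : seq bool) (w : T) : bool :=
  if a is c :: a' then (c ==> ~~ X (lv i k.+1) w) && leg_clear i k.+1 a' w
  else true.

Definition legs_clear (l : seq ('I_m * nat * seq bool)) (w : T) : bool :=
  all (fun L => leg_clear L.1.1 L.1.2 L.2 w) l.

Lemma measurable_leg_clear i k a : measurable_fun setT (leg_clear i k a).
Proof.
elim: a k => [|c a IH] k /=; first exact: measurable_cst.
apply: measurable_and => //.
exact: (measurable_bool_comp (fun b => c ==> ~~ b)).
Qed.

Lemma measurable_legs_clear l : measurable_fun setT (legs_clear l).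
Proof. by apply: measurable_all_seq => L; exact: measurable_leg_clear. Qed.

Definition update (x : V -> bool) v b u := if u == v then b else x u.

Lemma update_same x v b : update x v b v = b.
Proof. by rewrite /update eqxx. Qed.

Lemma update_other x v b u : u != v -> update x v b u = x u.
Proof. by rewrite /update => /negPf ->. Qed.

Lemma cylinder_update W x v b w : v \notin W ->
  cylinder X (v :: W) (update x v b) w = (X v w == b) && cylinder X W x w.
Proof.
move=> vW; rewrite /cylinder /= update_same; congr (_ && _).
apply: eq_in_all => u uW; rewrite update_other //.
by apply: contraNneq vW => <-.
Qed.

Lemma chain_weight_update W x v b : v \notin W -> root_last o par W ->
  chain_weight par r p W (update x v b) = chain_weight par r p W x.
Proof.
move=> vW; elim: W vW => [//|u W IH]; rewrite inE negb_or => /andP[vu vW] rl.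
have ux : update x v b u = x u by rewrite update_other // eq_sym.
case: W => [|u' W] in IH vW rl *; first by rewrite /= ux.
have /and4P[uW uo puW rl'] := rl.
have pux : update x v b (par u) = x (par u).
  by rewrite update_other //; apply: contraNneq vW => <-.
by rewrite [LHS]/= [RHS]/= ux pux; congr (_ * _); exact: IH.
Qed.

(* An entry (i, k, a) of l is a leg i explored up to distance k, with marks a on
   the vertices beyond. *)
Definition legs_outside (W : seq V) (l : seq ('I_m * nat * seq bool)) :=
  forall L, L \in l -> lv L.1.1 L.1.2 \in W /\
    forall k, (L.1.2 < k)%N -> lv L.1.1 k \notin W /\ par (lv L.1.1 k) = lv L.1.1 k.-1.

Lemma leg_vertex_inj i j k l : (0 < k)%N -> lv i k = lv j l -> i = j /\ k = l.
Proof. by case: k l => [|k] [|l] // _ [-> ->]. Qed.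

(** The outer induction runs over the legs, the inner one over the marks of the first leg. An inner
    step adds the next vertex of that leg to W in both of its states and merges the two terms by
    [leg_void_transition]. *)
Lemma legs_law l W x : root_last o par W -> uniq [seq L.1.1 | L <- l] ->
  legs_outside W l ->
  prb P (fun w => cylinder X W x w && legs_clear l w) =
  chain_weight par r p W x *
  \prod_(L <- l) leg_void L.2 (state_coord (x (lv L.1.1 L.1.2))).
Proof.
elim: l W x => [|[[i k] a] l IHl] W x rl ul out.
  by rewrite big_nil mulr1 -path_law //; apply: eq_prb => w; rewrite andbT.
have {}ul : uniq (i :: [seq L.1.1 | L <- l]) := ul.
elim: a k W x rl out => [|c a IHa] k W x rl out.
  rewrite big_cons /= mul1r -IHl //; first by case/andP: ul.
  by move=> L Ll; apply: out; rewrite in_cons Ll orbT.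
have [kW kout] := out _ (mem_head _ _); rewrite /= in kW kout.
pose v := lv i k.+1.
have [vW pv] : v \notin W /\ par v = lv i k := kout k.+1 (ltnSn k).
have rl' : root_last o par (v :: W).
  have oW := root_last_mem rl.
  have vo : v != o by apply: contraNneq vW => ->.
  by case: W rl vW kW oW {out kout} => [//|u W] rl vW kW oW; apply/and4P; rewrite pv.
have out' : legs_outside (v :: W) ((i, k.+1, a) :: l).
  move=> L; rewrite inE => /predU1P[->|Ll] /=.
    split=> [|k' kk']; first exact: mem_head.
    have [h1 h2] := kout k' (ltnW kk'); split=> //.
    rewrite inE negb_or h1 andbT; apply/eqP => /leg_vertex_inj -[|_ e].
      exact: leq_ltn_trans kk'.
    by rewrite e ltnn in kk'.
  have [h1 h2] := out L (mem_behead (s := _ :: l) Ll).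
  split=> [|k' kk']; first by rewrite inE h1 orbT.
  have [h3 h4] := h2 k' kk'; split=> //.
  rewrite inE negb_or h3 andbT; apply/eqP => /leg_vertex_inj -[|e _].
    exact: leq_ltn_trans kk'.
  by move: ul; rewrite /= -e (map_f (fun L => L.1.1) Ll).
have wS b : chain_weight par r p (v :: W) (update x v b) =
    transition r p (x (lv i k)) b * chain_weight par r p W x.
  case: W rl vW kW rl' {out kout out'} => [//|u W] rl vW kW rl'.
  transitivity (transition r p (update x v b (par v)) (update x v b v) *
    chain_weight par r p (u :: W) (update x v b)); first by [].
  rewrite pv update_same chain_weight_update // update_other //.
  by apply: contraNneq vW => <-.
have term b : prb P (fun w => cylinder X W x w && legs_clear ((i, k.+1, a) :: l) w && (X v w == b)) =
    transition r p (x (lv i k)) b * chain_weight par r p W x *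
    (leg_void a (state_coord b) * \prod_(L <- l) leg_void L.2 (state_coord (x (lv L.1.1 L.1.2)))).
  rewrite (@eq_prb _ _ _ P _ (fun w => cylinder X (v :: W) (update x v b) w &&
      legs_clear ((i, k.+1, a) :: l) w)); last first.
    by move=> w; rewrite cylinder_update // andbC andbA.
  rewrite IHa // wS big_cons /= -/v update_same; congr (_ * (_ * _)).
  rewrite !big_seq; apply: eq_bigr => L Ll; rewrite update_other //.
  have [h1 _] := out L (mem_behead (s := _ :: l) Ll).
  by apply: contraNneq vW => <-.
rewrite big_cons -[leg_void _.2 _]/(leg_void (c :: a) (state_coord (x (lv i k)))).
rewrite -leg_void_transition.
have mE a' k' : measurable_fun setT
    (fun w => cylinder X W x w && legs_clear ((i, k', a') :: l) w).
  apply: measurable_and; first exact: measurable_cylinder.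
  exact: measurable_legs_clear.
rewrite (@prbID _ _ _ P _ (X v)) //.
rewrite (@eq_prb _ _ _ P (fun w => cylinder X W x w && legs_clear ((i, k, c :: a) :: l) w && ~~ X v w)
  (fun w => cylinder X W x w && legs_clear ((i, k.+1, a) :: l) w && (X v w == false))); last first.
  by move=> w; rewrite /= -/v; case: (X v w); rewrite /= ?andbF ?andbT ?implybT.
rewrite term.
have -> : prb P (fun w => cylinder X W x w && legs_clear ((i, k, c :: a) :: l) w && X v w) =
    (c ==> ~~ true)%:R * prb P (fun w => cylinder X W x w && legs_clear ((i, k.+1, a) :: l) w && (X v w == true)).
  case: (c) => /=; [rewrite mul0r -[RHS](prb0 P) | rewrite mul1r]; apply: eq_prb => w /=;
    rewrite -/v; by case: (X v w); rewrite /= ?andbF.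
by rewrite term; ring.
Qed.

Let lv0_inj : injective (lv i0).
Proof. by case=> [|k] [|l] // [->]. Qed.

Let par_lt j : (j < K)%N -> par (lv i0 j) = lv i0 j.+1.
Proof. by case: j => [//|j] lt; rewrite /par /= eqxx lt. Qed.

Let path n := [seq lv i0 j | j <- iota (K - n) n.+1].

Let path_cons n : (n < K)%N -> path n.+1 = lv i0 (K - n.+1) :: path n.
Proof. by move=> lt; rewrite /path; have -> : (K - n)%N = (K - n.+1).+1 by lia. Qed.

Let path_chain n : (n <= K)%N -> root_last o par (path n).
Proof.
elim: n => [|n IH] le; first by rewrite /path subn0 /= eqxx.
rewrite path_cons //; have rl := IH (ltnW le).
have lt : (K - n.+1 < K)%N by lia.
have eS : (K - n.+1).+1 = (K - n)%N by lia.
apply/and4P; split=> //.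
- rewrite mem_map // mem_iota eS negb_and -ltnNge -eS ltnSn //.
- by apply/eqP => /lv0_inj e; rewrite e ltnn in lt.
- by rewrite -/(par _) par_lt // map_f // mem_iota eS leqnn addnS ltnS leq_addr.
Qed.

(** Along this path the parents point outwards; detailed balance turns every step, so that the
    weight becomes that of a chain started at the end nearest to the center. *)
Let path_weight n x : (n <= K)%N ->
  chain_weight par r p (path n) x = state_prob r (x (lv i0 (K - n))) *
    \prod_(K - n <= j < K) transition r p (x (lv i0 j)) (x (lv i0 j.+1)).
Proof.
elim: n => [|n IH] le; first by rewrite /path subn0 /= big_geq // !mulr1.
have lt : (K - n.+1 < K)%N by lia.
have eS : (K - n.+1).+1 = (K - n)%N by lia.
rewrite path_cons //.
transitivity (transition r p (x (par (lv i0 (K - n.+1)))) (x (lv i0 (K - n.+1))) *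
  chain_weight par r p (path n) x); first by [].
rewrite IH ?(ltnW le) // par_lt // eS mulrA [transition _ _ _ _ * _]mulrC.
by rewrite transition_reversible -eS [in RHS]big_ltn // mulrA.
Qed.

(** [legs_law] handles only legs leading away from the root. It is applied with the whole path from
    the center to the root prescribed, j = K; then the states at distances K, K - 1, ..., j + 1 are
    summed out, each becoming one more step of [leg_void] on leg [i0]. The marks a must reach the
    root for this, and at j = 0 only the center is left. *)
Let path_partial_law l x a j : (j <= K)%N -> (K <= size a)%N ->
  uniq (i0 :: [seq L.1.1 | L <- l]) -> (forall L, L \in l -> L.1.2 = 0%N) ->
  prb P (fun w => cylinder X [seq lv i0 k | k <- iota 0 j.+1] x w &&
    legs_clear ((i0, j, drop j a) :: l) w) =
  state_prob r (x None) *
   \prod_(0 <= k < j) transition r p (x (lv i0 k)) (x (lv i0 k.+1)) *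
   (leg_void (drop j a) (state_coord (x (lv i0 j))) *
    \prod_(L <- l) leg_void L.2 (state_coord (x None))).
Proof.
move=> jK Ka ul l0; rewrite -(subKn jK); have := leq_subr j K.
move: (K - j)%N => n {j jK}; elim: n x => [|n IH] x nK.
  rewrite subn0 (_ : [seq _ | _ <- _] = path K); last by rewrite /path subnn.
  rewrite legs_law ?path_chain //.
    rewrite path_weight // subnn big_cons; congr (_ * (_ * _)).
    by rewrite !big_seq; apply: eq_bigr => L /l0 ->.
  move=> L; rewrite inE => /predU1P[->|Ll] /=.
    split=> [|k Kk]; first by rewrite map_f // mem_iota subnn add0n ltnSn.
    split; first by rewrite mem_map // mem_iota subnn /= add0n -leqNgt.
    by case: k Kk => [//|k] Kk; rewrite /par /= eqxx /= ltnNge (ltnW Kk).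
  rewrite (l0 _ Ll); split=> [|k k0].
    by rewrite /= (_ : None = lv i0 0) // map_f // mem_iota subnn add0n.
  have ne : L.1.1 != i0.
    by case/andP: ul => h _; apply: contraNneq h => <-; exact: map_f.
  split; first by apply/mapP => -[k' _ /leg_vertex_inj -[//|e]]; rewrite e eqxx in ne.
  by case: k k0 => [//|k] _; rewrite /par /= (negPf ne).
have eS : (K - n.+1).+1 = (K - n)%N by lia.
have lt : (K - n.+1 < K)%N by lia.
set j := (K - n.+1)%N in eS lt *; rewrite -eS in IH.
rewrite (drop_nth false (leq_trans lt Ka)); set c := nth _ _ _; pose v := lv i0 j.+1.
have vW : v \notin [seq lv i0 k | k <- iota 0 j.+1].
  by rewrite mem_map // mem_iota add0n ltnn.
have iE : iota 0 j.+2 = iota 0 j.+1 ++ [:: j.+1] by rewrite -addn1 iotaD.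
have xE b k : (k <= j)%N -> update x v b (lv i0 k) = x (lv i0 k).
  by move=> kj; rewrite update_other //; apply/eqP => /lv0_inj e; rewrite e ltnn in kj.
have x0 b : update x v b None = x None by rewrite update_other.
have term b : prb P (fun w => cylinder X [seq lv i0 k | k <- iota 0 j.+1] x w &&
      legs_clear ((i0, j.+1, drop j.+1 a) :: l) w && (X v w == b)) =
    state_prob r (x None) *
     (\prod_(0 <= k < j) transition r p (x (lv i0 k)) (x (lv i0 k.+1)) *
      transition r p (x (lv i0 j)) b) *
     (leg_void (drop j.+1 a) (state_coord b) *
      \prod_(L <- l) leg_void L.2 (state_coord (x None))).
  have pE : \prod_(0 <= k < j) transition r p (x (lv i0 k)) (x (lv i0 k.+1)) =
     \prod_(0 <= k < j) transition r p (update x v b (lv i0 k)) (update x v b (lv i0 k.+1)).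
    by apply: eq_big_nat => k /andP[_ kj]; rewrite !xE // ltnW.
  have := IH (update x v b) (ltnW nK).
  rewrite x0 big_nat_recr // (xE b j) // -/v update_same -pE => <-; apply: eq_prb => w.
  suff -> : cylinder X [seq lv i0 k | k <- iota 0 j.+2] (update x v b) w =
      cylinder X [seq lv i0 k | k <- iota 0 j.+1] x w && (X v w == b) by rewrite andbAC.
  rewrite iE map_cat /cylinder all_cat; congr (_ && _); last first.
    by rewrite map_cons all_seq1 -/v update_same.
  apply: eq_in_all => u /mapP[k]; rewrite mem_iota add0n ltnS => /andP[_ kj] ->.
  by rewrite xE.
rewrite -leg_void_transition.
have mE a' k' : measurable_fun setT
    (fun w => cylinder X [seq lv i0 k | k <- iota 0 j.+1] x w && legs_clear ((i0, k', a') :: l) w).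
  apply: measurable_and; first exact: measurable_cylinder.
  exact: measurable_legs_clear.
rewrite (@prbID _ _ _ P _ (X v)) //.
rewrite (@eq_prb _ _ _ P (fun w => cylinder X _ x w && legs_clear ((i0, j, c :: _) :: l) w && ~~ X v w)
  (fun w => cylinder X [seq lv i0 k | k <- iota 0 j.+1] x w &&
    legs_clear ((i0, j.+1, drop j.+1 a) :: l) w && (X v w == false))); last first.
  by move=> w; rewrite /= -/v; case: (X v w); rewrite /= ?andbF ?andbT ?implybT.
rewrite term.
have -> : prb P (fun w => cylinder X [seq lv i0 k | k <- iota 0 j.+1] x w &&
      legs_clear ((i0, j, c :: drop j.+1 a) :: l) w && X v w) =
    (c ==> ~~ true)%:R * prb P (fun w => cylinder X [seq lv i0 k | k <- iota 0 j.+1] x w &&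
      legs_clear ((i0, j.+1, drop j.+1 a) :: l) w && (X v w == true)).
  case: (c) => /=; [rewrite mul0r -[RHS](prb0 P) | rewrite mul1r]; apply: eq_prb => w /=;
    rewrite -/v; by case: (X v w); rewrite /= ?andbF.
by rewrite term; ring.
Qed.

Lemma octopus_law (a : 'I_m -> seq bool) c : (K <= size (a i0))%N ->
  prb P (fun w => (c ==> ~~ X None w) && [forall i, leg_clear i 0 (a i) w]) =
  r * \prod_i leg_void (a i) 1 +
  (~~ c)%:R * ((1 - r) * \prod_i leg_void (a i) (- r / (1 - r))).
Proof.
move=> Ka; pose l := [seq (i, 0%N, a i) | i <- rem i0 (enum 'I_m)].
have i0in : i0 \in enum 'I_m by rewrite mem_enum.
have term b : prb P (fun w => (X None w == b) && [forall i, leg_clear i 0 (a i) w]) =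
    state_prob r b * \prod_i leg_void (a i) (state_coord b).
  have := @path_partial_law l (fun=> b) (a i0) 0 (leq0n _) Ka.
  rewrite /l -map_comp map_id -(perm_uniq (perm_to_rem i0in)) enum_uniq.
  move=> /(_ isT) /(_ _) h.
  rewrite (@eq_prb _ _ _ P _ (fun w => cylinder X [seq lv i0 k | k <- iota 0 1] (fun=> b) w &&
     legs_clear ((i0, 0%N, drop 0 (a i0)) :: l) w)); last first.
    move=> w; rewrite /cylinder /= andbT; congr (_ && _).
    rewrite drop0 /legs_clear all_map.
    have -> : [forall i, leg_clear i 0 (a i) w] = all (fun i => leg_clear i 0 (a i) w) (enum 'I_m).
      apply/forallP/allP => [h' i _|h' i]; first exact: h'.
      by apply: h'; rewrite mem_enum.
    by rewrite (perm_all _ (perm_to_rem i0in)).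
  rewrite h; last by move=> L /mapP[i _ ->].
  rewrite big_geq // mulr1 drop0 big_map /=; congr (_ * _).
  by rewrite -big_enum (perm_big _ (perm_to_rem i0in)) big_cons.
have mall : measurable_fun setT (fun w => [forall i, leg_clear i 0 (a i) w]).
  rewrite (_ : (fun w => _) = (fun w => all (fun i => leg_clear i 0 (a i) w) (enum 'I_m))).
    by apply: measurable_all_seq => i; exact: measurable_leg_clear.
  apply/funext => w; apply/forallP/allP => [h' i _|h' i]; first exact: h'.
  by apply: h'; rewrite mem_enum.
rewrite (@prbID _ _ _ P _ (X None)) //; last first.
  apply: measurable_and => //.
  exact: (measurable_bool_comp (fun b => c ==> ~~ b)).
rewrite addrC; congr (_ + _).
  rewrite -[RHS]/(state_prob r false * \prod_i leg_void (a i) (state_coord false)) -term.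
  by apply: eq_prb => w; case: (X None w); rewrite /= ?andbF ?andbT ?implybT.
rewrite -[(1 - r) * _]/(state_prob r true * \prod_i leg_void (a i) (state_coord true)) -term.
case: c => /=; [rewrite mul0r -[RHS](prb0 P) | rewrite mul1r]; apply: eq_prb => w /=;
  by case: (X None w); rewrite /= ?andbF ?andbT.
Qed.
End OctopusLaw.

(** * Void events *)

Section VoidProbabilities.
Variable S : countType.
Implicit Types (F : seq S).

Definition hitting F : set (subsets S) := [set B | exists2 i, i \in F & (B : set S) i].

Lemma measurable_hitting F : measurable (hitting F).
Proof.
elim: F => [|i F IH].
  by rewrite (_ : hitting [::] = set0) //; apply/seteqP; split => B // [].
rewrite (_ : hitting (i :: F) = [set B : subsets S | (B : set S) i] `|` hitting F).
  by apply: measurableU => //; apply: sub_sigma_algebra; exists i.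
apply/seteqP; split => B.
  by move=> [j]; rewrite inE => /predU1P[->|jF] Bj; [left|right; exists j].
by move=> [Bi|[j jF Bj]]; [exists i|exists j] => //; rewrite inE ?eqxx // jF orbT.
Qed.

Lemma not_hitting_set0 F : ~ hitting F set0.
Proof. by case. Qed.

Definition void_event F : set (S -> bool) := [set x | all (fun i => ~~ x i) F].

Lemma void_event_cons i F : void_event (i :: F) = [set x | x i = false] `&` void_event F.
Proof.
apply/seteqP; split => x; first by move=> /andP[/negPf].
by move=> [/= xi h]; rewrite /void_event /= xi.
Qed.

Lemma void_event_measurable F : <<s @cylinders S >> (void_event F).
Proof.
elim: F => [|i F IH].
  rewrite (_ : void_event [::] = setT); last by apply/seteqP; split.
  exact: (@measurableT _ (g_sigma_algebraType (@cylinders S))).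
rewrite void_event_cons.
apply: (@measurableI _ (g_sigma_algebraType (@cylinders S))) => //.
by apply: sub_sigma_algebra; exists i, false.
Qed.

Context d (T : measurableType d) (R : realType) (P : probability T R).
Variables (nu : {measure set (subsets S) -> \bar R}) (Z : nat -> {RV P >-> subsets S}).

Lemma covered_voidE F :
  [set w | void_event F ((covered Z)^~ w)] =
  point_count R Z (hitting F) @^-1` [set 0%:R%:E].
Proof.
apply/seteqP; split => w /=.
  move=> /allP h; rewrite /point_count (_ : [set k | _] = set0) ?measure0 //.
  apply/seteqP; split => k //= [i iF Bi].
  by have /asboolPn := h i iF; apply; exists k.
rewrite /point_count => e; apply/allP => i iF; apply/asboolPn => -[k Bk].
move: e; set A := [set _ | _] => e.
have : (counting [set k] <= counting A :> \bar R)%E.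
  by apply: le_measure; rewrite ?inE // => _ ->; exists i.
rewrite e /counting; case: ifPn => [_|/asboolPn]; last by case; exact: finite_set1.
by rewrite fset_set1 finmap.cardfs1 lee_fin ler10.
Qed.

Lemma measurable_point_count (A : set (subsets S)) : measurable A ->
  measurable_fun setT (point_count R Z A).
Proof.
move=> mA; rewrite (_ : point_count R Z A =
    (fun w => \sum_(0 <= k <oo) (\1_A (Z k w))%:E)%E); last first.
  apply/funext => w; rewrite /point_count counting_dirac.
  by apply: eq_eseriesr => k _; rewrite diracE indicE; congr (_%:R%:E).
apply: ge0_emeasurable_sum => [k w _ _|k _]; first by rewrite lee_fin.
by apply/measurable_EFinP; apply: measurableT_comp.
Qed.

Hypothesis Z_poisson : poisson_process nu Z.

Lemma poisson_void F l : nu (hitting F) = l%:E ->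
  P [set w | void_event F ((covered Z)^~ w)] = (expR (- l))%:E.
Proof.
move=> hl; rewrite covered_voidE.
have := Z_poisson.1 _ (measurable_hitting F) (@not_hitting_set0 F).
by rewrite hl => /(_ 0%N) ->; rewrite expr0 fact0 divr1 mulr1.
Qed.

(** Void probabilities of the chain used for necessity are positive, so there this excludes an
    infinite mass of [hitting F]. *)
Lemma poisson_void_infty F : nu (hitting F) = +oo%E ->
  P [set w | void_event F ((covered Z)^~ w)] = 0%E.
Proof.
move=> hl; rewrite covered_voidE.
have := Z_poisson.1 _ (measurable_hitting F) (@not_hitting_set0 F).
rewrite hl => h; set N := point_count R Z (hitting F) in h *.
have mN := measurable_point_count (measurable_hitting F).
have mpre x : measurable (N @^-1` [set x]) by rewrite -[X in measurable X]setTI; exact: mN.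
apply/eqP; rewrite eq_le measure_ge0 andbT.
have <- : P (~` (N @^-1` [set +oo%E])) = 0%E by rewrite probability_setC // h subee.
apply: le_measure; rewrite ?inE //; first exact: measurableC.
by move=> w /= ->.
Qed.

End VoidProbabilities.

Section OctopusVoid.
Context d (T : measurableType d) (R : realType) (P : probability T R).
Variables (m : nat) (o : octopus_vertex m) (r p : R).
Variables (X : octopus_vertex m -> {RV P >-> bool}).
Hypothesis m0 : (0 < m)%N.
Hypothesis r01 : 0 < r < 1.
Hypothesis chainX : tree_markov_chain (@octopus_edge m) o r p X.

Definition leg_trace (F : seq (octopus_vertex m)) (N : nat) (i : 'I_m) : seq bool :=
  mkseq (fun k => Some (i, k) \in F) N.

(** K is the distance of the root from the center; traces of length at least K reach the root. *)
Lemma octopus_void : exists K, forall F N, (K <= N)%N ->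
  (forall i k, Some (i, k) \in F -> (k < N)%N) ->
  P [set w | void_event F (X^~ w)] =
  (r * \prod_i leg_void r p (leg_trace F N i) 1 +
   (None \notin F)%:R * ((1 - r) * \prod_i leg_void r p (leg_trace F N i) (- r / (1 - r))))%:E.
Proof.
have [i0 [K oE]] : exists i0 K, o = leg_vertex i0 K.
  case: (o) => [[i k]|]; first by exists i, k.+1.
  by exists (Ordinal m0), 0%N.
exists K => F N KN FN; case: chainX => Rv [C [indep hR hC Xo XS]].
have plaw W x : root_last (leg_vertex i0 K) (octopus_parent i0 K) W ->
    prb P (cylinder X W x) = chain_weight (octopus_parent i0 K) r p W x.
  move=> rl; apply: (@cylinder_law _ _ _ P _ _ _ r p Rv C X) => //.
  - move=> v w vo; apply: XS => //; rewrite oE; apply: octopus_is_parent.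
    by rewrite -oE.
  - by rewrite oE.
rewrite -(octopus_law r01 plaw) ?size_mkseq //.
rewrite -prbE; last first.
  apply: measurable_and; first exact: (measurable_bool_comp (fun b => (None \in F) ==> ~~ b)).
  rewrite (_ : (fun w => _) = (fun w => all (fun i => leg_clear X i 0 (leg_trace F N i) w) (enum 'I_m))).
    by apply: measurable_all_seq => i; exact: measurable_leg_clear.
  apply/funext => w; apply/forallP/allP => [h' i _|h' i]; first exact: h'.
  by apply: h'; rewrite mem_enum.
congr (P _); apply/seteqP; split => w.
  move=> /allP h; apply/andP; split; first by apply/implyP => /h.
  apply/forallP => i; rewrite /leg_trace /mkseq.
  elim: N {KN FN} 0%N => [//|N IH] k /=; rewrite IH andbT.
  exact/implyP/h.
move=> /andP[/implyP h0 /forallP h]; apply/allP => -[[i k]|] // ik.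
have := h i; have := FN _ _ ik; rewrite /leg_trace /mkseq -{1}(subn0 k).
move: {KN FN h h0} (leq0n k); elim: N 0%N => [|N IH] l lk; first by rewrite ltn0.
move=> kl /= /andP[/implyP h1 h2].
have [e|ne] := eqVneq l k; first by rewrite -e in ik *; exact: h1.
by apply: (IH l.+1) => //; lia.
Qed.
End OctopusVoid.

(** * Necessity of [r1 <= r] *)

Section Necessity.
Variable R : realType.

Lemma hitting_split (S : countType) (nu : {measure set (subsets S) -> \bar R})
    (E : set (subsets S)) (i : S) (F : seq S) : measurable E ->
  nu (E `\` hitting F) =
  (nu ((E `&` hitting [:: i]) `\` hitting F) + nu (E `\` hitting (i :: F)))%E.
Proof.
move=> mE; have mi := measurable_hitting [:: i]; have mF := measurable_hitting F.
rewrite (measureDI nu (measurableD mE mF) mi) addeC; congr (_ + _)%E.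
  by congr (nu _); apply/seteqP; split => B /= [[? ?] ?].
congr (nu _); apply/seteqP; split => B.
  move=> [[EB nF] ni]; split => // -[j]; rewrite inE => /predU1P[->|jF] Bj.
    by apply: ni; exists i => //; rewrite inE.
  by apply: nF; exists j.
move=> [EB nF]; split.
  split=> // -[j jF Bj]; apply: nF; exists j => //.
  by rewrite inE jF orbT.
by move=> [j]; rewrite inE => /eqP -> Bi; apply: nF; exists i => //; rewrite inE eqxx.
Qed.

Definition hitting_all (S : countType) (E : seq S) : set (subsets S) :=
  \big[setI/setT]_(i <- E) hitting [:: i].

Fixpoint backward_diff (phi : nat -> R) (j k : nat) : R :=
  if j is j'.+1 then backward_diff phi j' k - backward_diff phi j' k.+1 else phi k.

(* Inclusion-exclusion for a measure under which the mass of the sets hitting a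
   finite set depends only on the cardinality of the latter. *)
Lemma hitting_all_measure (S : countType) (nu : {measure set (subsets S) -> \bar R})
    (phi : nat -> R) (D : pred S) :
  (forall F, uniq F -> all D F -> nu (hitting F) = (- phi (size F))%:E) ->
  forall i E F, uniq (i :: E ++ F) -> all D (i :: E ++ F) ->
  nu (hitting_all (i :: E) `\` hitting F) = (backward_diff phi (size E).+1 (size F))%:E.
Proof.
move=> hphi; have mall E : measurable (hitting_all E : set (subsets S)).
  by apply: bigsetI_measurable => i _; exact: measurable_hitting.
have sub (x : \bar R) (a b : R) : a%:E = (x + b%:E)%E -> x = (a - b)%:E.
  by move=> e; rewrite EFinB e addeK.
move=> i E; elim: E i => [|j E IH] i F uF DF.
  have hiF := hphi (i :: F) uF DF.
  have hF : nu (hitting F) = (- phi (size F))%:E.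
    by apply: hphi; [case/andP: uF|case/andP: DF].
  have mi := measurable_hitting [:: i]; have mF := measurable_hitting F.
  rewrite /hitting_all big_seq1.
  transitivity (- phi (size (i :: F)) - - phi (size F))%:E; last by congr EFin; rewrite /=; ring.
  apply: sub; rewrite -hF -hiF -measureU //; last first.
  - by rewrite setDE -setIA (setIC (~` _)) setICr setI0.
  - exact: measurableD.
  congr (nu _); apply/seteqP; split => B.
    move=> [k]; rewrite inE; have [BF|nF] := pselect (hitting F B); first by right.
    move=> /predU1P[->|kF] Bk; last by right; exists k.
    by left; split=> //; exists i => //; rewrite inE.
  case=> [[[k]]|[k kF Bk]]; last by exists k => //; rewrite inE kF orbT.
  by rewrite inE => /eqP -> Bi _; exists i => //; rewrite inE eqxx.
have e := hitting_split nu i F (mall (j :: E)).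
have jEF : perm_eq (i :: (j :: E) ++ F) ((j :: E) ++ i :: F).
  by rewrite -cat1s perm_catCA.
have uF' : uniq ((j :: E) ++ i :: F) by rewrite -(perm_uniq jEF).
have DF' : all D ((j :: E) ++ i :: F) by rewrite -(perm_all _ jEF).
rewrite !IH // in e; last 2 first.
- by case/andP: uF.
- by case/andP: DF.
by rewrite {1}/hitting_all big_cons setIC; exact: sub e.
Qed.

(** Differences of order at least 2 annihilate affine sequences. This removes the factors A_i from
    the logarithm of the void probability. *)
Lemma backward_diff_linear (phi psi : nat -> R) (c : R) :
  (forall k, phi k - phi k.+1 = psi k - psi k.+1 + c) ->
  forall j k, backward_diff phi j.+2 k = backward_diff psi j.+2 k.
Proof.
move=> h; elim=> [|j IH] k; first by rewrite /= !h; ring.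
by rewrite [LHS]/= [RHS]/= -!/(backward_diff _ j.+2 _) !IH.
Qed.

Lemma backward_diff_mixed_diff (g : R -> R) (z : R) j k :
  backward_diff (fun k => g (z ^+ k)) j k = mixed_diff g (nseq j (z, 1)) (z ^+ k).
Proof.
elim: j k => [//|j IH] k.
by rewrite [nseq _ _]/= mixed_diff_cons mul1r -exprS -!IH.
Qed.

Lemma leg_void_nseq (r p : R) n a y :
  leg_void r p (nseq n false ++ a) y = leg_void r p a ((1 - p) ^+ n * y).
Proof.
elim: n y => [|n IH] y; first by rewrite expr0 mul1r.
by rewrite [LHS]/= IH exprSr mulrA.
Qed.

(** * Vertices at a common distance from the center *)

Section Spherical.
Context d (T : measurableType d) (P : probability T R).
Variables (m : nat) (o : octopus_vertex m.+3) (r p : R).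
Variables (X : octopus_vertex m.+3 -> {RV P >-> bool}).
Hypotheses (r01 : 0 < r < 1) (p01 : 0 < p < 1).
Hypothesis chainX : tree_markov_chain (@octopus_edge m.+3) o r p X.
Local Notation s := ((1 - r) / r).

Let r0 : 0 < r. Proof. by case/andP: r01. Qed.
Let r1' : 0 < 1 - r. Proof. by case/andP: r01 => _; rewrite subr_gt0. Qed.
Let s0 : 0 < s. Proof. exact: divr_gt0. Qed.

Definition at_height N (v : octopus_vertex m.+3) : bool :=
  if v is Some (_, k) then k == N else false.

(** The logarithm of the void probability of k vertices on different legs at distance N + 1, with y
    = q^(N+1); its two summands belong to the two states of the center. *)
Let phi (y : R) k : R :=
  ln (r * (r + (1 - r) * y) ^+ k + (1 - r) * (r * (1 - y)) ^+ k).

(** The ratio z_k as a function of y = q^k, continuous at y = 0 with value 1. *)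
Let zeta (y : R) : R := (1 - y) / (1 + s * y).

Let zeta01 y : 0 < y < 1 -> 0 < zeta y < 1.
Proof.
case/andP=> y0 y1; have d0 : 0 < 1 + s * y by rewrite addr_gt0 // mulr_gt0.
rewrite /zeta divr_gt0 ?subr_gt0 //= ltr_pdivrMr // mul1r ltrD2l.
by rewrite (lt_trans (y := 0)) ?oppr_lt0 // mulr_gt0.
Qed.

Let spherical_void : exists K, forall N F, (K <= N)%N -> uniq F -> all (at_height N) F ->
  P [set w | void_event F (X^~ w)] = (expR (phi ((1 - p) ^+ N.+1) (size F)))%:E.
Proof.
have [K hK] := octopus_void (ltn0Sn _) r01 chainX.
exists K => N F KN uF FN; rewrite (hK F N.+1); last 2 first.
- exact: leqW.
- by move=> i k ik; have /eqP -> := allP FN _ ik.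
have Nin : None \notin F by apply/negP => /(allP FN).
rewrite Nin mul1r; set y := (1 - p) ^+ N.+1.
have trace i z : leg_void r p (leg_trace F N.+1 i) z =
    if Some (i, N) \in F then r + (1 - r) * (y * z) else 1.
  have -> : leg_trace F N.+1 i = nseq N false ++ [:: Some (i, N) \in F].
    rewrite /leg_trace /mkseq -[N.+1]addn1 iotaD map_cat; congr (_ ++ _).
    apply: (@eq_from_nth _ false); rewrite size_map size_iota ?size_nseq // => k kN.
    rewrite nth_nseq kN (nth_map 0%N) ?size_iota // nth_iota // add0n.
    by apply/negP => /(allP FN) /eqP e; rewrite e ltnn in kN.
  rewrite leg_void_nseq; case: ifP => _ /=; last by [].
  by rewrite mulr1 (mulrA (1 - p)) -exprS.
have prodE z : \prod_i leg_void r p (leg_trace F N.+1 i) z = (r + (1 - r) * (y * z)) ^+ size F.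
  under eq_bigr do rewrite trace.
  rewrite -big_mkcond prodr_const; congr (_ ^+ _).
  rewrite cardE /enum_mem -(size_map (fun i => Some (i, N))); apply: perm_size.
  apply: uniq_perm => //; first by rewrite map_inj_uniq ?filter_uniq -?enumT ?enum_uniq // => i j [].
  move=> v; apply/mapP/idP => [[i]|vF].
    by rewrite mem_filter => /andP[h _ ->].
  case: v vF => [[i k]|] vF; last by rewrite vF in Nin.
  have /eqP kN := allP FN _ vF; rewrite kN in vF *.
  by exists i => //; rewrite mem_filter -enumT mem_enum andbT; exact: vF.
rewrite !prodE mulr1 /phi lnK; last first.
  rewrite posrE ltr_pwDl //.
    rewrite mulr_gt0 // exprn_gt0 // ltr_pwDl // mulr_ge0 ?(ltW r1') //.
    by apply: exprn_ge0; rewrite subr_ge0 ltW //; case/andP: p01.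
  rewrite mulr_ge0 ?(ltW r1') // exprn_ge0 // mulr_ge0 ?(ltW r0) // subr_ge0 exprn_ile1 //.
    by rewrite subr_ge0 ltW //; case/andP: p01.
  by rewrite gerBl ltW //; case/andP: p01.
congr (_ + (1 - r) * _ ^+ _)%:E; field.
by rewrite gt_eqF.
Qed.

Hypothesis reprX : poisson_representable X.

Let mixed_diff_ge0 : exists K, forall N j, (K <= N)%N -> (j.+2 <= m.+3)%N ->
  0 <= mixed_diff (log_weight s 0) (nseq j.+2 (zeta ((1 - p) ^+ N.+1), 1)) 1.
Proof.
have [K hK] := spherical_void; exists K => N j KN jm.
have [nu [_ [d' [T' [P' [Z [Zp XZ]]]]]]] := reprX.
set y := (1 - p) ^+ N.+1.
have q01 : 0 < 1 - p < 1 by case/andP: p01 => p0 p1; rewrite subr_gt0 p1 gtrBl.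
have y01 : 0 < y < 1.
  case/andP: q01 => q0 q1.
  by rewrite exprn_gt0 // exprn_ilt1 // ltW.
have hnu F : uniq F -> all (at_height N) F -> nu (hitting F) = (- phi y (size F))%:E.
  move=> uF FN; have := XZ _ (void_event_measurable F); rewrite (hK N) // => e.
  have nu0 : (0 <= nu (hitting F))%E by [].
  case E : (nu (hitting F)) nu0 => [l| |] // _.
    by move: e; rewrite (poisson_void Zp E) => -[/expR_inj e]; rewrite /y e opprK.
  move: e; rewrite (poisson_void_infty Zp E) => -[e].
  by have := expR_gt0 (phi y (size F)); rewrite e ltxx.
pose E := [seq Some (i, N) | i <- take j.+2 (enum 'I_m.+3)].
have sE : size E = j.+2 by rewrite size_map size_takel // -cardE card_ord.
have uE : uniq E by rewrite map_inj_uniq ?take_uniq ?enum_uniq // => a b [].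
have DE : all (at_height N) E by apply/allP => _ /mapP[i _ ->] /=.
case: E => [//|v E] in sE uE DE.
have := hitting_all_measure hnu (i := v) (E := E) (F := [::]).
rewrite cats0 => /(_ uE DE) h.
have : (0 <= nu (hitting_all (v :: E) `\` hitting [::]))%E by [].
rewrite h lee_fin [(size E).+1]sE.
have den0 : 0 < 1 + s * y by rewrite ltr_pwDl // mulr_ge0 ?(ltW s0) //; case/andP: y01 => /ltW.
rewrite (@backward_diff_linear _ (fun k => log_weight s 0 (zeta y ^+ k)) (- ln (r + (1 - r) * y))).
  by rewrite backward_diff_mixed_diff expr0.
have f0 : 0 < r + (1 - r) * y.
  by rewrite ltr_pwDl // mulr_ge0 ?(ltW r1') //; case/andP: y01 => /ltW.
have /andP[z0 _] := zeta01 y01.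
(* The identity r (1 - y) = (r + (1 - r) y) [zeta y] pulls a common k-th power out of both summands,
   leaving an affine sequence plus ln (1 + s [zeta y] ^ k). *)
have phiE k : phi y k = ln r + ln (r + (1 - r) * y) *+ k + ln (1 + s * zeta y ^+ k).
  have p1 : 0 < 1 + s * zeta y ^+ k by rewrite ltr_pwDl // mulr_ge0 ?exprn_ge0 // ltW.
  rewrite -lnXn // -!lnM ?posrE ?mulr_gt0 ?exprn_gt0 //; congr ln.
  have -> : r * (1 - y) = (r + (1 - r) * y) * zeta y.
    by rewrite /zeta; field; rewrite !gt_eqF //= mulrC; move: f0.
  by rewrite exprMn; field; rewrite gt_eqF.
by move=> k; rewrite !phiE /= mulrS; ring.
Qed.

(** A negative value at 1 would persist near 1 by continuity. For large N the cube [zeta, 1]^(j+2)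
    has all its coordinate products in that neighbourhood, and [mixed_diff_MVT] would make a mass
    negative. *)
Let log_weight_ge0 j : (j.+2 <= m.+3)%N -> 0 <= log_weight s j.+2 1.
Proof.
move=> jm; rewrite leNgt; apply/negP => neg.
have [K hK] := mixed_diff_ge0.
have q01 : 0 < 1 - p < 1 by case/andP: p01 => p0 p1; rewrite subr_gt0 p1 gtrBl.
have y01 N : 0 < (1 - p) ^+ N.+1 < 1.
  case/andP: q01 => q0 q1.
  by rewrite exprn_gt0 // exprn_ilt1 // ltW.
have /cvgr_lt := continuous_log_weight s0 (k := j.+2) ler01.
move=> /(_ _ neg) /nbhs_ballP[del /= del0 hdel].
have cz : (zeta ((1 - p) ^+ N.+1)) ^+ j.+2 @[N --> \oo] --> (1 : R).
  have z0 : zeta 0 ^+ j.+2 = 1 by rewrite /zeta subr0 mulr0 addr0 divr1 expr1n.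
  rewrite -[X in _ --> X]z0.
  apply: (@continuous_cvg _ _ _ _ _ _ (fun x : R => zeta x ^+ j.+2) 0).
    apply: (@continuous_comp _ _ _ zeta (fun x => x ^+ j.+2)); last exact: exprn_continuous.
    apply: cvgM; first by apply: cvgB; [exact: cvg_cst|exact: cvg_id].
    apply: cvgV; first by rewrite mulr0 addr0 oner_neq0.
    by apply: cvgD; [exact: cvg_cst|apply: cvgM; [exact: cvg_cst|exact: cvg_id]].
  rewrite (cvg_shiftS (fun N => (1 - p) ^+ N)); apply: cvg_expr.
  by case/andP: q01 => q0 q1; rewrite ger0_norm // ltW.
have /cvgr_gt := cz; have d1 : 1 - del < 1 by rewrite gtrBl.
move=> /(_ _ d1) [N0 _ hN0].
(* Beyond K the void probabilities are known; beyond N0 the corner of the cube is within [del] of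
   1. *)
pose N := maxn K N0.
have zN : 1 - del < zeta ((1 - p) ^+ N.+1) ^+ j.+2 by apply: hN0; exact: leq_maxr.
have := hK N j (leq_maxl _ _) jm.
have /andP[z0 z1] := zeta01 (y01 N).
have ok : all (fun ab : R * R => 0 <= ab.1 < ab.2) (nseq j.+2 (zeta ((1 - p) ^+ N.+1), 1)).
  by apply/allP => ab /nseqP[-> _] /=; rewrite (ltW z0).
have [c [x [c0 x0 + ->]]] := mixed_diff_MVT s0 0 ok ltr01.
rewrite !big_nseq !iter_mulr_1 /= expr1n !mul1r size_nseq.
move=> /andP[xz x1]; rewrite leNgt pmulr_rlt0 // => /negP; apply.
apply: hdel; rewrite /ball /= ger0_norm ?subr_ge0 //.
by rewrite ltrBlDr addrC -ltrBlDr (lt_le_trans zN).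
Qed.

Lemma r1_le_of_representable : r1 R m.+3 <= r.
Proof.
have [x hx x1] := logistic_poly_first_root R m.+1.
rewrite (r1E hx) lerBlDr addrC -lerBlDr.
(* At z = 1 the logistic variable is s / (1 + s) = 1 - r. *)
have sE : s * 1 / (1 + s * 1) = 1 - r.
  have rn : r != 0 by rewrite gt_eqF.
  have -> : 1 + s * 1 = r^-1 by field.
  by field.
apply: (le_first_pos_root hx); first by rewrite r1' gtrBl.
move=> [//|[//|j]] /andP[_ jm]; have := @log_weight_ge0 j.+1 _.
by rewrite /log_weight sE; apply.
Qed.
End Spherical.
End Necessity.

(** * Existence of Poisson processes with discrete intensity *)

Section PoissonWeights.
Variable R : realType.
Implicit Types (l w : R) (k : nat).

Definition poisson_weight l k : R := expR (- l) * l ^+ k / k`!%:R.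

Definition poisson_cdf l k : R := \sum_(i < k.+1) poisson_weight l i.

Lemma poisson_weight_ge0 l k : 0 <= l -> 0 <= poisson_weight l k.
Proof. by move=> l0; rewrite divr_ge0 // mulr_ge0 ?expR_ge0 ?exprn_ge0. Qed.

Lemma poisson_weightD l w k :
  \sum_(i < k.+1) poisson_weight l (k - i) * poisson_weight w i = poisson_weight (l + w) k.
Proof.
rewrite /poisson_weight opprD expRD exprDn mulr_sumr mulr_suml; apply: eq_bigr => i _.
have ik : (i <= k)%N by rewrite -ltnS.
have /(congr1 (fun n => n%:R : R)) := bin_fact ik; rewrite !natrM => e.
have f0 n : n`!%:R != 0 :> R by rewrite pnatr_eq0 -lt0n fact_gt0.
rewrite -mulr_natr -e; field.
by rewrite !f0 pnatr_eq0 -lt0n bin_gt0 ik.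
Qed.

(** Adds one independent Poisson summand to a count, conditioning on its value i. *)
Lemma poisson_cdfD l w k :
  \sum_(i < k.+1) poisson_cdf l (k - i) * poisson_weight w i = poisson_cdf (l + w) k.
Proof.
rewrite /poisson_cdf.
under [RHS]eq_bigr => j _ do rewrite -poisson_weightD.
elim: k => [|k IH]; first by rewrite 2!big_ord1 /= 2!big_ord1.
rewrite [RHS]big_ord_recr /= -IH big_ord_recr /= subnn [X in _ + X * _ = _]big_ord1.
rewrite [X in _ = _ + X]big_ord_recr /= subnn addrA -big_split /=; congr (_ + _).
apply: eq_bigr => i _; have ik : (i <= k)%N by rewrite -ltnS.
by rewrite subSn // big_ord_recr mulrDl.
Qed.

Lemma poisson_cdf0 k : poisson_cdf 0 k = 1.
Proof.
rewrite /poisson_cdf big_ord_recl big1 => [|i _].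
  by rewrite /poisson_weight oppr0 expR0 expr0 fact0 divr1 mulr1 addr0.
by rewrite /poisson_weight expr0n /= mulr0 mul0r.
Qed.

Lemma poisson_series l :
  series (poisson_weight l) = (fun n => expR (- l) * series (exp_coeff l) n).
Proof.
apply/funext => n; rewrite /series /= mulr_sumr; apply: eq_bigr => i _.
by rewrite /poisson_weight /exp_coeff mulrA.
Qed.

Lemma poisson_series_cvg l : series (poisson_weight l) @ \oo --> (1 : R).
Proof.
rewrite poisson_series; have -> : (1 : R) = expR (- l) * expR l by rewrite -expRD addNr expR0.
by apply: cvgM; [exact: cvg_cst|exact: is_cvg_series_exp_coeff].
Qed.

Lemma continuous_poisson_weight k : continuous (poisson_weight ^~ k).
Proof.
move=> l; apply: cvgM; last exact: cvg_cst.
apply: cvgM; last exact: exprn_continuous.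
apply: (@continuous_comp _ _ _ (fun l => - l) (@expR R)); first exact: opp_continuous.
exact: continuous_expR.
Qed.

Lemma continuous_poisson_cdf k : continuous (poisson_cdf ^~ k).
Proof.
elim: k => [|k IH] l.
  rewrite (_ : poisson_cdf ^~ 0%N = poisson_weight ^~ 0%N); first exact: continuous_poisson_weight.
  by apply/funext => x; rewrite /poisson_cdf big_ord1.
rewrite (_ : poisson_cdf ^~ k.+1 = poisson_cdf ^~ k + poisson_weight ^~ k.+1).
  by apply: continuousD; [exact: IH|exact: continuous_poisson_weight].
by apply/funext => x; rewrite /poisson_cdf big_ord_recr.
Qed.

(** From exp l >= l^(i+1) / (i+1)! each of the k + 1 weights is at most (k + 1) / l. The decay in l
    makes a set of infinite intensity receive infinitely many points. *)
Lemma poisson_cdf_le l k : 0 < l -> poisson_cdf l k <= (k.+1 * k.+1)%:R / l.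
Proof.
move=> l0; have h (i : 'I_k.+1) : true -> poisson_weight l i <= k.+1%:R / l.
  move=> _; rewrite /poisson_weight expRN ler_pdivrMr ?ltr0n ?fact_gt0 //.
  rewrite ler_pdivrMl ?expR_gt0 // -ler_pdivrMr; last first.
    by rewrite mulr_gt0 ?divr_gt0 ?ltr0n ?fact_gt0.
  apply: le_trans (_ : 1 + l ^+ i.+1 / i.+1`!%:R <= _); last exact/expR_ge1Dxn/ltW.
  rewrite -[leLHS]add0r lerD // factS natrM exprS.
  have f0 : 0 < i`!%:R :> R by rewrite ltr0n fact_gt0.
  rewrite [leLHS](_ : _ = l * l ^+ i / (k.+1%:R * i`!%:R)); last first.
    move: f0 (ltr0n R k.+1); move: (i`!%:R : R) (k.+1%:R : R) => x y x0 /esym y0.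
    by field; rewrite !gt_eqF.
  rewrite ler_pM2l ?mulr_gt0 ?exprn_gt0 // lef_pV2 ?posrE ?mulr_gt0 ?ltr0n ?fact_gt0 //.
  by rewrite ler_pM2r // ler_nat ltn_ord.
rewrite /poisson_cdf (le_trans (ler_sum _ h)) // sumr_const card_ord -[leLHS]mulr_natr.
by rewrite natrM mulrAC.
Qed.

Lemma poisson_cdf_cvg0 (u : R^nat) k : u @ \oo --> +oo ->
  (fun n => poisson_cdf (u n) k) @ \oo --> (0 : R).
Proof.
move=> uoo; apply/cvgrPdist_lt => e e0.
near=> n; rewrite sub0r normrN.
have un : (k.+1 * k.+1)%:R / e + 1 <= u n by near: n; apply: (cvgryPge u).1.
have u0 : 0 < u n.
  by rewrite (lt_le_trans _ un) // ltr_wpDl // divr_ge0 // ltW.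
rewrite ger0_norm ?sumr_ge0 // => [|i _]; last exact/poisson_weight_ge0/ltW.
rewrite (le_lt_trans (poisson_cdf_le k u0)) // ltr_pdivrMr // mulrC -ltr_pdivrMr //.
by rewrite (lt_le_trans _ un) // ltrDl.
Unshelve. all: by end_near. Qed.

End PoissonWeights.

(** * Independent discrete variables on the unit interval *)

Section UnitInterval.
Variable R : realType.

Definition unit_interval_measure : set (measurableTypeR R) -> \bar R :=
  mrestr (@lebesgue_measure R) (measurable_itv `[0%R, 1%R[).

HB.instance Definition _ := Measure.on unit_interval_measure.

Lemma unit_interval_measureT : unit_interval_measure setT = 1%E.
Proof.
by rewrite /unit_interval_measure /mrestr setTI lebesgue_measure_itv /= lte_fin ltr01 oppr0 adde0.
Qed.

HB.instance Definition _ :=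
  Measure_isProbability.Build _ _ _ unit_interval_measure unit_interval_measureT.

Lemma unit_interval_measure_itv (a b : R) : 0 <= a -> a <= b -> b <= 1 ->
  unit_interval_measure `[a, b[%classic = (b - a)%:E.
Proof.
move=> a0 ab b1; rewrite /unit_interval_measure /mrestr setIidl; last first.
  move=> x /=; rewrite !in_itv /= => /andP[ax xb].
  by rewrite (le_trans a0) // (lt_le_trans xb).
rewrite lebesgue_measure_itv /= lte_fin; case: ltP => [//|ba].
have -> : a = b by apply/eqP; rewrite eq_le ab.
by rewrite subrr.
Qed.

End UnitInterval.

Section IndependentSequence.
Variable R : realType.
Variable pm : nat -> nat -> R.
Hypothesis pm_ge0 : forall j k, 0 <= pm j k.
Hypothesis pm_cvg : forall j, series (pm j) @ \oo --> (1 : R).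
Local Notation cum j := (series (pm j)).

Let cumS j k : cum j k.+1 = cum j k + pm j k.
Proof. by rewrite seriesSr. Qed.

Let cum0 j : cum j 0 = 0.
Proof. by rewrite /series /= big_geq. Qed.

Let cum_le j : {homo cum j : k l / (k <= l)%N >-> k <= l}.
Proof. by apply: homo_leq => // [x y z|k]; [exact: le_trans|rewrite cumS lerDl]. Qed.

Let cum_le1 j k : cum j k <= 1.
Proof.
rewrite -(cvg_lim (@norm_hausdorff _ _) (pm_cvg j)).
apply: nondecreasing_cvgn_le; first by move=> a b; exact: cum_le.
exact: (cvgP _ (pm_cvg j)).
Qed.

Let cell j k : set R := `[cum j k, cum j k.+1[%classic.

Let label j (u : R) : nat := xget 0%N [set k | cell j k u].

Let label_eq j k u : cell j k u -> label j u = k.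
Proof.
move=> ku; apply: xget_unique => // l.
move: ku; rewrite /cell /= !in_itv /= => /andP[k1 k2] /andP[l1 l2].
have [kl|lk|//] := ltngtP l k.
  by move: (lt_le_trans l2 (le_trans (cum_le j kl) k1)); rewrite ltxx.
by move: (lt_le_trans k2 (le_trans (cum_le j lk) l1)); rewrite ltxx.
Qed.

Let label_cell j u : 0 <= u < 1 -> cell j (label j u) u.
Proof.
case/andP=> u0 u1; have ex : exists k, u < cum j k.
  have /cvgr_gt /(_ _ u1) [N _ hN] := pm_cvg j.
  by exists N; apply: hN => /=.
case: (ex_minnP ex) => -[|k] uk mink; first by move: uk; rewrite cum0 ltNge u0.
suff h : cell j k u by rewrite (label_eq h).
rewrite /cell /= in_itv /= uk andbT leNgt; apply/negP => /mink.
by rewrite ltnn.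
Qed.

Let shift j (u : R) : R := (u - cum j (label j u)) / pm j (label j u).

Let state := fix state j (u : R) := if j is j'.+1 then shift j' (state j' u) else u.

Let sample j (u : R) : nat := label j (state j u).

Let measurable_label j : measurable_fun setT (label j).
Proof.
move=> _ Y _; rewrite setTI.
pose G k := cell j k.
(* Points in no cell receive the default label 0, so they belong to the preimage exactly when Y
   contains 0. *)
rewrite (_ : label j @^-1` Y = (\bigcup_(k in Y) G k) `|`
    (if 0%N \in Y then ~` (\bigcup_k G k) else set0)).
  apply: measurableU.
    by apply: bigcup_measurable => k _; exact: measurable_itv.
  case: ifP => // _; apply: measurableC.
  by apply: bigcup_measurable => k _; exact: measurable_itv.
apply/seteqP; split => u /=.
  have [[k ku] Yu|no] := pselect (exists k, cell j k u).
    by left; exists k => //; rewrite (label_eq ku) in Yu.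
  rewrite {1}/label xgetPN => [Y0|k ku]; last by apply: no; exists k.
  by right; rewrite mem_set // => -[k _ ku]; apply: no; exists k.
case=> [[k Yk ku]|]; first by rewrite (label_eq ku).
case: ifPn => // /set_mem Y0 no; rewrite /label xgetPN // => k ku.
by apply: no; exists k.
Qed.

Let measurable_state j : measurable_fun setT (state j).
Proof.
elim: j => [|j IH] /=; first exact: measurable_id.
have nat_comp (f : nat -> R) : measurable_fun setT (fun u => f (label j (state j u))).
  apply: (@measurableT_comp _ _ _ _ _ _ f) => //.
  exact: (measurableT_comp (measurable_label j)).
apply: measurable_funM; last exact: (nat_comp (fun k => (pm j k)^-1)).
apply: measurable_funB => //; exact: (nat_comp (series (pm j))).
Qed.

Let measurable_sample j : measurable_fun setT (sample j).
Proof. exact: (measurableT_comp (measurable_label j)). Qed.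

(* Inverse transform sampling from one uniform variable u: given the first n
   samples, u is uniform on an interval, which is rescaled to the unit interval
   before the next sample is read off. *)
Let sample_interval n (k : nat -> nat) : exists a,
  [/\ 0 <= a, a + \prod_(j < n) pm j (k j) <= 1 & forall u, 0 <= u < 1 ->
  ((forall j, (j < n)%N -> sample j u = k j) <-> a <= u < a + \prod_(j < n) pm j (k j)) /\
  (a <= u < a + \prod_(j < n) pm j (k j) ->
    state n u * \prod_(j < n) pm j (k j) = u - a)].
Proof.
elim: n => [|n [a [a0 a1 IH]]].
  exists 0; rewrite big_ord0 add0r; split=> // u u01; split.
    by split => // _ j.
  by move=> _ /=; rewrite subr0 mulr1.
rewrite big_ord_recr /=; set l := \prod_(j < n) _ in a1 IH *.
have l0 : 0 <= l by apply: prodr_ge0.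
exists (a + l * cum n (k n)); split.
- by rewrite addr_ge0 // mulr_ge0 // -(cum0 n) cum_le.
- by rewrite -addrA -mulrDr -cumS (le_trans _ a1) // lerD2l ler_piMr.
move=> u u01; have [iff1 st] := IH u u01.
have c0 : 0 <= cum n (k n) by rewrite -(cum0 n) cum_le.
have inside : a + l * cum n (k n) <= u < a + l * cum n (k n) + l * pm n (k n) ->
    a <= u < a + l.
  case/andP=> h1 h2; rewrite (le_trans _ h1) ?lerDl ?mulr_ge0 //=.
  by rewrite (lt_le_trans h2) // -addrA -mulrDr -cumS lerD2l ler_piMr.
have state01 : a <= u < a + l -> [/\ 0 < l, state n u * l = u - a & 0 <= state n u < 1].
  move=> au; have e := st au; case/andP: au => au ul.
  have lgt0 : 0 < l by rewrite -(ltrD2l a) addr0 (le_lt_trans au).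
  split=> //; have -> : state n u = (u - a) / l by rewrite -e mulfK ?gt_eqF.
  by rewrite divr_ge0 ?subr_ge0 //= ltr_pdivrMr // mul1r ltrBlDl.
have celliff : a <= u < a + l ->
    sample n u = k n <-> a + l * cum n (k n) <= u < a + l * cum n (k n) + l * pm n (k n).
  move=> au; have [lgt0 e s01] := state01 au.
  have conv : cell n (k n) (state n u) <->
      a + l * cum n (k n) <= u < a + l * cum n (k n) + l * pm n (k n).
    have uE : u = a + l * state n u by rewrite mulrC e subrKC.
    rewrite {2 3}uE /cell /= in_itv /= -!addrA -mulrDr -cumS lerD2l ltrD2l.
    by rewrite ler_pM2l // ltr_pM2l.
  split=> [h|/conv h]; first by apply/conv; rewrite -h; exact: label_cell.
  exact: label_eq.
split.
  split=> [h|h].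
    have au : a <= u < a + l by apply/iff1 => j jn; apply: h; exact: ltnW.
    by apply/(celliff au)/h.
  have au := inside h; move=> j; rewrite ltnS leq_eqVlt => /predU1P[->|jn].
    exact/celliff.
  by apply: (iff1.2 au).
move=> h; have au := inside h; have [lgt0 e s01] := state01 au.
have sk : label n (state n u) = k n by apply/(celliff au).
rewrite /shift sk; have pgt0 : pm n (k n) != 0.
  case/andP: h => h1 h2; have := le_lt_trans h1 h2; rewrite ltrDl.
  by apply: contraTneq => ->; rewrite mulr0 ltxx.
have uE : u = a + state n u * l by rewrite e subrKC.
by rewrite {2}uE; field.
Qed.

Lemma independent_nat_sequence :
  exists (d : measure_display) (T : measurableType d) (P : probability T R)
    (N : nat -> {RV P >-> nat}),
  forall n (k : nat -> nat),
    prb P (fun w => all (fun j => N j w == k j) (iota 0 n)) = \prod_(j < n) pm j (k j).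
Proof.
pose P : probability (measurableTypeR R) R := @unit_interval_measure R.
exists _, _, P.
have hm j := isMeasurableFun.Build _ _ (measurableTypeR R) nat (sample j) (measurable_sample j).
pose N j : {RV P >-> nat} := HB.pack (sample j) (hm j).
exists N => n k; have [a [a0 a1 h]] := sample_interval n k.
have p0 : 0 <= \prod_(j < n) pm j (k j) by apply: prodr_ge0.
apply: EFin_inj; rewrite -prbE; last first.
  apply: measurable_all_seq => j; apply: (@measurableT_comp _ _ _ _ _ _ (eq_op^~ (k j))) => //.
transitivity (unit_interval_measure `[a, a + \prod_(j < n) pm j (k j)[%classic); last first.
  by rewrite unit_interval_measure_itv ?lerDl // addrC addKr.
rewrite /unit_interval_measure /= /mrestr; congr (lebesgue_measure _).
apply/seteqP; split => u [/= hu]; rewrite !in_itv /= => u01; split=> //.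
  apply/(h u u01).1 => j jn; apply/eqP/(allP hu).
  by rewrite mem_iota.
apply/allP => j; rewrite mem_iota add0n => /andP[_ jn]; apply/eqP.
exact: ((h u u01).1.2 hu j jn).
Qed.
End IndependentSequence.

(** * Joint law of counts over finitely many atoms *)

Section PartialSums.
Context d (T : measurableType d) (R : realType) (P : probability T R).

Lemma measurable_natP (f : T -> nat) (Q : pred nat) :
  measurable_fun setT f -> measurable_fun setT (fun w => Q (f w)).
Proof. by move=> mf; apply: (@measurableT_comp _ _ _ _ _ _ Q). Qed.

Lemma prb_nat_sum (b : T -> bool) (f : T -> nat) L :
  measurable_fun setT b -> measurable_fun setT f ->
  \sum_(l < L) prb P (fun w => b w && (f w == l)) = prb P (fun w => b w && (f w < L)%N).
Proof.
move=> mb mf; elim: L => [|L IH].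
  by rewrite big_ord0 -(prb0 P); apply: eq_prb => w; rewrite ltn0 andbF.
rewrite big_ord_recr /= IH (@prbID _ _ _ P (fun w => b w && (f w < L.+1)%N) (fun w => (f w < L)%N)).
- congr (_ + _); apply: eq_prb => w; rewrite -andbA; congr (_ && _); lia.
- by apply: measurable_and => //; exact: (measurable_natP (fun n => n < L.+1)%N).
- exact: (measurable_natP (fun n => n < L)%N).
Qed.

Lemma prb_nat_series (b : T -> bool) (f : T -> nat) :
  measurable_fun setT b -> measurable_fun setT f ->
  series (fun l => prb P (fun w => b w && (f w == l))) @ \oo --> prb P b.
Proof.
move=> mb mf.
have mbl L : measurable_fun setT (fun w => b w && (f w < L)%N).
  by apply: measurable_and => //; exact: (measurable_natP (fun n => n < L)%N).
rewrite (_ : series _ = fun L => prb P (fun w => b w && (f w < L)%N)); last first.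
  by apply/funext => L; rewrite -prb_nat_sum // /series /= big_mkord.
rewrite /prb; apply: fine_cvg.
rewrite fineK ?fin_num_measure //; last exact: measurable_boolP.
have -> : [set w | b w] = \bigcup_L [set w | b w && (f w < L)%N].
  apply/seteqP; split => w /=; last by move=> [L _] /andP[].
  by move=> bw; exists (f w).+1 => //=; rewrite bw ltnSn.
apply: nondecreasing_cvg_mu.
- by move=> L; exact: measurable_boolP.
- by apply: bigcup_measurable => L _; exact: measurable_boolP.
- move=> m n mn; apply/subsetPset => w /= /andP[-> h] /=.
  exact: leq_trans mn.
Qed.

Variables (N : nat -> {RV P >-> nat}) (u : nat -> R).
Hypothesis u0 : forall j, 0 <= u j.
Hypothesis N_law : forall n (k : nat -> nat),
  prb P (fun w => all (fun j => N j w == k j) (iota 0 n)) =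
  \prod_(j < n) poisson_weight (u j) (k j).
Variables (I : eqType) (J : I -> nat -> bool).
Hypothesis J_disjoint : forall i i' j, J i j -> J i' j -> i = i'.

Definition partial_count i n w : nat := \sum_(j < n) J i j * N j w.

Definition partial_rate i n : R := \sum_(j < n) (J i j)%:R * u j.

Lemma measurable_partial_count i n : measurable_fun setT (partial_count i n).
Proof.
elim: n => [|n IH].
  rewrite (_ : partial_count i 0 = cst 0%N); first exact: measurable_cst.
  by apply/funext => w; rewrite /partial_count big_ord0.
rewrite (_ : partial_count i n.+1 = fun w => (partial_count i n w + J i n * N n w)%N).
  apply: measurable_fun_addn => //.
  exact: (@measurableT_comp _ _ _ _ _ _ (fun x => J i n * x)%N).
by apply/funext => w; rewrite /partial_count big_ord_recr.
Qed.

Let event n n' s (k : I -> nat) (c : nat -> nat) w :=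
  all (fun i => partial_count i n w <= k i)%N s && all (fun j => N j w == c j) (iota n n').

Let mevent n n' s k c : measurable_fun setT (event n n' s k c).
Proof.
apply: measurable_and; apply: measurable_all_seq => i.
  exact: (measurable_natP (fun x => x <= k i)%N (measurable_partial_count i n)).
exact: (measurable_natP (fun x => x == c i)).
Qed.

(** Here [J i j] puts atom j into class i. The induction on n moves the variable [N n] from the
    counted block to the block with prescribed values. The classes being disjoint, at most one
    contains n: if it occurs in s, splitting along [N n] gives the convolution [poisson_cdfD]; if
    none does, [N n] is free and its weights sum to 1. *)
Let joint_cdf n n' s k c : uniq s ->
  prb P (event n n' s k c) =
  \prod_(i <- s) poisson_cdf (partial_rate i n) (k i) *
  \prod_(j <- iota n n') poisson_weight (u j) (c j).
Proof.
move=> us; elim: n n' k c => [|n IH] n' k c.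
  rewrite big1_seq => [|i _]; last by rewrite /partial_rate big_ord0 poisson_cdf0.
  rewrite mul1r -[iota 0 n']/(iota 0 n') -[in RHS](subn0 n') -/(index_iota 0 n') big_mkord -N_law.
  apply: eq_prb => w; rewrite /event (@eq_all _ _ xpredT) ?all_predT // => i.
  by rewrite /partial_count big_ord0.
have countS i w : partial_count i n.+1 w = (partial_count i n w + J i n * N n w)%N.
  by rewrite /partial_count big_ord_recr.
have rateS i : partial_rate i n.+1 = partial_rate i n + (J i n)%:R * u n.
  by rewrite /partial_rate big_ord_recr.
pose c' l j := if j == n then l else c j.
have c'E l : \prod_(j <- iota n n'.+1) poisson_weight (u j) (c' l j) =
    poisson_weight (u n) l * \prod_(j <- iota n.+1 n') poisson_weight (u j) (c j).
  rewrite big_cons /c' eqxx; congr (_ * _); rewrite !big_seq; apply: eq_bigr => j.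
  by rewrite mem_iota => /andP[nj _]; rewrite gtn_eqF.
have restE l w : all (fun j => N j w == c' l j) (iota n n'.+1) =
    (N n w == l) && all (fun j => N j w == c j) (iota n.+1 n').
  rewrite /= /c' eqxx; congr (_ && _); apply: eq_in_all => j.
  by rewrite mem_iota => /andP[nj _]; rewrite gtn_eqF.
have [/hasP[i0 i0s Ji0]|/hasPn none] := boolP (has (J^~ n) s).
  have Jn i : i != i0 -> J i n = false.
    by move=> ne; apply: contraNF ne => /J_disjoint /(_ Ji0) ->.
  pose k' l i := if i == i0 then (k i0 - l)%N else k i.
  rewrite (@eq_prb _ _ _ P _ (fun w => event n.+1 n' s k c w && (N n w < (k i0).+1)%N)); last first.
    move=> w; case: (boolP (event _ _ _ _ _ _)) => //= /andP[/allP /(_ _ i0s)].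
    by rewrite countS Ji0 mul1n ltnS => h _; apply/esym; apply: leq_trans h; exact: leq_addl.
  rewrite -prb_nat_sum //.
  have term (l : 'I_(k i0).+1) : prb P (fun w => event n.+1 n' s k c w && (N n w == l)) =
      poisson_cdf (partial_rate i0 n) (k i0 - l) * poisson_weight (u n) l *
      (\prod_(i <- s | i != i0) poisson_cdf (partial_rate i n) (k i) *
       \prod_(j <- iota n.+1 n') poisson_weight (u j) (c j)).
    rewrite (@eq_prb _ _ _ P _ (event n n'.+1 s (k' l) (c' l))); last first.
      move=> w; rewrite /event restE andbAC -!andbA; case: eqP => [Nl|_]; last by rewrite !andbF.
      rewrite /=; congr (_ && _); apply: eq_in_all => i iS.
      rewrite countS /k'; case: (eqVneq i i0) => [->|ne]; last by rewrite Jn // mul0n addn0.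
      by rewrite Ji0 mul1n Nl -[RHS](leq_add2r l) subnK // -ltnS.
    rewrite IH c'E (bigD1_seq i0) //= /k' eqxx mulrACA; congr (_ * (_ * _)).
    by apply: eq_bigr => i /negPf ->.
  rewrite (eq_bigr _ (fun l _ => term l)).
  rewrite -mulr_suml poisson_cdfD [in RHS](bigD1_seq i0) //= rateS Ji0 mul1r mulrA.
  congr (_ * _ * _); apply: eq_bigr => i ne.
  by rewrite rateS Jn // mul0r addr0.
have term l : prb P (fun w => event n.+1 n' s k c w && (N n w == l)) =
    (\prod_(i <- s) poisson_cdf (partial_rate i n) (k i) *
     \prod_(j <- iota n.+1 n') poisson_weight (u j) (c j)) * poisson_weight (u n) l.
  rewrite (@eq_prb _ _ _ P _ (event n n'.+1 s k (c' l))); last first.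
    move=> w; rewrite /event restE -andbA [X in _ && X]andbC; congr (_ && _).
    by apply: eq_in_all => i /none /negPf Jn; rewrite countS Jn mul0n addn0.
  by rewrite IH c'E -mulrA [X in _ = _ * X]mulrC.
have h := prb_nat_series (mevent n.+1 n' s k c) (@measurable_funP _ _ _ _ _ (N n)).
apply: (cvg_unique (@norm_hausdorff _ _) h).
rewrite (funext term).
rewrite (_ : series _ = (fun L => (\prod_(i <- s) poisson_cdf (partial_rate i n.+1) (k i) *
    \prod_(j <- iota n.+1 n') poisson_weight (u j) (c j)) * series (poisson_weight (u n)) L)).
  rewrite /= -[X in _ --> X]mulr1; apply: cvgM; first exact: cvg_cst.
  exact: poisson_series_cvg.
apply/funext => L; rewrite /series /= mulr_sumr; apply: eq_bigr => l _.
congr (_ * _ * _); rewrite !big_seq; apply: eq_bigr => i /none /negPf Jn.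
by rewrite rateS Jn mul0r addr0.
Qed.

Lemma partial_count_law n s (k : I -> nat) : uniq s ->
  prb P (fun w => all (fun i => partial_count i n w <= k i)%N s) =
  \prod_(i <- s) poisson_cdf (partial_rate i n) (k i).
Proof.
move=> us; have := joint_cdf n 0 k (fun=> 0%N) us; rewrite big_nil mulr1 => <-.
by apply: eq_prb => w; rewrite /event andbT.
Qed.

End PartialSums.

(** * Independence from lower rays *)

Section RayIndependence.
Context d (T : measurableType d) (R : realType) (P : probability T R).

Let independent_of (E F : set T) := measurable F /\ (P (F `&` E) = P F * P E)%E.

Let independentT E : measurable E -> independent_of E setT.
Proof. by move=> mE; split=> //; rewrite setTI probability_setT mul1e. Qed.

Let independent0 E : independent_of E set0.
Proof. by split=> //; rewrite set0I measure0 mul0e. Qed.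

Let independentD E A B : measurable E -> A `<=` B ->
  independent_of E A -> independent_of E B -> independent_of E (B `\` A).
Proof.
move=> mE AB [mA iA] [mB iB]; split; first exact: measurableD.
have fin X : measurable X -> P X \is a fin_num by move=> mX; exact: fin_num_measure.
have lt X : measurable X -> (P X < +oo)%E by move=> mX; rewrite ltey_eq fin.
rewrite (_ : _ `&` E = (B `&` E) `\` (A `&` E)); last first.
  apply/seteqP; split => x; first by move=> [[Bx nA] Ex]; split=> // -[].
  by move=> [[Bx Ex] nA]; split=> //; split=> // Ax; apply: nA.
have mBE := measurableI _ _ mB mE; have mAE := measurableI _ _ mA mE.
have hD X Y' : measurable X -> measurable Y' -> Y' `<=` X -> P (X `\` Y') = (P X - P Y')%E.
  by move=> mX mY' /setIidr e; rewrite measureD ?lt // e.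
rewrite !hD //; last by move=> x [/AB Bx Ex].
rewrite iA iB -(fineK (fin _ mA)) -(fineK (fin _ mB)) -(fineK (fin _ mE)).
by congr EFin; rewrite mulrBl.
Qed.

Let independent_bigcup E (F : (set T)^nat) : measurable E -> trivIset setT F ->
  (forall k, independent_of E (F k)) -> independent_of E (\bigcup_k F k).
Proof.
move=> mE tF iF; split; first by apply: bigcup_measurable => k _; have [] := iF k.
rewrite setI_bigcupl !measure_bigcup //; last 3 first.
- by move=> k _; have [] := iF k.
- by move=> k _; have [mF _] := iF k; exact: measurableI.
- exact: trivIset_setIr.
rewrite muleC -[P E]fineK ?fin_num_measure // -nneseriesZl //.
by apply: eq_eseriesr => k _; rewrite fineK ?fin_num_measure // muleC; have [] := iF k.
Qed.

Definition nat_or_infinite (Y : T -> \bar R) :=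
  forall w, Y w = +oo%E \/ exists k : nat, Y w = k%:R%:E.

Let level (Y : T -> \bar R) k := [set w | Y w = k%:R%:E].
Let ray (Y : T -> \bar R) (k : nat) := [set w | (Y w <= k%:R%:E)%E].

Let independent_level (Y : T -> \bar R) E : measurable E -> nat_or_infinite Y ->
  (forall k, independent_of E (ray Y k)) -> forall k, independent_of E (level Y k).
Proof.
move=> mE vY iR [|k].
  rewrite (_ : level Y 0 = ray Y 0) //; apply/seteqP; split => w; rewrite /level /ray /=; first by move=> ->.
  by case: (vY w) => [->|[k ->]] //; rewrite lee_fin ler_nat leqn0 => /eqP ->.
rewrite (_ : level Y k.+1 = ray Y k.+1 `\` ray Y k).
  by apply: independentD => // w /= /le_trans; apply; rewrite lee_fin ler_nat.
apply/seteqP; split => w; rewrite /level /ray /=.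
  by move=> ->; rewrite !lee_fin !ler_nat ltnn leqnn.
case: (vY w) => [->|[l ->]]; first by case.
rewrite !lee_fin !ler_nat => -[lk /negP]; rewrite -ltnNge => kl.
by congr (_%:R%:E); apply/eqP; rewrite eqn_leq lk.
Qed.

Let trivIset_level (Y : T -> \bar R) : trivIset setT (level Y).
Proof.
by move=> i j _ _ [w []]; rewrite /level /= => -> /eqP; rewrite eqe eqr_nat => /eqP.
Qed.

Let independent_infinite (Y : T -> \bar R) E : measurable E -> nat_or_infinite Y ->
  (forall k, independent_of E (ray Y k)) -> independent_of E [set w | Y w = +oo%E].
Proof.
move=> mE vY iR; rewrite (_ : [set w | _] = setT `\` \bigcup_k level Y k).
  apply: independentD => //; last exact: independentT.
  by apply: independent_bigcup => //; exact: independent_level.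
apply/seteqP; split => w /=; first by move=> Yw; split=> // -[k _]; rewrite /level /= Yw.
by case: (vY w) => [//|[k Yk]] [_]; case; exists k.
Qed.

Let independent_preimage (Y : T -> \bar R) E U : measurable E -> nat_or_infinite Y ->
  (forall k, independent_of E (ray Y k)) -> independent_of E (Y @^-1` U).
Proof.
move=> mE vY iR.
pose G k := if k is k'.+1 then (if k'%:R%:E \in U then level Y k' else set0)
  else if +oo%E \in U then [set w | Y w = +oo%E] else set0.
rewrite (_ : Y @^-1` U = \bigcup_k G k).
  apply: independent_bigcup => //.
    move=> [|i] [|j] _ _ //; rewrite /G.
    - by case: ifP => _; case: ifP => _ [w []] //=; rewrite /level /= => ->.
    - by case: ifP => _; case: ifP => _ [w []] //=; rewrite /level /= => ->.
    - case: ifP => _; case: ifP => _ [w []] //= h1 h2.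
      by congr S; apply: (@trivIset_level Y) => //; exists w.
  move=> [|k] /=; case: ifP => _ //.
    exact: independent_infinite.
  exact: independent_level.
apply/seteqP; split => w /=.
  case: (vY w) => [Yw|[k Yw]]; rewrite Yw => /mem_set Uw.
    by exists 0%N => //=; rewrite Uw.
  by exists k.+1 => //=; rewrite Uw.
by case=> -[|k] _ /=; case: ifPn => //= /set_mem Uw ->.
Qed.

(** Rays are replaced by arbitrary sets one index at a time. With E the event fixed by the other
    indices, independence of E passes from rays to levels by differences, to the value [+oo] by
    complement, and to every preimage because only countably many values occur. *)
Lemma ray_independent (I : eqType) (Y : I -> T -> \bar R) :
  (forall i, measurable_fun setT (Y i)) -> (forall i, nat_or_infinite (Y i)) ->
  (forall s (k : I -> nat), uniq s ->
    P (\bigcap_(i in [set` s]) ray (Y i) (k i)) = (\prod_(i <- s) P (ray (Y i) (k i)))%E) ->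
  mutually_independent P Y.
Proof.
move=> mY vY hray s A us mA.
have mray i k : measurable (ray (Y i) k).
  by rewrite -[X in measurable X]setTI; apply: emeasurable_fun_infty_c.
have mpre i : measurable (Y i @^-1` A i).
  by rewrite -[X in measurable X]setTI; exact: mY.
have bcons (F : I -> set T) i l : \bigcap_(j in [set` i :: l]) F j =
    F i `&` \bigcap_(j in [set` l]) F j.
  apply/seteqP; split => w h.
    split; first by apply: h; rewrite /= mem_head.
    by move=> j /= jl; apply: h; rewrite /= inE jl orbT.
  by move=> j; rewrite /= inE => /predU1P[->|jl]; [exact: h.1|exact: h.2].
have msec (F : I -> set T) (l : seq I) : (forall i, measurable (F i)) ->
    measurable (\bigcap_(i in [set` l]) F i).
  move=> mF; elim: l => [|i l IH]; first by rewrite set_nil bigcap_set0.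
  by rewrite bcons; exact: measurableI.
(* The indices in s1 already carry arbitrary sets, those in s2 still carry rays. *)
have main s1 s2 (k : I -> nat) : uniq (s1 ++ s2) ->
    P ((\bigcap_(i in [set` s1]) Y i @^-1` A i) `&` (\bigcap_(i in [set` s2]) ray (Y i) (k i))) =
    ((\prod_(i <- s1) P (Y i @^-1` A i)) * \prod_(i <- s2) P (ray (Y i) (k i)))%E.
  elim: s1 s2 k => [|i s1 IH] s2 k.
    by rewrite set_nil bigcap_set0 setTI big_nil mul1e; exact: hray.
  move=> /= /andP[i12 u12].
  set E := (\bigcap_(j in [set` s1]) Y j @^-1` A j) `&`
    (\bigcap_(j in [set` s2]) ray (Y j) (k j)).
  have mE : measurable E by apply: measurableI; exact: msec.
  have iE l : independent_of E (ray (Y i) l).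
    split=> //; rewrite [in RHS]/E IH //.
    pose k' j := if j == i then l else k j.
    have k'E j : j \in s2 -> k' j = k j.
      by move=> js; rewrite /k'; case: eqP => // e; move: i12; rewrite -e mem_cat js orbT.
    have -> : ray (Y i) l `&` E = (\bigcap_(j in [set` s1]) Y j @^-1` A j) `&`
        (\bigcap_(j in [set` i :: s2]) ray (Y j) (k' j)).
      rewrite bcons /E setICA /k' eqxx; congr (_ `&` (_ `&` _)).
      by apply: eq_bigcapr => j /= /k'E; rewrite /k' => ->.
    rewrite IH; last by rewrite -cat1s uniq_catCA /= i12.
    rewrite big_cons muleCA {1}/k' eqxx; congr (_ * (_ * _))%E.
    by rewrite !big_seq; apply: eq_bigr => j /k'E ->.
  rewrite bcons -setIA.
  have [_ ->] := independent_preimage (A i) mE (vY i) iE.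
  by rewrite /E IH // big_cons muleA.
have := main s [::] (fun=> 0%N); rewrite cats0 => /(_ us).
by rewrite set_nil bigcap_set0 setIT big_nil mule1.
Qed.
End RayIndependence.

Lemma counting_set1 (R : realType) (T : choiceType) (x : T) : counting [set x] = 1%E :> \bar R.
Proof.
rewrite /counting; case: ifPn => [_|/asboolPn]; last by case; exact: finite_set1.
by rewrite fset_set1 finmap.cardfs1.
Qed.

(** * A Poisson process with countably many atoms *)

Section PoissonConstruction.
Context (R : realType) (S : countType).
Variables (B : nat -> subsets S) (u : nat -> {nonneg R}).

Definition discrete_measure : {measure set (subsets S) -> \bar R} :=
  mseries (fun j => mscale (u j) (dirac (B j))) 0.

Lemma discrete_measureE (A : set (subsets S)) :
  discrete_measure A = (\sum_(0 <= j <oo) ((u j)%:num * (B j \in A)%:R)%:E)%E.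
Proof.
rewrite /discrete_measure /= /mseries; apply: eq_eseriesr => j _.
by rewrite EFinM -diracE.
Qed.

Context d (T : measurableType d) (P : probability T R) (N : nat -> {RV P >-> nat}).

(* The process consists of N_j copies of each B_j; the pairs (j, l) with
   l < N_j are enumerated by their codes k. *)
Definition cluster_member (k : nat) (n : nat -> nat) : set S :=
  if pickle_inv k is Some (j, l) then if (l < n j)%N then B j else set0 else set0.

Definition cluster_fun (k : nat) (w : T) : subsets S := cluster_member k (N ^~ w).

Lemma measurable_cluster_fun k : measurable_fun setT (cluster_fun k).
Proof.
rewrite /cluster_fun /cluster_member; case: (pickle_inv k) => [[j l]|]; last exact: measurable_cst.
exact: (@measurableT_comp _ _ _ _ _ _ (fun x => (if (l < x)%N then B j else set0) : subsets S)).
Qed.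

HB.instance Definition _ k := isMeasurableFun.Build _ _ T (subsets S)
  (cluster_fun k) (measurable_cluster_fun k).

Definition cluster (k : nat) : {RV P >-> subsets S} := cluster_fun k.

Lemma counting_image (f : nat -> nat) n : injective f ->
  counting (f @` `I_n) = n%:R%:E :> \bar R.
Proof.
move=> fi; elim: n => [|n IH]; first by rewrite II0 image_set0 measure0.
rewrite IIS image_setU image_set1 measureU //; last first.
  apply/seteqP; split => // x [[k /= kn <-] /fi kE].
  by rewrite kE ltnn in kn.
rewrite -[n.+1]addn1 natrD EFinD; congr (_ + _)%E; first exact: IH.
exact: counting_set1.
Qed.

Section Count.
Variables (I : eqType) (A : I -> set (subsets S)).
Hypothesis mA : forall i, measurable (A i).
Hypothesis A0 : forall i, ~ A i set0.
Hypothesis A_disjoint : forall i i' C, A i C -> A i' C -> i = i'.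

Let J i j := B j \in A i.

(** Truncation to the first n atoms makes the count finite and equal to [partial_count]. *)
Let members i n w : set nat := [set k | if pickle_inv k is Some (j, l) then
  [/\ (j < n)%N, A i (B j) & (l < N j w)%N] else False].

Let members_bigcup i w : \bigcup_n members i n w = [set k | A i (cluster k w)].
Proof.
apply/seteqP; split => k; rewrite /members /= /cluster /= /cluster_fun /cluster_member.
  move=> [n _] /=; case: (pickle_inv k) => [[j l]|] //= [_ Aj ->] //.
case E : (pickle_inv k) => [[j l]|]; last by move=> /A0.
case: ifP => [lN Aj|_ /A0 //].
by exists j.+1 => //=; rewrite E ltnSn.
Qed.

Let counting_members i n w :
  counting (members i n w) = (partial_count N J i n w)%:R%:E :> \bar R.
Proof.
elim: n => [|n IH].
  rewrite /partial_count big_ord0 (_ : members i 0 w = set0) ?measure0 //.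
  by apply/seteqP; split => k //=; rewrite /members /=; case: pickle_inv => [[j l]|] // [].
rewrite /partial_count big_ord_recr /= -/(partial_count N J i n w) natrD EFinD -IH.
have pinj : injective (fun l : nat => pickle (n, l)).
  by move=> l l' /(pcan_inj (@pickleK_inv (nat * nat)%type)) [].
rewrite /J; case: (boolP (B n \in A i)) => [/set_mem An|/negP nA].
  rewrite mul1n -(counting_image (N n w) pinj) -measureU //; last first.
    apply/seteqP; split => // k [] + [l _ e]; rewrite /members /= -e pickleK_inv.
    by move=> [] /=; rewrite ltnn.
  congr (counting _); apply/seteqP; split => k; rewrite /members /=.
    case E : (pickle_inv k) => [[j l]|] //= [jn Aj lN].
    have [lt|ge] := ltnP j n; first by left.
    have e : j = n by apply/eqP; rewrite eqn_leq ge -ltnS jn.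
    right; rewrite e in E lN; exists l => //=.
    by have := @pickle_invK (nat * nat)%type k; rewrite E.
  case=> [|[l lN <-]]; last by rewrite pickleK_inv.
  by case: pickle_inv => [[j l]|] //= [jn Aj lN]; split=> //; exact: ltnW.
rewrite mul0n adde0; congr (counting _); apply/seteqP; split => k; rewrite /members /=.
  case: pickle_inv => [[j l]|] //= [jn Aj lN]; split => //.
  rewrite ltn_neqAle -ltnS jn andbT; apply/eqP => e; apply: nA.
  by rewrite -e; exact: mem_set.
by case: pickle_inv => [[j l]|] //= [jn Aj lN]; split=> //; exact: ltnW.
Qed.

(** The full count is the increasing limit of the truncated ones. *)
Let point_count_leP i K w : (point_count R cluster (A i) w <= K%:R%:E)%E <->
  forall n, (partial_count N J i n w <= K)%N.
Proof.
rewrite /point_count -members_bigcup; split=> [h n|h].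
  rewrite -(ler_nat R) -lee_fin -counting_members (le_trans _ h) //.
  by apply: le_measure; rewrite ?inE // => k km; exists n.
have c : (counting (R:=R) \o members i ^~ w) @ \oo --> counting (R:=R) (\bigcup_n members i n w).
  apply: nondecreasing_cvg_mu => // m n mn; apply/subsetPset => k; rewrite /members /=.
  case: pickle_inv => [[j l]|] //= [jm Aj lN]; split=> //.
  exact: leq_trans mn.
rewrite -(cvg_lim (@ereal_hausdorff R) c); apply: lime_le; first exact: cvgP c.
by near=> n; rewrite /= counting_members lee_fin ler_nat.
Unshelve. all: by end_near. Qed.

Let nat_or_infinite_point_count i : nat_or_infinite (point_count R cluster (A i)).
Proof.
move=> w; rewrite /point_count /counting; case: ifP => _; last by left.
by right; eexists.
Qed.

(** Infinite mass belongs to the variable equal to [+oo], which lies below no k; the value 0 is also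
    the limit of [poisson_cdf] as the rate grows. *)
Definition extended_cdf (x : \bar R) k : R := if x is l%:E then poisson_cdf l k else 0.

Let rate := partial_rate (fun j => (u j)%:num) J.

Let rate_cvg i : (fun n => (rate i n)%:E) @ \oo --> discrete_measure (A i).
Proof.
rewrite discrete_measureE.
rewrite (_ : (fun n => _) = (fun n => \sum_(0 <= j < n) ((u j)%:num * (B j \in A i)%:R)%:E)%E).
  by apply: is_cvg_nneseries => j _ _; rewrite lee_fin mulr_ge0.
apply/funext => n; rewrite sumEFin; congr EFin.
by rewrite big_mkord; apply: eq_bigr => j _; rewrite mulrC.
Qed.

Let cdf_cvg i k :
  (fun n => poisson_cdf (rate i n) k) @ \oo --> extended_cdf (discrete_measure (A i)) k.
Proof.
have := @rate_cvg i; have : (0 <= discrete_measure (A i))%E by [].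
case: (discrete_measure (A i)) => [l| |] // _ h /=.
  have hl : rate i @ \oo --> l by exact: (fine_cvg h).
  exact: (continuous_cvg _ (@continuous_poisson_cdf R k l) hl).
by apply: poisson_cdf_cvg0; exact/cvgeryP.
Qed.

Hypothesis N_law : forall n (k : nat -> nat),
  prb P (fun w => all (fun j => N j w == k j) (iota 0 n)) =
  \prod_(j < n) poisson_weight (u j)%:num (k j).

(** The events for the first n atoms decrease to the one in question. Their probabilities are
    products by [partial_count_law], and [cdf_cvg] passes to the limit in every factor, for finite
    and infinite rates alike. *)
Let ray_law s (k : I -> nat) : uniq s ->
  P (\bigcap_(i in [set` s]) [set w | (point_count R cluster (A i) w <= (k i)%:R%:E)%E]) =
  (\prod_(i <- s) extended_cdf (discrete_measure (A i)) (k i))%:E.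
Proof.
move=> us.
pose b n w := all (fun i => partial_count N J i n w <= k i)%N s.
have Jd i i' j : J i j -> J i' j -> i = i'.
  by move=> /set_mem h /set_mem h'; exact: A_disjoint h h'.
have mb n : measurable_fun setT (b n).
  apply: measurable_all_seq => i.
  exact: (measurable_natP (fun x => x <= k i)%N (measurable_partial_count N J i n)).
rewrite (_ : \bigcap_(i in _) _ = \bigcap_n [set w | b n w]); last first.
  apply/seteqP; split => w h.
    by move=> n _; apply/allP => i iS; apply: (point_count_leP i (k i) w).1; exact: h.
  by move=> i /= iS; apply/point_count_leP => n; exact: (allP (h n Logic.I) i iS).
have c : (P \o (fun n => [set w | b n w])) @ \oo --> P (\bigcap_n [set w | b n w]).
  apply: nonincreasing_cvg_mu.
  - by rewrite ltey_eq fin_num_measure //; exact: measurable_boolP.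
  - by move=> n; exact: measurable_boolP.
  - by apply: bigcap_measurable => // n _; exact: measurable_boolP.
  - move=> m n mn; apply/subsetPset => w /allP h; apply/allP => i /h.
    apply: leq_trans; rewrite /partial_count -(subnKC mn) big_split_ord /=.
    exact: leq_addr.
apply: (cvg_unique (@ereal_hausdorff R) c).
rewrite (_ : P \o _ = fun n => (\prod_(i <- s) poisson_cdf (rate i n) (k i))%:E); last first.
  by apply/funext => n; rewrite /= prbE // (@partial_count_law _ _ _ P N (fun j => (u j)%:num) N_law _ J Jd).
apply: cvg_EFin; first by near=> n.
rewrite (_ : fine \o _ = fun n => \prod_(i <- s) poisson_cdf (rate i n) (k i)) //.
elim: s {us b mb c} => [|i s IH].
  by under eq_fun do rewrite big_nil; rewrite big_nil; exact: cvg_cst.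
under eq_fun do rewrite big_cons.
by rewrite big_cons; apply: cvgM; [exact: cdf_cvg|exact: IH].
Unshelve. all: by end_near. Qed.

Lemma point_count_independent :
  mutually_independent P (fun i => point_count R cluster (A i)).
Proof.
apply: ray_independent => [i|i|s k us].
- exact: measurable_point_count.
- exact: nat_or_infinite_point_count.
rewrite ray_law // -prodEFin; apply: eq_bigr => i _.
have := @ray_law [:: i] k isT; rewrite big_seq1 => <-; congr (P _).
apply/seteqP; split => w /=; first by apply; rewrite /= mem_head.
by move=> h j /=; rewrite inE => /eqP ->.
Qed.

Lemma point_count_poisson i :
  poisson_distributed P (discrete_measure (A i)) (point_count R cluster (A i)).
Proof.
set Y := point_count _ _ _.
have ray k : P [set w | (Y w <= k%:R%:E)%E] = (extended_cdf (discrete_measure (A i)) k)%:E.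
  have := @ray_law [:: i] (fun=> k) isT; rewrite big_seq1 => <-; congr (P _).
  apply/seteqP; split => w /=; last by apply; rewrite /= mem_head.
  by move=> h j /=; rewrite inE => /eqP ->.
have mY := measurable_point_count cluster (mA i).
have mray k : measurable [set w | (Y w <= k%:R%:E)%E].
  by rewrite -[X in measurable X]setTI; apply: emeasurable_fun_infty_c.
have vY := @nat_or_infinite_point_count i : nat_or_infinite Y.
have levelS k : P (Y @^-1` [set k.+1%:R%:E]) =
    (extended_cdf (discrete_measure (A i)) k.+1 - extended_cdf (discrete_measure (A i)) k)%:E.
  have -> : Y @^-1` [set k.+1%:R%:E] = [set w | (Y w <= k.+1%:R%:E)%E] `\` [set w | (Y w <= k%:R%:E)%E].
    apply/seteqP; split => w /=; first by move=> ->; rewrite !lee_fin !ler_nat ltnn leqnn.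
    case: (vY w) => [->|[l ->]]; first by case.
    rewrite !lee_fin !ler_nat => -[lk /negP]; rewrite -ltnNge => kl.
    by congr (_%:R%:E); apply/eqP; rewrite eqn_leq lk.
  have sub : [set w | (Y w <= k%:R%:E)%E] `<=` [set w | (Y w <= k.+1%:R%:E)%E].
    by move=> w /= /le_trans; apply; rewrite lee_fin ler_nat.
  transitivity (P [set w | (Y w <= k.+1%:R%:E)%E] - P [set w | (Y w <= k%:R%:E)%E])%E.
    by rewrite measureD ?(setIidr sub) // ltey_eq fin_num_measure.
  by rewrite !ray EFinB.
have level0 : P (Y @^-1` [set 0%:R%:E]) = (extended_cdf (discrete_measure (A i)) 0)%:E.
  rewrite -ray; congr (P _); apply/seteqP; split => w /=; first by move=> ->.
  by case: (vY w) => [->|[l ->]] //; rewrite lee_fin ler_nat leqn0 => /eqP ->.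
have : (0 <= discrete_measure (A i))%E by [].
case E : (discrete_measure (A i)) => [l| |] // _; rewrite E in ray levelS level0.
  move=> [|k]; last by rewrite levelS /= /poisson_cdf big_ord_recr /= addrAC subrr add0r.
  by rewrite level0 /= /poisson_cdf big_ord1.
(* With infinite mass every finite value has probability 0, so the count is almost surely
   infinite. *)
have mlevel x : measurable (Y @^-1` [set x]) by rewrite -[X in measurable X]setTI; exact: mY.
have : P (~` (\bigcup_k (Y @^-1` [set k%:R%:E]))) = 1%E.
  have mU : measurable (\bigcup_k (Y @^-1` [set k%:R%:E])) by apply: bigcup_measurable => k _.
  rewrite probability_setC //; have -> : P (\bigcup_k (Y @^-1` [set k%:R%:E])) = 0%E.
    rewrite measure_bigcup //; last first.
      by move=> a b _ _ [w [/= -> /eqP]]; rewrite eqe eqr_nat => /eqP.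
    apply: eseries0 => k _ _; case: k => [|k]; first exact: level0.
    by apply: etrans (levelS k) _; rewrite /= subrr.
  by rewrite sube0.
move=> /= <-; congr (P _); apply/seteqP; split => w /=; first by move=> Yw [k _ /=]; rewrite Yw.
by case: (vY w) => [->|[k Yk]] // h; exfalso; apply: h; exists k.
Qed.
End Count.

Hypothesis N_law : forall n (k : nat -> nat),
  prb P (fun w => all (fun j => N j w == k j) (iota 0 n)) =
  \prod_(j < n) poisson_weight (u j)%:num (k j).

Lemma cluster_poisson_process : poisson_process discrete_measure cluster.
Proof.
split=> [A mA A0|n A mA A0 tA].
  by apply: (@point_count_poisson unit (fun=> A)) => // -[] [].
apply: point_count_independent => // i i' C AC AC'.
by apply: tA => //; exists C.
Qed.
End PoissonConstruction.

Lemma poisson_process_exists (R : realType) (S : countType) (B : nat -> subsets S)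
    (u : nat -> {nonneg R}) :
  exists (d : measure_display) (T : measurableType d) (P : probability T R)
    (Z : nat -> {RV P >-> subsets S}), poisson_process (discrete_measure B u) Z.
Proof.
have [d [T [P [N hN]]]] := @independent_nat_sequence R (fun j => poisson_weight (u j)%:num)
  (fun j k => poisson_weight_ge0 k (ge0 (u j))) (fun j => @poisson_series_cvg R (u j)%:num).
by exists d, T, P, (cluster B N); exact: cluster_poisson_process.
Qed.

(** * The representing intensity *)

Section VoidDeterminesLaw.
Context (R : realType) (S : countType).
Context d1 (T1 : measurableType d1) (P1 : probability T1 R) (X1 : S -> T1 -> bool).
Context d2 (T2 : measurableType d2) (P2 : probability T2 R) (X2 : S -> T2 -> bool).
Hypothesis mX1 : forall i, measurable_fun setT (X1 i).
Hypothesis mX2 : forall i, measurable_fun setT (X2 i).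

Let pre1 (A : set (S -> bool)) := [set w | A (X1^~ w)].
Let pre2 (A : set (S -> bool)) := [set w | A (X2^~ w)].
Let agree A := [/\ measurable (pre1 A), measurable (pre2 A) & P1 (pre1 A) = P2 (pre2 A)].

Let agree_lambda_system : lambda_system setT agree.
Proof.
split=> //.
- split; rewrite /pre1 /pre2.
  + exact: measurableT.
  + exact: measurableT.
  + by rewrite !probability_setT.
- move=> A B BA [mA1 mA2 eA] [mB1 mB2 eB].
  have D1 : pre1 (A `\` B) = pre1 A `\` pre1 B by [].
  have D2 : pre2 (A `\` B) = pre2 A `\` pre2 B by [].
  split; [by rewrite D1; exact: measurableD|by rewrite D2; exact: measurableD|].
  have hD d (T : measurableType d) (P : probability T R) (U V : set T) :
      measurable U -> measurable V -> V `<=` U -> P (U `\` V) = (P U - P V)%E.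
    move=> mU mV /setIidr e; rewrite measureD ?e //.
    by rewrite ltey_eq fin_num_measure.
  rewrite D1 D2 !hD ?eA ?eB // => w; exact: BA.
- move=> F ndF hF.
  have U1 : pre1 (\bigcup_k F k) = \bigcup_k pre1 (F k) by [].
  have U2 : pre2 (\bigcup_k F k) = \bigcup_k pre2 (F k) by [].
  have mF1 k : measurable (pre1 (F k)) by have [] := hF k.
  have mF2 k : measurable (pre2 (F k)) by have [] := hF k.
  split; [by rewrite U1; exact: bigcup_measurable|by rewrite U2; exact: bigcup_measurable|].
  have c1 : (P1 \o (fun k => pre1 (F k))) @ \oo --> P1 (\bigcup_k pre1 (F k)).
    apply: nondecreasing_cvg_mu => //; first exact: bigcup_measurable.
    by move=> m n /ndF/subsetPset h; apply/subsetPset => w; exact: h.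
  have c2 : (P2 \o (fun k => pre2 (F k))) @ \oo --> P2 (\bigcup_k pre2 (F k)).
    apply: nondecreasing_cvg_mu => //; first exact: bigcup_measurable.
    by move=> m n /ndF/subsetPset h; apply/subsetPset => w; exact: h.
  rewrite U1 U2; apply: (cvg_unique (@ereal_hausdorff R) c1).
  rewrite (_ : P1 \o _ = P2 \o (fun k => pre2 (F k))) //.
  by apply/funext => k /=; have [] := hF k.
Qed.

(** Void events are stable under intersection, by concatenation of the lists, and generate the
    cylinder sigma-algebra, so the two laws agree by the pi-lambda theorem. *)
Lemma eq_in_distribution_void :
  (forall F, P1 [set w | void_event F (X1^~ w)] = P2 [set w | void_event F (X2^~ w)]) ->
  eq_in_distribution P1 X1 P2 X2.
Proof.
move=> eqF A; set G : set (set (S -> bool)) := range (@void_event S).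
have mvoid d (T : measurableType d) (X : S -> T -> bool) F :
    (forall i, measurable_fun setT (X i)) -> measurable [set w | void_event F (X^~ w)].
  move=> mX; apply: measurable_boolP; apply: measurable_all_seq => i.
  exact: (measurable_bool_comp negb).
have cylG : <<s @cylinders S >> `<=` <<s G >>.
  apply: smallest_sub; first exact: smallest_sigma_algebra.
  have void1 i : <<s G >> [set x | x i = false].
    apply: sub_sigma_algebra; exists [:: i] => //; rewrite void_event_cons.
    by apply/seteqP; split => x //= [].
  move=> _ [i [[|] ->]] //.
  rewrite (_ : [set x | _] = ~` [set x : S -> bool | x i = false]).
    by apply: (@measurableC _ (g_sigma_algebraType G)); exact: void1.
  by apply/seteqP; split => x /=; case: (x i).
move=> /cylG GA; suff [] : agree A by [].
have GI : setI_closed G.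
  move=> _ _ [F1 _ <-] [F2 _ <-]; exists (F1 ++ F2) => //.
  by apply/seteqP; split => x; rewrite /void_event /= all_cat => /andP.
apply: (lambda_system_subset GI agree_lambda_system _ _ GA) => //.
by move=> _ [F _ <-]; split; [exact: mvoid|exact: mvoid|exact: eqF].
Qed.
End VoidDeterminesLaw.

Lemma measurable_covered d (T : measurableType d) (R : realType) (P : probability T R)
    (S : countType) (Z : nat -> {RV P >-> subsets S}) i :
  measurable_fun setT (covered Z i).
Proof.
apply: (measurable_fun_bool true); rewrite setTI.
rewrite (_ : _ @^-1` _ = \bigcup_k (Z k @^-1` [set B : subsets S | (B : set S) i])).
  apply: bigcup_measurable => k _; apply: measurable_funPTI => //.
  by apply: sub_sigma_algebra; exists i.
apply/seteqP; split => w /=; first by move=> /asboolP[k h]; exists k.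
by move=> [k _ h]; apply/asboolP; exists k.
Qed.

(** * Sums over countable types *)

Section SumsOverTypes.
Context {R : realType}.
Local Open Scope ereal_scope.

Lemma esum_sumtype (A B : choiceType) (F : A + B -> \bar R) : (forall x, 0 <= F x) ->
  \esum_(x in [set: A + B]) F x =
  \esum_(a in [set: A]) F (inl a) + \esum_(b in [set: B]) F (inr b).
Proof.
move=> F0; rewrite (esumID (range inl)) //; congr (_ + _).
  by rewrite setTI esum_image // => a b _ _ [].
rewrite setTI (_ : ~` _ = range inr); first by rewrite esum_image // => a b _ _ [].
apply/seteqP; split => [[a|b] h|_ [b _ <-] [a _ //]]; last by exists b.
by exfalso; apply: h; exists a.
Qed.

Lemma esum_prodtype (A B : choiceType) (F : A -> B -> \bar R) : (forall x y, 0 <= F x y) ->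
  \esum_(x in [set: A * B]) F x.1 x.2 =
  \esum_(a in [set: A]) \esum_(b in [set: B]) F a b.
Proof.
move=> F0; rewrite esum_esum //; congr (esum _ _).
by apply/seteqP; split.
Qed.

Lemma esum_fintype (A : finType) (F : A -> \bar R) : (forall x, 0 <= F x) ->
  \esum_(x in [set: A]) F x = \sum_x F x.
Proof.
move=> F0; rewrite esum_fset //; last exact: finite_finset.
rewrite (@fsbigE _ _ _ _ _ (index_enum A)) ?index_enum_uniq //; last first.
  by move=> i _; rewrite mem_index_enum.
by apply: eq_bigl => i; rewrite in_setT.
Qed.

Lemma esum_telescope (h : nat -> R) (l : R) : nondecreasing_seq h -> h @ \oo --> l ->
  \esum_(k in [set: nat]) (h k.+1 - h k)%:E = (l - h 0%N)%:E.
Proof.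
move=> ndh hl; rewrite -nneseries_esumT; last first.
  by move=> k; rewrite lee_fin subr_ge0; exact: ndh.
apply: cvg_lim => //.
rewrite (_ : (fun n => _) = (fun n => (h n - h 0%N)%:E)); last first.
  by apply/funext => n; rewrite sumEFin telescope_sumr.
apply: cvg_EFin; first by near=> n.
by apply: cvgB => //; exact: cvg_cst.
Unshelve. all: by end_near. Qed.

Lemma esum_pickle (J : countType) (F : J -> \bar R) : (forall j, 0 <= F j) ->
  \sum_(0 <= n <oo) (if pickle_inv n is Some j then F j else 0) =
  \esum_(j in [set: J]) F j.
Proof.
move=> F0; rewrite nneseries_esumT; last by move=> n; case: pickle_inv.
rewrite [LHS](esumID (range (@pickle J))); last by move=> n _; case: pickle_inv.
rewrite setTI esum_image; last by move=> i j _ _; apply: (pcan_inj pickleK).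
rewrite [X in _ + X]esum1 ?adde0.
  by apply: eq_esum => j _; rewrite pickleK_inv.
move=> n [_ /= nr]; case e : (pickle_inv n) => [j|] //.
by case: nr; exists j => //; have := @pickle_invK J n; rewrite e.
Qed.

End SumsOverTypes.

(** * Telescoping sums of mixed differences *)

Section BoxSums.
Context {R : realType}.
Variable z : nat -> R.
Hypothesis z_0 : z 0%N = 0.
Hypothesis z_nd : nondecreasing_seq z.
Hypothesis z_cvg : z @ \oo --> (1 : R).

(** A cap is the index of the first marked vertex of a leg, [None] if no vertex is marked. Index k
    means distance k + 1, hence the value [z k.+1]; a set with b vertices on the leg misses the
    marks when b <= k. *)
Definition cap_value (c : option nat) : R := if c is Some k then z k.+1 else 1.

Definition under_cap (k : nat) (c : option nat) : bool :=
  if c is Some n then (k <= n)%N else true.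

Definition step_box (b : seq nat) : seq (R * R) := [seq (z k, z k.+1) | k <- b].

Let z_ge0 k : 0 <= z k.
Proof. by rewrite -z_0; exact: z_nd. Qed.

Let z_le1 k : z k <= 1.
Proof.
rewrite -(cvg_lim (@Rhausdorff R) z_cvg).
by apply: nondecreasing_cvgn_le => //; exact: cvgP z_cvg.
Qed.

Lemma cap_value_ge0 c : 0 <= cap_value c.
Proof. by case: c => [k|] //=. Qed.

Lemma prod_cap_value_ge0 (cs : seq (option nat)) : 0 <= \prod_(c <- cs) cap_value c.
Proof. by apply: prodr_ge0 => c _; exact: cap_value_ge0. Qed.

(** The boxes under the caps tile the box with upper corner given by the cap values and lower corner
    0. Summing one coordinate at a time telescopes; the lower ends vanish because z 0 = 0 and g 0 =
    0, and an absent cap uses z -> 1 and continuity. The difference in the first coordinate meets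
    the same hypotheses as g. *)
Lemma esum_box (g : R -> R) (cs : seq (option nat)) : g 0 = 0 ->
  (forall t, 0 <= t -> {for t, continuous g}) ->
  (forall b, size b = size cs -> 0 <= mixed_diff g (step_box b) 1) ->
  (\esum_(b in [set b | all2 under_cap b cs]) (mixed_diff g (step_box b) 1)%:E =
   (g (\prod_(c <- cs) cap_value c))%:E)%E.
Proof.
elim: cs g => [|c cs IH] g g0 cg pg.
  rewrite (_ : [set b | _] = [set [::]]) ?esum_set1 ?big_nil //.
    by rewrite lee_fin; exact: pg.
  by apply/seteqP; split => [[|k b]|_ ->].
set t := \prod_(c <- cs) cap_value c.
have t0 : 0 <= t := prod_cap_value_ge0 cs.
have all2_size b : all2 under_cap b cs -> size b = size cs by rewrite all2E => /andP[/eqP].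
rewrite (_ : [set b | _] = (fun kb => kb.1 :: kb.2) @`
    ([set k | under_cap k c] `*`` fun=> [set b | all2 under_cap b cs])); last first.
  apply/seteqP; split => [[|k b] //= /andP[h1 h2]|_ [[k b] /= [h1 h2] <-]].
    by exists (k, b).
  by rewrite /= h1.
rewrite esum_image; last by move=> [k b] [k' b'] _ _ /= [-> ->].
pose gk k y := g (z k.+1 * y) - g (z k * y).
rewrite -(@esum_esum _ _ _ _ _ (fun k b => (mixed_diff g (step_box (k :: b)) 1)%:E)); last first.
  by move=> k b _ /= /all2_size sb; rewrite lee_fin; apply: (pg (k :: b)); rewrite /= sb.
have inner k : (\esum_(b in [set b | all2 under_cap b cs])
    (mixed_diff g (step_box (k :: b)) 1)%:E = (g (z k.+1 * t) - g (z k * t))%:E)%E.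
  rewrite -[RHS]/((gk k t)%:E) -IH //.
  - by rewrite /gk !mulr0 subrr.
  - move=> y y0; rewrite /gk; apply: (@continuousB R R R (fun y => g (z k.+1 * y)) (fun y => g (z k * y))).
    + by apply: continuous_comp; [exact: mulrl_continuous|apply: cg; rewrite mulr_ge0].
    + by apply: continuous_comp; [exact: mulrl_continuous|apply: cg; rewrite mulr_ge0].
  - by move=> b sb; apply: (pg (k :: b)); rewrite /= sb.
rewrite (eq_esum (fun k _ => inner k)) big_cons.
have nd k : g (z k * t) <= g (z k.+1 * t).
  rewrite -subr_ge0 -lee_fin -inner; apply: esum_ge0 => b /= /all2_size sb.
  by rewrite lee_fin; apply: (pg (k :: b)); rewrite /= sb.
have h0 : g (z 0%N * t) = 0 by rewrite z_0 mul0r.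
case: (c) => [n|] /=; last first.
  rewrite set_true (esum_telescope (h := fun k => g (z k * t)) (l := g (1 * t))).
  - by rewrite h0 subr0.
  - exact/nondecreasing_seqP.
  - apply: (@continuous_cvg _ _ _ _ _ _ g (1 * t)); first by apply: cg; rewrite mul1r.
    by apply: cvgM => //; exact: cvg_cst.
rewrite esum_mkcond.
(* Freezing the index at n + 1 makes the increments above the cap zero, so the restricted sum is a
   telescoping sum over all k. *)
rewrite (eq_esum (b := fun k => (g (z (minn k.+1 n.+1) * t) - g (z (minn k n.+1) * t))%:E)); last first.
  move=> k _; case: ifPn; rewrite ?inE ?notin_setE /= => kn.
    by rewrite !(minn_idPl _) // ltnW.
  by rewrite !(minn_idPr _) ?subrr //; move/negP: kn; rewrite -?ltnNge; lia.
rewrite (esum_telescope (h := fun k => g (z (minn k n.+1) * t)) (l := g (z n.+1 * t))).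
- by rewrite min0n h0 subr0.
- apply/nondecreasing_seqP => k; rewrite /minn; case: ltnP => h1; case: ltnP => h2 //; last by lia.
  by have -> : n.+1 = k.+1 by lia.
- apply: cvg_near_cst; near=> k; rewrite (minn_idPr _) //.
  by near: k; exact: nbhs_infty_ge.
Unshelve. all: by end_near. Qed.

End BoxSums.

(** * Leg intervals and central sets: weights and sums *)

Section LegWeights.
Context {R : realType}.
Variables r p : R.
Hypothesis r01 : 0 < r < 1.
Hypothesis p01 : 0 < p < 1.
Local Notation q := (1 - p).

Definition leg_factor k : R := r + (1 - r) * q ^+ k.

Definition leg_gap k : R := ln (leg_factor k) - ln (leg_factor k.+1).

Let r_gt0 : 0 < r. Proof. by case/andP: r01. Qed.
Let cr_gt0 : 0 < 1 - r. Proof. by case/andP: r01 => _; rewrite subr_gt0. Qed.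
Let q_gt0 : 0 < q. Proof. by case/andP: p01 => _; rewrite subr_gt0. Qed.
Let q_lt1 : q < 1. Proof. by case/andP: p01 => p0 _; rewrite ltrBlDr ltrDl. Qed.

Lemma expr_cvg0 : (fun k => q ^+ k) @ \oo --> (0 : R).
Proof. by apply: cvg_expr; rewrite gtr0_norm. Qed.

Lemma leg_factor_gt0 k : 0 < leg_factor k.
Proof. by rewrite addr_gt0 // mulr_gt0 // exprn_gt0. Qed.

Lemma leg_gap_cvg0 : leg_gap @ \oo --> (0 : R).
Proof.
have cf : leg_factor @ \oo --> r.
  have h := cvgD (cvg_cst r) (cvgM (cvg_cst (1 - r)) expr_cvg0).
  by rewrite mulr0 addr0 in h; exact: h.
have cl : (fun k => ln (leg_factor k)) @ \oo --> ln r.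
  by apply: (@continuous_cvg _ _ _ _ _ _ (@ln R) r) => //; exact: continuous_ln.
rewrite -(subrr (ln r)); apply: cvgB => //.
by rewrite (cvg_shiftS (fun k => ln (leg_factor k))).
Qed.

(** Log-convexity of [leg_factor]: f_k f_{k+2} - f_{k+1}^2 = r (1 - r) q^k p^2. It makes the weights
    of the leg intervals nonnegative. *)
Lemma leg_gapS_le k : leg_gap k.+1 <= leg_gap k.
Proof.
have f0 := leg_factor_gt0.
rewrite -subr_ge0 /leg_gap.
have -> : ln (leg_factor k) - ln (leg_factor k.+1) - (ln (leg_factor k.+1) - ln (leg_factor k.+2)) =
    ln (leg_factor k * leg_factor k.+2) - ln (leg_factor k.+1 * leg_factor k.+1).
  by rewrite !lnM ?posrE //; ring.
rewrite subr_ge0 ler_ln ?posrE ?mulr_gt0 // -subr_ge0.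
rewrite (_ : _ - _ = r * (1 - r) * q ^+ k * p ^+ 2).
  by rewrite mulr_ge0 ?sqr_ge0 // ltW // !mulr_gt0 // exprn_gt0.
by rewrite /leg_factor !exprS; ring.
Qed.

Lemma leg_void_find a y : has id a ->
  leg_void r p a y =
  (r + (1 - r) * (q ^+ (find id a).+1 * y)) * leg_void r p (drop (find id a).+1 a) 1.
Proof.
elim: a y => [//|[] a IH] y /= ha; first by rewrite drop0 expr1.
by rewrite IH // [in RHS]exprSr !mulrA.
Qed.

Lemma leg_void_hasN a y : ~~ has id a -> leg_void r p a y = 1.
Proof. by elim: a y => [//|[] a IH] y //= /IH ->. Qed.

Lemma leg_void_gt0 a : 0 < leg_void r p a 1.
Proof.
have [n] := ubnP (size a); elim: n a => // n IH a sa.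
have [ha|ha] := boolP (has id a); last by rewrite leg_void_hasN.
rewrite leg_void_find // mulr1 mulr_gt0 //; first exact: leg_factor_gt0.
by apply: IH; rewrite size_drop; move: ha; rewrite has_find; lia.
Qed.

(** Only the factor up to the first mark changes, its distance from the start growing by 1; for a
    mark in front the new factor is compared with [leg_factor 0] = 1. *)
Lemma ln_leg_void_cons c a :
  ln (leg_void r p a 1) - ln (leg_void r p (c :: a) 1) =
  if has id (c :: a) then leg_gap (find id (c :: a)) else 0.
Proof.
have lnf k b x : x = leg_factor k * leg_void r p b 1 ->
    ln x = ln (leg_factor k) + ln (leg_void r p b 1).
  by move=> ->; apply: lnM; rewrite posrE; [exact: leg_factor_gt0|exact: leg_void_gt0].
case: c => /=.
  rewrite (lnf 1%N a (_ * _)); last by rewrite /leg_factor expr1 mulr1.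
  have f0 : leg_factor 0 = 1 by rewrite /leg_factor expr0; ring.
  by rewrite /leg_gap f0 ln1 opprD addrCA subrr addr0 add0r.
case: ifPn => ha; last by rewrite !leg_void_hasN // subrr.
set b := drop (find id a).+1 a.
rewrite (lnf (find id a).+1 b (leg_void r p a 1)); last first.
  by rewrite leg_void_find // mulr1.
rewrite (lnf (find id a).+2 b (leg_void r p a (q * 1))); last first.
  by rewrite leg_void_find // mulr1 -exprSr.
by rewrite opprD addrACA subrr addr0.
Qed.

(** An interval of l + 1 vertices starting where a starts meets a mark exactly when l >=
    [find id a]. From there on the second differences telescope, [leg_gap] tending to 0. *)
Lemma esum_leg_interval a :
  (\esum_(l in [set: nat]) ((leg_gap l - leg_gap l.+1) * (has id (take l.+1 a))%:R)%:E =
   (if has id a then leg_gap (find id a) else 0)%:E)%E.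
Proof.
case: ifPn => ha; last first.
  apply: esum1 => l _; rewrite (_ : has _ _ = false) ?mulr0 //.
  by apply: contraNF ha => h; rewrite -(cat_take_drop l.+1 a) has_cat h.
pose n := find id a.
rewrite (eq_esum (b := fun l => (- leg_gap (maxn n l.+1) - - leg_gap (maxn n l))%:E)); last first.
  move=> l _; rewrite has_take // ltnS -/n; case: leqP => h.
    by rewrite (maxn_idPr (leqW h)) mulr1 opprK addrC.
  by rewrite (maxn_idPl h) mulr0 subrr.
rewrite (esum_telescope (h := fun l => - leg_gap (maxn n l)) (l := 0)).
- by rewrite maxn0 sub0r opprK.
- apply/nondecreasing_seqP => l; rewrite lerN2 /maxn; case: ltnP => h1; case: ltnP => h2 //; last by lia.
    exact: leg_gapS_le.
  have -> : n = l by lia.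
  exact: leg_gapS_le.
- rewrite -[0]oppr0; apply: cvgN.
  apply: (@cvg_trans _ (leg_gap @ \oo)); last exact: leg_gap_cvg0.
  apply: near_eq_cvg; near=> l; rewrite (maxn_idPr _) //.
  by near: l; exact: nbhs_infty_ge.
Unshelve. all: by end_near. Qed.

Lemma leg_gap_ge0 k : 0 <= leg_gap k.
Proof.
rewrite -(cvg_lim (@Rhausdorff R) leg_gap_cvg0).
apply: nonincreasing_cvgn_ge; last exact: cvgP leg_gap_cvg0.
by apply/nonincreasing_seqP; exact: leg_gapS_le.
Qed.

(** For each starting point j the sum over lengths is an increment of ln [leg_void] along the tails
    of a, by [ln_leg_void_cons]; these telescope to the empty tail, where the logarithm is 0. *)
Lemma esum_leg a :
  (\esum_(x in [set: nat * nat])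
     ((leg_gap x.2 - leg_gap x.2.+1) * (has id (take x.2.+1 (drop x.1 a)))%:R)%:E =
   (- ln (leg_void r p a 1))%:E)%E.
Proof.
rewrite (@esum_prodtype _ _ _ (fun j l =>
  ((leg_gap l - leg_gap l.+1) * (has id (take l.+1 (drop j a)))%:R)%:E)); last first.
  by move=> j l; rewrite lee_fin mulr_ge0 // subr_ge0; exact: leg_gapS_le.
rewrite (eq_esum (fun j _ => esum_leg_interval (drop j a))).
pose h j := ln (leg_void r p (drop j a) 1).
have hE j : (if has id (drop j a) then leg_gap (find id (drop j a)) else 0) = h j.+1 - h j.
  have [ja|ja] := ltnP j (size a).
    by rewrite /h (drop_nth false ja) ln_leg_void_cons.
  by rewrite /h !drop_oversize //= ?subrr // leqW.
rewrite (eq_esum (b := fun j => (h j.+1 - h j)%:E)); last by move=> j _; rewrite hE.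
rewrite (esum_telescope (h := h) (l := 0)).
- by rewrite sub0r /h drop0.
- apply/nondecreasing_seqP => j; rewrite -subr_ge0 -hE; case: ifP => // _.
  exact: leg_gap_ge0.
- apply: cvg_near_cst; near=> j; rewrite /h drop_oversize /= ?ln1 //.
  by near: j; exact: nbhs_infty_ge.
Unshelve. all: by end_near. Qed.

Local Notation s := ((1 - r) / r).

Definition center_ratio k : R := (1 - q ^+ k) / (1 + s * q ^+ k).

Let s_gt0 : 0 < s. Proof. exact: divr_gt0. Qed.

Let den_gt0 k : 0 < 1 + s * q ^+ k.
Proof. by rewrite addr_gt0 // mulr_gt0 // exprn_gt0. Qed.

Lemma center_ratio0 : center_ratio 0 = 0.
Proof. by rewrite /center_ratio expr0 subrr mul0r. Qed.

Lemma center_ratioS_gt k : center_ratio k < center_ratio k.+1.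
Proof.
rewrite /center_ratio ltr_pdivrMr // mulrAC ltr_pdivlMr // -subr_gt0.
have qk : 0 < q ^+ k by exact: exprn_gt0.
rewrite (_ : _ - _ = (1 + s) * q ^+ k * p); last by rewrite exprS; ring.
by case/andP: p01 => p0 _; rewrite !mulr_gt0 // addr_gt0.
Qed.

Lemma center_ratio_nd : nondecreasing_seq center_ratio.
Proof. by apply/nondecreasing_seqP => k; exact/ltW/center_ratioS_gt. Qed.

Lemma center_ratio_cvg1 : center_ratio @ \oo --> (1 : R).
Proof.
have h := cvgM (cvgB (cvg_cst (1 : R)) expr_cvg0)
  (cvgV _ (cvgD (cvg_cst (1 : R)) (cvgM (cvg_cst s) expr_cvg0))).
by rewrite mulr0 addr0 subr0 invr1 mulr1 in h; apply: h; rewrite oner_neq0.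
Qed.

(** The left side starts from a center in state 1. The two starting states differ only in the factor
    up to the first mark: conditioned on state 0 there, the chain forgets the center. *)
Lemma leg_void_center a :
  leg_void r p a (- r / (1 - r)) =
  leg_void r p a 1 * cap_value center_ratio (if has id a then Some (find id a) else None).
Proof.
case: ifPn => ha; last by rewrite !leg_void_hasN // mulr1.
rewrite leg_void_find // [in RHS]leg_void_find // [RHS]mulrAC; congr (_ * _).
rewrite /cap_value /center_ratio mulr1.
have := exprn_gt0 (find id a).+1 q_gt0; set x := _ ^+ _ => x0.
have d0 : r + (1 - r) * x != 0 by rewrite gt_eqF // addr_gt0 // mulr_gt0.
have c0 : 1 - r != 0 by rewrite gt_eqF.
have -> : 1 + (1 - r) / r * x = (r + (1 - r) * x) / r by field; rewrite gt_eqF.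
by field; rewrite d0 c0 gt_eqF.
Qed.

Lemma center_ratio_ge0 k : 0 <= center_ratio k.
Proof. by rewrite -center_ratio0; exact: center_ratio_nd. Qed.

Lemma center_ratio_le1 k : center_ratio k <= 1.
Proof.
rewrite -(cvg_lim (@Rhausdorff R) center_ratio_cvg1).
by apply: nondecreasing_cvgn_le; [exact: center_ratio_nd|exact: cvgP center_ratio_cvg1].
Qed.

(** The list b has one entry per leg, zeros included, so the order of the difference is m + 3 and
    the polynomial involved is that of index m + 2. For z in (0, 1] the logistic variable stays at
    most 1 - r, hence does not pass its first root. *)
Lemma center_weight_ge0 m b : r1 R m.+3 <= r -> size b = m.+3 ->
  0 <= mixed_diff (log_weight s 0) (step_box center_ratio b) 1.
Proof.
move=> hr sb; apply: mixed_diff_log_weight_ge0 => //.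
  rewrite all_map; apply/allP => k _ /=.
  by rewrite center_ratio_ge0 center_ratioS_gt center_ratio_le1.
move=> z /andP[z0 z1]; rewrite size_map sb /log_weight.
have [x [x0 rx px] _] := logistic_poly_first_root R m.+1.
rewrite (r1E (And3 x0 rx px)) in hr.
have d0 : 0 < 1 + s * z by rewrite addr_gt0 // mulr_gt0.
have y0 : 0 < s * z / (1 + s * z) by rewrite divr_gt0 // mulr_gt0.
have : s * z / (1 + s * z) <= x.
  apply: (@le_trans _ _ (1 - r)); last by rewrite lerBlDr addrC -lerBlDr.
  rewrite ler_pdivrMr // -subr_ge0.
  have -> : (1 - r) * (1 + s * z) - s * z = (1 - r) * (1 - z).
    by field; rewrite gt_eqF.
  by rewrite mulr_ge0 ?(ltW cr_gt0) // subr_ge0.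
rewrite le_eqVlt => /predU1P[->|yx]; first by move/eqP: rx => ->.
by apply/ltW/px; rewrite y0.
Qed.

Lemma esum_center_box m (cs : seq (option nat)) : r1 R m.+3 <= r -> size cs = m.+3 ->
  (\esum_(b in [set b | all2 under_cap b cs])
     (mixed_diff (log_weight s 0) (step_box center_ratio b) 1)%:E =
   (ln (1 + s * \prod_(c <- cs) cap_value center_ratio c))%:E)%E.
Proof.
move=> hr sc; rewrite (esum_box center_ratio0 center_ratio_nd center_ratio_cvg1) //.
- exact: log_weight_at0.
- by move=> t t0; exact: continuous_log_weight.
- by move=> b sb; apply: (center_weight_ge0 hr); rewrite sb.
Qed.

Lemma esum_center_total m : r1 R m.+3 <= r ->
  (\esum_(b in [set b | size b = m.+3])
     (mixed_diff (log_weight s 0) (step_box center_ratio b) 1)%:E = (- ln r)%:E)%E.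
Proof.
move=> hr; have allN n b : all2 under_cap b (nseq n None) = (size b == n).
  by elim: n b => [|n IH] [|k b] //=; rewrite IH.
rewrite (_ : [set b | _] = [set b | all2 under_cap b (nseq m.+3 None)]).
  rewrite (esum_center_box hr) ?size_nseq // big_nseq; congr EFin.
  rewrite (_ : 1 + s * _ = r^-1) ?lnV ?posrE //.
  by rewrite iter_mulr_1 expr1n; field; rewrite gt_eqF.
by apply/eq_set => b; rewrite allN; apply/propext; split => /eqP.
Qed.

Lemma esum_center_hit m (cs : seq (option nat)) : r1 R m.+3 <= r -> size cs = m.+3 ->
  (\esum_(b in [set b | size b = m.+3 /\ ~~ all2 under_cap b cs])
     (mixed_diff (log_weight s 0) (step_box center_ratio b) 1)%:E =
   (- ln r - ln (1 + s * \prod_(c <- cs) cap_value center_ratio c))%:E)%E.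
Proof.
move=> hr sc; pose w b := (mixed_diff (log_weight s 0) (step_box center_ratio b) 1)%:E.
have w0 b : size b = m.+3 -> (0 <= w b)%E.
  by move=> sb; rewrite lee_fin; exact: center_weight_ge0 hr sb.
have box : [set b | size b = m.+3] `&` [set b | all2 under_cap b cs] = [set b | all2 under_cap b cs].
  by apply/setIidPr => b /=; rewrite all2E sc => /andP[/eqP].
have := esumID [set b | all2 under_cap b cs] [set b | size b = m.+3] w w0.
rewrite (esum_center_total hr) box (esum_center_box hr sc).
rewrite (_ : _ `&` ~` _ = [set b | size b = m.+3 /\ ~~ all2 under_cap b cs]); last first.
  by apply/seteqP; split => b [sb /negP h].
rewrite -/w; case: (\esum_(b in [set b | size b = m.+3 /\ _]) w b)%E => [x| |] //= [->].
by rewrite addrAC subrr add0r.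
Qed.

End LegWeights.

(** * The representing measure and its masses *)

Section OctopusIntensity.
Context {R : realType}.
Variables (m : nat) (r p : R).
Hypothesis r01 : 0 < r < 1.
Hypothesis p01 : 0 < p < 1.
Hypothesis r1_le : r1 R m.+3 <= r.
Local Notation V := (octopus_vertex m.+3).
Local Notation s := ((1 - r) / r).
Local Notation piece := ('I_m.+3 * (nat * nat) + seq nat)%type.

Definition piece_set (j : piece) : set V :=
  match j with
  | inl (i, (a, l)) => [set v | exists2 k, v = Some (i, k) & (a <= k < a + l.+1)%N]
  | inr b => [set v : V | if v is Some (i, k) then (k < nth 0%N b i)%N else true]
  end.

(** Central sets are indexed by all lists b; only lists with one entry per leg describe a piece, the
    others get weight 0. *)
Definition piece_weight (j : piece) : R :=
  match j with
  | inl (_, (_, l)) => leg_gap r p l - leg_gap r p l.+1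
  | inr b => if size b == m.+3
             then mixed_diff (log_weight s 0) (step_box (center_ratio r p) b) 1 else 0
  end.

Lemma piece_weight_ge0 j : 0 <= piece_weight j.
Proof.
case: j => [[i [a l]]|b] /=; first by rewrite subr_ge0; exact: leg_gapS_le.
case: eqP => // sb; exact: (center_weight_ge0 r01 p01 r1_le).
Qed.

(** Pieces are listed through their codes. A number that codes no piece carries mass 0, and [setT]
    is a filler there. *)
Definition octopus_intensity : {measure set (subsets V) -> \bar R} :=
  discrete_measure
    (fun n => if pickle_inv n is Some j then piece_set j else setT)
    (fun n => if pickle_inv n is Some j then NngNum (piece_weight_ge0 j) else 0%:nng).

Lemma octopus_intensityE (A : set (subsets V)) :
  octopus_intensity A =
  (\esum_(j in [set: piece]) (piece_weight j * ((piece_set j : subsets V) \in A)%:R)%:E)%E.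
Proof.
rewrite /octopus_intensity discrete_measureE -esum_pickle; last first.
  by move=> j; rewrite lee_fin mulr_ge0 // piece_weight_ge0.
by apply: eq_eseriesr => n _; case: pickle_inv => //; rewrite mul0r.
Qed.

Variables (F : seq V) (N : nat).
Hypothesis F_bound : forall i k, Some (i, k) \in F -> (k < N)%N.
Local Notation trace := (leg_trace F N).

Lemma hitting_interval i a l :
  ((piece_set (inl (i, (a, l))) : subsets V) \in hitting F) =
  has id (take l.+1 (drop a (trace i))).
Proof.
have szE : size (take l.+1 (drop a (trace i))) = minn l.+1 (N - a).
  by rewrite size_take_min size_drop size_mkseq.
apply/idP/(has_nthP false) => [/set_mem[v vF [k vE /andP[ak kl]]]|[k]].
  rewrite vE in vF; have kN := F_bound vF.
  exists (k - a)%N; first by rewrite szE; lia.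
  rewrite nth_take; last by lia.
  by rewrite nth_drop subnKC // nth_mkseq.
rewrite szE leq_min => /andP[kl kN]; rewrite nth_take // nth_drop nth_mkseq; last by lia.
by move=> vF; apply/mem_set; exists (Some (i, a + k)%N) => //; exists (a + k)%N => //; lia.
Qed.

Definition first_hit (a : seq bool) : option nat :=
  if has id a then Some (find id a) else None.

Lemma under_first_hit k a : under_cap k (first_hit a) = ~~ has id (take k a).
Proof.
rewrite /first_hit; case: ifPn => h; first by rewrite has_take // -leqNgt.
by apply/esym; apply: contraNN h => h; rewrite -(cat_take_drop k a) has_cat h.
Qed.

Lemma hitting_center b : size b = m.+3 ->
  ((piece_set (inr b) : subsets V) \in hitting F) =
  (None \in F) || ~~ all2 under_cap b [seq first_hit (trace i) | i <- enum 'I_m.+3].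
Proof.
move=> sb; have [NF|NF] := boolP (None \in F).
  by apply/mem_set; exists None.
rewrite orFb; have bE : b = [seq nth 0%N b (nat_of_ord i) | i <- enum 'I_m.+3].
  by rewrite (map_comp (nth 0%N b) val) val_enum_ord -sb -[LHS](mkseq_nth 0%N).
have -> : all2 under_cap b [seq first_hit (trace i) | i <- enum 'I_m.+3] =
    all (fun i : 'I_m.+3 => ~~ has id (take (nth 0%N b i) (trace i))) (enum 'I_m.+3).
  rewrite [in LHS]bE; elim: (enum _) => //= i e ->.
  by rewrite under_first_hit.
rewrite -has_predC; apply/idP/hasP => [/set_mem[[[i k]|] vF]|[i _]] /=; last 2 first.
- by rewrite vF in NF.
- rewrite negbK => /(has_nthP false)[k]; rewrite size_take_min size_mkseq leq_min => /andP[kb kN].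
  rewrite nth_take // nth_mkseq // => vF.
  by apply/mem_set; exists (Some (i, k)).
move=> kb; exists i; rewrite ?mem_enum //= negbK; apply/(has_nthP false); exists k.
  by rewrite size_take_min size_mkseq leq_min kb; exact: F_bound vF.
by rewrite nth_take // nth_mkseq //; exact: F_bound vF.
Qed.

(** The intervals of leg i contribute - ln A_i. The central sets have total mass - ln r, from which
    those missing F are subtracted; none of them misses F when F contains the center. *)
Lemma octopus_intensity_hitting :
  octopus_intensity (hitting F) =
  (\sum_i - ln (leg_void r p (trace i) 1) + (- ln r -
   (None \notin F)%:R *
     ln (1 + s * \prod_i cap_value (center_ratio r p) (first_hit (trace i)))))%:E.
Proof.
rewrite octopus_intensityE esum_sumtype; last first.
  by move=> j; rewrite lee_fin mulr_ge0 // piece_weight_ge0.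
rewrite [RHS]EFinD; congr (_ + _)%E.
  pose G (i : 'I_m.+3) (x : nat * nat) := (piece_weight (inl (i, x)) *
    ((piece_set (inl (i, x)) : subsets V) \in hitting F)%:R)%:E.
  have G0 i x : (0 <= G i x)%E by rewrite lee_fin mulr_ge0 // piece_weight_ge0.
  transitivity (\esum_(y in [set: 'I_m.+3 * (nat * nat)]) G y.1 y.2)%E.
    by apply: eq_esum => -[].
  rewrite (esum_prodtype G0).
  rewrite -sumEFin esum_fintype => [|i]; last by apply: esum_ge0.
  apply: eq_bigr => i _; rewrite -(esum_leg r01 p01).
  by apply: eq_esum => -[a l] _; rewrite /G hitting_interval.
pose cs := [seq first_hit (trace i) | i <- enum 'I_m.+3].
have csE : \prod_i cap_value (center_ratio r p) (first_hit (trace i)) =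
    \prod_(c <- cs) cap_value (center_ratio r p) c.
  by rewrite /cs big_map big_enum.
transitivity (\esum_(b in [set b | size b = m.+3 /\ ((None \in F) || ~~ all2 under_cap b cs)])
     (mixed_diff (log_weight s 0) (step_box (center_ratio r p) b) 1)%:E)%E.
  rewrite [RHS]esum_mkcond; apply: eq_esum => b _; rewrite /piece_weight.
  have [sb|sb] := eqVneq (size b) m.+3; last first.
    rewrite mul0r memNset // => -[/eqP]; by rewrite (negPf sb).
  rewrite hitting_center // -/cs; case: ifPn => [/set_mem[_ ->]|]; first by rewrite mulr1.
  rewrite notin_setE => h; case: (boolP (_ || _)) => h'; last by rewrite mulr0.
  by case: h.
case: (boolP (None \in F)) => NF /=.
  rewrite mul0r subr0 -(esum_center_total r01 p01 r1_le); congr (esum _ _).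
  by apply/seteqP; split => b // [].
by rewrite mul1r csE -(esum_center_hit r01 p01 r1_le) // size_map size_enum_ord.
Qed.

End OctopusIntensity.

Lemma leg_bound m (F : seq (octopus_vertex m)) :
  exists N, forall i k, Some (i, k) \in F -> (k < N)%N.
Proof.
elim: F => [|v F [N hN]]; first by exists 0%N.
exists (maxn (if v is Some (_, k) then k.+1 else 0%N) N) => i k.
rewrite inE leq_max => /predU1P[<-|/hN ->]; last exact: orbT.
by rewrite leqnn.
Qed.

Lemma piece_set_nonempty m j : exists v, @piece_set m j v.
Proof.
case: j => [[i [a l]]|b]; last by exists None.
by exists (Some (i, a)), a => //; rewrite leqnn addnS ltnS leq_addr.
Qed.

(** * Representation of the chain *)

Section OctopusRepresentation.
Context (R : realType).
Variables (m : nat) (r p : R).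
Hypothesis r01 : 0 < r < 1.
Hypothesis p01 : 0 < p < 1.
Hypothesis r1_le : r1 R m.+3 <= r.
Local Notation V := (octopus_vertex m.+3).
Local Notation s := ((1 - r) / r).
Local Notation nu := (octopus_intensity r01 p01 r1_le).

(** Pieces are nonempty, so the sets hitting no vertex have mass 0; all others are covered by the
    events of hitting one given vertex, each of finite mass. *)
Lemma octopus_intensity_sigma_finite : sigma_finite_on_nonempty nu.
Proof.
split.
  rewrite octopus_intensityE esum1 // => j _; rewrite memNset ?mulr0 //= => j0.
  by have [v] := piece_set_nonempty j; rewrite j0.
pose G n := if pickle_inv n is Some v then hitting [:: v : V] else set0.
have mG n : measurable (G n) by rewrite /G; case: pickle_inv => // v; exact: measurable_hitting.
exists (fun n => if n is n'.+1 then G n' else ~` \bigcup_n G n).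
  apply/seteqP; split=> // B _.
  have [[n _ GB]|nGB] := pselect ((\bigcup_n G n) B); first by exists n.+1.
  by exists 0%N.
move=> [|n].
  split; first by apply: measurableC; exact: bigcup_measurable.
  rewrite octopus_intensityE esum1 ?ltry // => j _; rewrite memNset ?mulr0 //= => h.
  have [v jv] := piece_set_nonempty j; apply: h; exists (pickle v) => //.
  by rewrite /G pickleK_inv; exists v => //; rewrite mem_head.
split=> //; rewrite /G; case: pickle_inv => [v|]; last by rewrite measure0 ltry.
have [N hN] := leg_bound [:: v].
by rewrite (octopus_intensity_hitting r01 p01 r1_le hN) ltry.
Qed.

Lemma octopus_intensity_void (F : seq V) N :
  (forall i k, Some (i, k) \in F -> (k < N)%N) -> exists2 l : R,
  nu (hitting F) = l%:E &
  expR (- l) = r * \prod_i leg_void r p (leg_trace F N i) 1 +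
    (None \notin F)%:R * ((1 - r) * \prod_i leg_void r p (leg_trace F N i) (- r / (1 - r))).
Proof.
move=> hN; eexists; first exact: (octopus_intensity_hitting r01 p01 r1_le hN).
have [r0 r1] := andP r01.
pose c i := cap_value (center_ratio r p) (first_hit (leg_trace F N i)).
under [X in _ + _ * (_ * X)]eq_bigr do rewrite leg_void_center // -/(c _).
rewrite big_split /= sumrN !opprD !opprK expRD expR_sum; set A := \prod_i leg_void _ _ _ _.
have -> : \prod_i expR (ln (leg_void r p (leg_trace F N i) 1)) = A.
  by apply: eq_bigr => i _; rewrite lnK // posrE; exact: leg_void_gt0.
set C := \prod_i c i.
have C0 : 0 <= C.
  apply: prodr_ge0 => i _; apply: cap_value_ge0; [exact: center_ratio0|exact: center_ratio_nd].
rewrite expRD lnK ?posrE //.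
case: (None \notin F); last by rewrite !mul0r expR0 mulr1 addr0 mulrC.
rewrite !mul1r lnK; first by field; rewrite gt_eqF.
by rewrite posrE ltr_pwDl // mulr_ge0 // divr_ge0 ?subr_ge0 // ltW.
Qed.

Lemma octopus_representable d (T : measurableType d) (P : probability T R) (o : V)
    (X : V -> {RV P >-> bool}) :
  tree_markov_chain (@octopus_edge m.+3) o r p X -> poisson_representable X.
Proof.
move=> chainX; exists nu; split; first exact: octopus_intensity_sigma_finite.
have [d' [T' [P' [Z hZ]]]] := poisson_process_exists
  (fun n => if pickle_inv n is Some j then @piece_set m j else setT)
  (fun n => if pickle_inv n is Some j then NngNum (piece_weight_ge0 r01 p01 r1_le j) else 0%:nng).
exists d', T', P', Z; split=> //.
apply: eq_in_distribution_void => [i|i|F]; [by []|exact: measurable_covered|].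
have [K hK] := octopus_void (ltn0Sn _) r01 chainX.
have [N hN] := leg_bound F.
have {}hN i k : Some (i, k) \in F -> (k < maxn K N)%N.
  by move=> /hN kN; rewrite leq_max kN orbT.
rewrite (hK F _ (leq_maxl K N) hN).
by have [l hl <-] := octopus_intensity_void hN; rewrite (poisson_void hZ hl).
Qed.

End OctopusRepresentation.

Lemma r1_itv (R : realType) m : 0 < r1 R m.+3 < 1.
Proof.
have [x fx _] := logistic_poly_first_root R m.+1.
rewrite (r1E fx) subr_gt0 (first_pos_root_lt1 fx) ltrBlDr ltrDl.
by case: fx.
Qed.

Theorem theorem1p3 (R : realType) :
  exists r2 : nat -> R,
    (forall m : nat, (3 <= m)%N ->
       0 < r2 m < 1 /\
       forall r p : R, 0 < r < 1 -> 0 < p < 1 ->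
       forall (d : measure_display) (T : measurableType d)
              (P : probability T R) (o : octopus_vertex m)
              (X : octopus_vertex m -> {RV P >-> bool}),
         tree_markov_chain (@octopus_edge m) o r p X ->
         (r < r1 R m -> ~ poisson_representable X) /\
         (r2 m <= r -> poisson_representable X)) /\
    r2 3%N = r1 R 3 /\ r1 R 3 = 1 / 2.
Proof.
(* Taking r2 = r1 for every m leaves of (c) only the value 1 / 2, the first positive root of P_2 = x
   (1 - x) (1 - 2 x) being 1 / 2. *)
exists (fun m => r1 R m); split; last by split=> //; exact: r1_3.
move=> [|[|[|m]]] // _; split; first exact: r1_itv.
move=> r p r01 p01 d T P o X chainX; split; last by move=> r1_le; exact: octopus_representable chainX.
by move=> rlt /(r1_le_of_representable r01 p01 chainX); rewrite leNgt rlt.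
Qed.
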